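(* Let $N>2$, let $\Omega\subset\mathbb{R}^N$ be open and bounded, let $T>0$, $Q_T=(0,T)\times\Omega$, $\gamma>0$, $2-\frac N{N+1}<q<2$ and $\sigma=\frac{N(q-1)}{2-q}$. Let $1\le\rho<\sigma$. There exists a value $\delta>0$ (only depending on $\rho,q,N$) such that, if $u_0(x)\ge|x|^{-\frac N\rho+\delta}\chi_{\{|x|<1\}}$, then the problem $$u_t-\Delta u=\gamma|Du|^q\ \text{in }Q_T,\quad u=0\ \text{on }(0,T)\times\partial\Omega,\quad u(0,x)=u_0(x)\ \text{in }\Omega$$ does not admit any renormalized solution $u$ (as defined in the context) such that $$u\in L^\infty(0,T;L^\rho(\Omega)),\qquad |u|^{\frac\rho2}\in L^2(0,T;H^1_0(\Omega)).$$
   Context: $u_0$ is a measurable function on $\Omega$; $D$ is the gradient in $x$; $T_k(v)=\max\{-k,\min\{k,v\}\}$. $\mathcal{T}^{1,2}_0(Q_T)$ is the set of measurable, a.e. finite functions $u:Q_T\to\mathbb{R}$ with $T_k(u)\in L^2(0,T;H^1_0(\Omega))$ for all $k>0$; the generalized gradient $Du$ is defined by $DT_k(u)=Du\,\chi_{\{|u|<k\}}$ for all $k>0$. Here a renormalized solution is a function $u\in\mathcal{T}^{1,2}_0(Q_T)\cap L^1(Q_T)$ with $|Du|^q\in L^1(Q_T)$ and $$-\int_\Omega S(u_0)\varphi(0,x)\,dx+\iint_{Q_T}-S(u)\varphi_t+Du\cdot D(S'(u)\varphi)\,dx\,dt=\gamma\iint_{Q_T}|Du|^qS'(u)\varphi\,dx\,dt$$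 for every $S\in W^{2,\infty}(\mathbb{R})$ such that $S'$ has compact support and every $\varphi\in C^\infty(\overline{Q_T})$ such that $\varphi(T,x)=0$ and $S'(u)\varphi\in L^2(0,T;H^1_0(\Omega))$.
   Formalization: The origin is assumed to lie in Ω: otherwise, e.g. for Ω outside the unit ball, the lower bound on u_0 only says u_0 ≥ 0, and u_0 = 0, u = 0 is a renormalized solution in the stated class; measurable functions are taken Borel, i.e. up to null sets. *)

(* Defs.v *)
From HB Require Import structures.
From mathcomp Require Import all_boot all_order all_algebra.
From mathcomp Require Import all_classical all_reals all_analysis.

Set Implicit Arguments.
Unset Strict Implicit.
Unset Printing Implicit Defensive.

Import Order.TTheory GRing.Theory Num.Theory.
Import numFieldNormedType.Exports.

Local Open Scope classical_set_scope.
Local Open Scope ring_scope.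

Section borel_rV.
Context (R : realType) (n : nat).

Let coor (i : 'I_n) (x : 'rV[R]_n) : R := x ord0 i.

Let rV_set0 : g_sigma_preimage coor set0.
Proof. exact: sigma_algebra0. Qed.

Let rV_setC A : g_sigma_preimage coor A -> g_sigma_preimage coor (~` A).
Proof. exact: sigma_algebraC. Qed.

Let rV_bigcup (F : (set 'rV[R]_n)^nat) :
  (forall i, g_sigma_preimage coor (F i)) ->
  g_sigma_preimage coor (\bigcup_i (F i)).
Proof. exact: sigma_algebra_bigcup. Qed.

(* The product sigma-algebra of R^n, which is also its Borel sigma-algebra. *)
HB.instance Definition _ := @isMeasurable.Build
  (measure_tuple_display default_measure_display)
  'rV[R]_n (g_sigma_preimage coor) rV_set0 rV_setC rV_bigcup.

Lemma measurable_coor (i : 'I_n) :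
  measurable_fun [set: 'rV[R]_n] (fun x : 'rV[R]_n => x ord0 i).
Proof.
move=> _ Y mY; rewrite setTI; apply: sub_sigma_algebra => /=.
rewrite -bigcup_seq/=; exists i => /=; first by rewrite mem_index_enum.
by exists Y => //; rewrite setTI.
Qed.

Lemma measurable_rVP d (T : measurableType d) (f : T -> 'rV[R]_n) :
  (forall i, measurable_fun [set: T] (fun x => f x ord0 i)) ->
  measurable_fun [set: T] f.
Proof.
move=> mf _ A mA; rewrite setTI.
have : g_sigma_preimage (fun i => coor i \o f) (f @^-1` A).
  rewrite (g_sigma_preimage_comp coor); exists A => //.
  by rewrite setTI.
move: (f @^-1` A); apply: smallest_sub; first exact: sigma_algebra_measurable.
rewrite -bigcup_seq/= => B [i _] [C mC <-].
exact: mf.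
Qed.

End borel_rV.

Section lebesgue_rV.
Context (R : realType).
Local Notation mR := (measurableTypeR R).

Definition consrV n (p : mR * 'rV[R]_n) : 'rV[R]_n.+1 :=
  row_mx ((p.1 : R)%:M : 'rV_1) p.2.

Definition unconsrV n (x : 'rV[R]_n.+1) : mR * 'rV[R]_n :=
  (x ord0 ord0, rsubmx (x : 'rV_(1 + n))).

Lemma consrVK n : cancel (@consrV n) (@unconsrV n).
Proof.
move=> [a x]; rewrite /unconsrV /consrV row_mxKr/=; congr pair.
have -> : ord0 = lshift n (ord0 : 'I_1) by exact: val_inj.
by rewrite (@row_mxEl _ 1 1 n) mxE.
Qed.

Lemma measurable_consrV n : measurable_fun [set: mR * 'rV[R]_n] (@consrV n).
Proof.
apply: measurable_rVP => i.
case: (splitP (i : 'I_(1 + n))) => j ij.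
  have -> : i = lshift n j by exact: val_inj.
  rewrite (_ : (fun _ => _) = fst); first exact: measurable_fst.
  by apply/funext => p; rewrite /consrV (@row_mxEl _ 1 1 n) (ord1 j) mxE.
have -> : i = rshift 1 j by exact: val_inj.
rewrite (_ : (fun _ => _) = (fun x : 'rV[R]_n => x ord0 j) \o snd).
  exact: (measurableT_comp (measurable_coor j) measurable_snd).
by apply/funext => p; rewrite /consrV (@row_mxEr _ 1 1 n).
Qed.

Lemma measurable_unconsrV n : measurable_fun [set: 'rV[R]_n.+1] (@unconsrV n).
Proof.
apply/measurable_fun_pair => /=; first exact: measurable_coor.
apply: measurable_rVP => i.
rewrite (_ : (fun _ => _) = (fun x : 'rV[R]_n.+1 => x ord0 (rshift 1 i))).
  exact: measurable_coor.
by apply/funext => x; rewrite mxE.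
Qed.

Section step.
Context (n : nat) (mu : {sigma_finite_measure set 'rV[R]_n -> \bar R}).

Definition lebesgueS : set 'rV[R]_n.+1 -> \bar R :=
  pushforward (@lebesgue_measure R \x mu)%E (@consrV n).

Let lebesgueS0 : lebesgueS set0 = 0%E.
Proof. by rewrite /lebesgueS /pushforward preimage_set0 measure0. Qed.

Let lebesgueS_ge0 A : (0 <= lebesgueS A)%E.
Proof. exact: (measure_ge0 (@lebesgue_measure R \x mu)%E). Qed.

Let measurable_preimage_consrV A :
  measurable A -> measurable (@consrV n @^-1` A).
Proof.
by move=> mA; rewrite -[X in measurable X]setTI; exact: measurable_consrV.
Qed.

Let lebesgueS_sigma_additive : semi_sigma_additive lebesgueS.
Proof.
move=> F mF tF mUF; rewrite /lebesgueS /pushforward preimage_bigcup.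
apply: measure_semi_sigma_additive.
- by move=> i; exact: measurable_preimage_consrV.
- apply/trivIsetP => i j _ _ ij; rewrite -preimage_setI.
  by move/trivIsetP : tF => /(_ i j Logic.I Logic.I ij) ->; rewrite preimage_set0.
- by rewrite -preimage_bigcup; exact: measurable_preimage_consrV.
Qed.

HB.instance Definition _ := isMeasure.Build _ _ _ lebesgueS
  lebesgueS0 lebesgueS_ge0 lebesgueS_sigma_additive.

Let lebesgueS_sigma_finite : sigma_finite setT lebesgueS.
Proof.
have /sigma_finiteP[F [FT ndF Foo]] := sigma_finiteT (@lebesgue_measure R).
have /sigma_finiteP[G [GT ndG Goo]] := sigma_finiteT mu.
exists (fun i => @unconsrV n @^-1` (F i `*` G i)).
  apply/esym/seteqP; split=> // x _.
  have : setT (unconsrV x).1 by [].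
  have : setT (unconsrV x).2 by [].
  rewrite {1}FT {1}GT => -[k _ Gk] [l _ Fl].
  exists (maxn l k) => //; split.
  - by move: Fl; exact/subsetPset/ndF/leq_maxl.
  - by move: Gk; exact/subsetPset/ndG/leq_maxr.
move=> i; have [mF Fi] := Foo i; have [mG Gi] := Goo i; split.
  rewrite -[X in measurable X]setTI; apply: measurable_unconsrV => //.
  exact: measurableX.
rewrite /lebesgueS /pushforward -comp_preimage.
rewrite (_ : _ \o _ = id); last by apply/funext => p; exact: consrVK.
by rewrite preimage_id product_measure1E// lte_mul_pinfty// ge0_fin_numE.
Qed.

HB.instance Definition _ :=
  Measure_isSigmaFinite.Build _ _ _ lebesgueS lebesgueS_sigma_finite.

End step.

Fixpoint lebesgue_rV (n : nat) : {sigma_finite_measure set 'rV[R]_n -> \bar R} :=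
  if n is n'.+1 then lebesgueS (lebesgue_rV n')
  else @dirac _ 'rV[R]_0 0 R.

(* Lebesgue measure on space-time R x R^n; the time variable comes first. *)
Definition lebesgue_st (n : nat) :
    {measure set (mR * 'rV[R]_n) -> \bar R} :=
  (@lebesgue_measure R \x lebesgue_rV n)%E.

End lebesgue_rV.

(* L^p on a subset D of the underlying space, by extension by zero. *)
Definition Lp_norm d (T : measurableType d) (R : realType)
    (mu : {measure set T -> \bar R}) (p : \bar R) (D : set T) (f : T -> R) :
    \bar R :=
  'N[mu]_p[EFin \o (f \_ D)]%E.

Definition in_Lp d (T : measurableType d) (R : realType)
    (mu : {measure set T -> \bar R}) (p : \bar R) (D : set T) (f : T -> R) :
    Prop :=
  f \_ D \in Lfun mu p.

Section smooth_functions.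
Context (R : realType) (E : normedModType R).
Implicit Types (U : set E) (f : E -> R).

Definition iter_derive (vs : seq E) f : E -> R :=
  foldr (fun v g => 'D_v g) f vs.

(* C^infty on an open set: all iterated directional derivatives exist and are
   differentiable. *)
Definition smooth_on U f : Prop :=
  forall vs x, U x -> differentiable (iter_derive vs f) x.

(* C^infty(closure U) for U open: f is smooth in U, and f and all its
   derivatives extend continuously to closure U (f itself being the
   extension). *)
Definition smooth_closure U f : Prop :=
  [/\ smooth_on U f,
      {within closure U, continuous f} &
      forall vs, exists2 g : E -> R, {within closure U, continuous g} &
        forall x, U x -> g x = iter_derive vs f x].

Definition supp f : set E := closure [set x | f x != 0].

(* C_c^infty(U) *)
Definition test_function U f : Prop :=
  [/\ smooth_on setT f, compact (supp f) & supp f `<=` U].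

End smooth_functions.

Section sobolev.
Context (R : realType) (N : nat).
Implicit Types (Om : set 'rV[R]_N) (v : 'rV[R]_N -> R)
  (G : 'rV[R]_N -> 'rV[R]_N) (x y : 'rV[R]_N).

Local Notation leb := (@lebesgue_rV R N).

Definition dot x y : R := \sum_(i < N) x 0 i * y 0 i.

(* The library's norm on 'rV is the sup norm. *)
Definition enorm x : R := Num.sqrt (dot x x).

Definition dx (i : 'I_N) v : 'rV[R]_N -> R := 'D_(delta_mx 0 i) v.

Definition weak_gradient Om v G : Prop :=
  forall phi, test_function Om phi -> forall i : 'I_N,
    \int[leb]_(x in Om) (v x * dx i phi x) =
    - (\int[leb]_(x in Om) (G x 0 i * phi x)).

(* v belongs to H^1(Om) and its weak gradient is G *)
Definition H1 Om v G : Prop :=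
  [/\ in_Lp leb 2%:E Om v, forall i, in_Lp leb 2%:E Om (fun x => G x 0 i)
    & weak_gradient Om v G].

(* v belongs to H^1_0(Om), the closure of C_c^infty(Om) in H^1(Om), and its
   weak gradient is G *)
Definition H10 Om v G : Prop :=
  H1 Om v G /\
  exists phi : nat -> 'rV[R]_N -> R,
    [/\ forall n, test_function Om (phi n),
        Lp_norm leb 2%:E Om (phi n \- v) @[n --> \oo] --> 0%E &
        forall i, Lp_norm leb 2%:E Om (dx i (phi n) \- (fun x => G x 0 i))
          @[n --> \oo] --> 0%E].

End sobolev.

Section one_dimensional_sobolev.
Context (R : realType).
Implicit Types S : R -> R.
Local Notation leb1 := (@lebesgue_measure R).

Definition weak_derivative (f g : R -> R) : Prop :=
  forall psi : R -> R, test_function setT psi ->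
    \int[leb1]_s (f s * derive1 psi s) = - (\int[leb1]_s (g s * psi s)).

(* W^{2,infty}(R); among the functions equal a.e. to S, we take the C^1
   representative, so that S and S' can be evaluated pointwise. *)
Definition W2infty S : Prop :=
  [/\ forall s, derivable S s 1, continuous (derive1 S) &
      exists S1 S2 : R -> R,
        [/\ in_Lp leb1 +oo%E setT S, in_Lp leb1 +oo%E setT S1,
            in_Lp leb1 +oo%E setT S2,
            weak_derivative S S1 & weak_derivative S1 S2]].

End one_dimensional_sobolev.

Section parabolic.
Context (R : realType) (N : nat) (Om : set 'rV[R]_N) (T : R).
Implicit Types (u w : R * 'rV[R]_N -> R) (G : R * 'rV[R]_N -> 'rV[R]_N).

Local Notation leb := (@lebesgue_rV R N).
Local Notation lebst := (@lebesgue_st R N).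

Definition Q_T : set (R * 'rV[R]_N) := `]0, T[%classic `*` Om.

(* w belongs to L^2(0,T; H^1_0(Om)) and its gradient in x is G. Joint
   measurability of w and G on Q_T stands for strong measurability of
   t |-> w(t, .), the two being equivalent since H^1_0(Om) is separable. *)
Definition L2H10 w G : Prop :=
  [/\ in_Lp lebst 2%:E Q_T w,
      forall i, in_Lp lebst 2%:E Q_T (fun z => G z 0 i) &
      {ae @lebesgue_measure R, forall t, t \in `]0, T[ ->
        H10 Om (fun x => w (t, x)) (fun x => G (t, x))}].

Definition in_L2H10 w : Prop := exists G, L2H10 w G.

Definition in_LinftyLp (p : R) w : Prop :=
  measurable_fun Q_T w /\
  exists M : R, {ae @lebesgue_measure R, forall t, t \in `]0, T[ ->
    (Lp_norm leb p%:E Om (fun x => w (t, x)) <= M%:E)%E}.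

Definition truncation (k s : R) : R := Num.max (- k) (Num.min k s).

(* T^{1,2}_0(Q_T); a.e. finite functions are represented by real-valued ones. *)
Definition T120 u : Prop :=
  measurable_fun Q_T u /\
  forall k, 0 < k -> in_L2H10 (fun z => truncation k (u z)).

(* Du is the generalized gradient of u. *)
Definition generalized_gradient u (Du : R * 'rV[R]_N -> 'rV[R]_N) : Prop :=
  measurable_fun Q_T Du /\
  forall k G, 0 < k -> L2H10 (fun z => truncation k (u z)) G ->
    {ae lebst, forall z, Q_T z ->
      G z = (if `|u z| < k then Du z else 0)}.

(* D is the gradient of S'(u) phi, and 'D_(1, 0) is the time derivative. *)
Definition renormalized_solution (gamma q : R) (u0 : 'rV[R]_N -> R) u : Prop :=
  [/\ T120 u, in_Lp lebst 1%:E Q_T u &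
   exists Du : R * 'rV[R]_N -> 'rV[R]_N,
   [/\ generalized_gradient u Du,
       in_Lp lebst 1%:E Q_T (fun z => enorm (Du z) `^ q) &
       forall (S : R -> R) (phi : R * 'rV[R]_N -> R)
         (D : R * 'rV[R]_N -> 'rV[R]_N),
         W2infty S -> compact (supp (derive1 S)) ->
         smooth_closure Q_T phi ->
         (forall x, closure Om x -> phi (T, x) = 0) ->
         L2H10 (fun z => derive1 S (u z) * phi z) D ->
         - (\int[leb]_(x in Om) (S (u0 x) * phi (0, x)))
         + (\int[lebst]_(z in Q_T)
              (- S (u z) * 'D_(1, 0) phi z + dot (Du z) (D z)))
         = gamma * (\int[lebst]_(z in Q_T)
                     (enorm (Du z) `^ q * derive1 S (u z) * phi z))]].

End parabolic.

(* Main.v *)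
Require Import Defs.
From mathcomp Require Import all_boot all_order all_algebra.
From mathcomp Require Import all_classical all_reals all_analysis.
From mathcomp Require Import measurable_realfun ess_sup_inf.
From mathcomp Require Import ring lra.
Import Order.TTheory GRing.Theory Num.Theory.
Import numFieldNormedType.Exports.
Local Open Scope classical_set_scope.
Local Open Scope ring_scope.

(** Two scales r < l = r^(1-eps) are compared on a parabolic cylinder of duration
    tau = r^t.  Let S be a smooth truncation at a high level k and G the gradient
    of the truncation of u.  Testing the equation with a cutoff concentrated on the
    box of size r and on [0, tau] shows that a time average over [0, tau] of the
    mean of S(u) on that box is at least of the order of the mean of the initial
    datum, hence of r^-b with b = N/rho - delta, up to an error of order
    r^-q' tau, where q' = q/(q-1).  The mean on the box of size l is at most of
    order l^(-N/rho), by the L^oo(L^rho) bound.  The difference of the two means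
    is the integral of S'(u) G against an explicit vector field of size r^(1-N)
    on the box of size l.  The L^1 norm of S'(u) G is bounded by interpolation,
    |G| <= lam + lam^(1-q) |G|^q, from the dissipation of |G|^q, which the equation
    tested at scale 2l controls.  Since rho < sigma, the exponents t, eps, delta and
    the power lam of r can be chosen so that every upper bound is o(r^-b) as
    r -> 0, a contradiction.

    The integral of |S''(u)| |G|^2 tends to 0 as k -> oo, because |S''| <= C/k and
    |G|^2 <= C |u| |D |u|^(rho/2)|^2 where |u| > 1: this is the only use of
    |u|^(rho/2) in L^2(H^1_0). *)

Set Implicit Arguments.
Unset Strict Implicit.
Unset Printing Implicit Defensive.

(** * Smooth functions *)

(** On the box of size r alone nothing contradicts: the L^oo(L^rho) bound allows means of order
    r^(-N/rho), above r^-b. On the box of size l it allows only r^(-(1-eps)N/rho), below r^-b; hence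
    the second scale, at the price of an oscillation term. There lam is slightly below r^(-b-1), the
    gradient of a profile of height r^-b and width r.

    The duration is squeezed from both sides: r^-q' tau wants tau short, the factor tau^-1 in the
    oscillation wants it long. As eps -> 0 the window is max(0, 1 + A - B) < t < q + B(q-1) with A =
    1/(q-1), B = N/rho. It is nonempty because rho < sigma reads A < B + 1.

    Young's inequality must absorb G . D chi into half of gamma |G|^q chi, so the cutoffs have to
    satisfy |D chi| <= C chi^(1/q); this is why they are built from exp(-1/x).

    The gradient of u is accessible only through truncations, and the chain rule in H^1_0 is
    established for smooth functions vanishing at 0. All nonlinearities are therefore smooth,
    including the function of ln |u| that compares u with |u|^(rho/2). *)

Notation smooth := (smooth_on setT).

Section smooth_calculus.
Context (R : realType) (E : normedModType R).
Implicit Types (f g : E -> R) (x v : E).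

Lemma smooth_differentiable f x : smooth f -> differentiable f x.
Proof. by move=> /(_ [::] x Logic.I). Qed.

Lemma smooth_derivable f x v : smooth f -> derivable f x v.
Proof. by move=> sf; apply/diff_derivable/smooth_differentiable. Qed.

Lemma smooth_continuous f : smooth f -> continuous f.
Proof. by move=> sf x; apply/differentiable_continuous/smooth_differentiable. Qed.

Lemma smooth_derive f v : smooth f -> smooth ('D_v f).
Proof.
move=> sf vs x _; have := sf (rcons vs v) x Logic.I.
by rewrite /iter_derive foldr_rcons.
Qed.

End smooth_calculus.

Section smooth_operations.
Context (R : realType) (E : normedModType R).
Implicit Types (f g : E -> R) (x v : E).

(** Smoothness quantifies over lists of directions; it follows by invariance once a class of
    differentiable functions is stable under every directional derivative. Most smoothness proofs
    below amount to the choice of such a class. *)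
Lemma smooth_ind (P : (E -> R) -> Prop) :
  (forall f, P f -> (forall x, differentiable f x) /\ forall v, P ('D_v f)) ->
  forall f, P f -> smooth f.
Proof.
move=> PD f Pf vs x _.
suff /PD[+ _] : P (iter_derive vs f) by exact.
by elim: vs => [//|v vs /= /PD[_]]; exact.
Qed.

Lemma derive_comp1 (F : R -> R) g x v :
  differentiable F (g x) -> differentiable g x ->
  'D_v (F \o g) x = 'D_1 F (g x) * 'D_v g x.
Proof.
move=> dF dg; rewrite deriveE; last exact: differentiable_comp.
rewrite diff_comp//= !deriveE//.
rewrite -[in LHS](mulr1 ('d g x v)).
by rewrite [LHS](linearZ_LR ('d F (g x)) ('d g x v) 1) mulrC.
Qed.

(** The derivative of a product or of a composition is a sum of products, so no single operation
    gives a class stable under differentiation; the closure under all three does. *)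
Inductive smooth_expr : (E -> R) -> Prop :=
| SmoothAtom f : smooth f -> smooth_expr f
| SmoothAdd f g : smooth_expr f -> smooth_expr g -> smooth_expr (f + g)
| SmoothMul f g : smooth_expr f -> smooth_expr g -> smooth_expr (f * g)
| SmoothComp (F : R -> R) g : smooth F -> smooth_expr g -> smooth_expr (F \o g).

Lemma smooth_exprP f : smooth_expr f -> smooth f.
Proof.
apply: smooth_ind => {}f; elim.
- move=> {}f sf; split=> [x|v]; first exact: smooth_differentiable.
  exact/SmoothAtom/smooth_derive.
- move=> {}f g cf [df Df] cg [dg Dg]; split=> [x|v].
    exact: differentiableD.
  rewrite (_ : 'D_v _ = 'D_v f + 'D_v g); first exact: SmoothAdd.
  by apply/funext => x; rewrite deriveD//; exact: diff_derivable.
- move=> {}f g cf [df Df] cg [dg Dg]; split=> [x|v].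
    exact: differentiableM.
  rewrite (_ : 'D_v _ = f * 'D_v g + g * 'D_v f).
    by apply: SmoothAdd; apply: SmoothMul.
  by apply/funext => x; rewrite deriveM//; exact: diff_derivable.
- move=> F g sF cg [dg Dg]; split=> [x|v].
    by apply: differentiable_comp => //; exact: smooth_differentiable.
  rewrite (_ : 'D_v _ = ('D_1 F \o g) * 'D_v g).
    by apply: SmoothMul => //; apply: SmoothComp => //; exact: smooth_derive.
  apply/funext => x; rewrite derive_comp1//.
  exact: smooth_differentiable.
Qed.

Lemma smoothD f g : smooth f -> smooth g -> smooth (f + g).
Proof. by move=> sf sg; apply/smooth_exprP/SmoothAdd; exact: SmoothAtom. Qed.

Lemma smoothM f g : smooth f -> smooth g -> smooth (f * g).
Proof. by move=> sf sg; apply/smooth_exprP/SmoothMul; exact: SmoothAtom. Qed.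

Lemma smooth_comp (F : R -> R) g : smooth F -> smooth g -> smooth (F \o g).
Proof. by move=> sf sg; apply/smooth_exprP/SmoothComp => //; exact: SmoothAtom. Qed.

Lemma smooth_cst (c : R) : smooth (cst c : E -> R).
Proof.
apply: (@smooth_ind (fun f => exists c, f = cst c)); last by exists c.
move=> f [{}c ->]; split=> [x|v]; first exact: differentiable_cst.
by exists 0; apply/funext => x; rewrite derive_cst.
Qed.

Lemma smooth_prod (I : Type) (r : seq I) (F : I -> E -> R) :
  (forall i, smooth (F i)) -> smooth (fun x => \prod_(i <- r) F i x).
Proof.
move=> sF; elim: r => [|i r IH].
  under eq_fun do rewrite big_nil; exact: smooth_cst.
under eq_fun do rewrite big_cons; exact: smoothM.
Qed.

Lemma supp_sub f g : (forall x, g x = 0 -> f x = 0) -> supp f `<=` supp g.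
Proof.
by move=> fg; apply: closureS => x /=; apply: contra_neq; exact: fg.
Qed.

Lemma supp_out f x : ~ supp f x -> \forall y \near x, f y = 0.
Proof.
move=> nx; have : nbhs x (~` supp f).
  by apply: open_nbhs_nbhs; split => //; apply: closed_openC; exact: closed_closure.
apply: filterS => y ny; apply: contrapT => fy; apply: ny.
by apply: subset_closure => /=; apply/eqP.
Qed.

Lemma supp_derive f v : supp ('D_v f) `<=` supp f.
Proof.
rewrite /supp [X in _ `<=` X](closure_id _).1; last exact: closed_closure.
apply: closureS => x /= /eqP dfx; apply: contrapT => /supp_out f0; apply: dfx.
rewrite (@near_eq_derive _ _ _ f (cst 0)); first by rewrite derive_cst.
exact: f0.
Qed.

Lemma supp_compact f g :
  (forall x, g x = 0 -> f x = 0) -> compact (supp g) -> compact (supp f).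
Proof.
move=> /supp_sub fg cg; apply: (subclosed_compact _ cg fg).
exact: closed_closure.
Qed.

Lemma compact_supp_bounded f : continuous f -> compact (supp f) ->
  exists2 M, 0 <= M & forall x, `|f x| <= M.
Proof.
move=> cf kf.
have /compact_bounded[M [_ Mb]] : compact (f @` supp f).
  by apply: continuous_compact => //; exact: continuous_subspaceT.
exists (Num.max M 0 + 1); first by rewrite addr_ge0// le_max lexx orbT.
move=> x; have [->|fx] := eqVneq (f x) 0.
  by rewrite normr0 addr_ge0// le_max lexx orbT.
apply: Mb; first by rewrite (@le_lt_trans _ _ (Num.max M 0)) ?le_max ?lexx// ltrDl.
by exists x => //; exact: subset_closure.
Qed.

End smooth_operations.

Section smooth_line.
Context (R : realType).
Implicit Types f g : R -> R.

Lemma smooth_id : smooth (id : R -> R).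
Proof.
apply: (@smooth_ind _ _ (fun f => f = id \/ smooth f)); last by left.
move=> f [->|sf]; split=> [x|v]; last 2 first.
- exact: smooth_differentiable.
- by right; exact: smooth_derive.
- by apply/derivable1_diffP; exact: derivable_id.
- right; rewrite (_ : 'D_v id = cst v); first exact: smooth_cst.
  by apply/funext => x; rewrite derive_id.
Qed.

Lemma smooth_derive1 f : smooth f -> smooth (derive1 f).
Proof.
move=> sf; rewrite (_ : derive1 f = 'D_1 f); first exact: smooth_derive.
by apply/funext => x; rewrite derive1E.
Qed.

Lemma derive_derive1 f x v : differentiable f x -> 'D_v f x = derive1 f x * v.
Proof.
move=> df; rewrite derive1E !deriveE//.
by rewrite -[in LHS](mulr1 v) [LHS](linearZ_LR ('d f x) v 1) mulrC.
Qed.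

(** On the line every directional derivative is a constant multiple of the derivative in direction
    1, so stability under that derivative and under scaling suffices. *)
Lemma smooth1_ind (P : (R -> R) -> Prop) :
  (forall f, P f -> exists2 g, P g & forall x : R, is_derive x 1 f (g x)) ->
  (forall f (c : R), P f -> P (f * cst c)) ->
  forall f, P f -> smooth f.
Proof.
move=> PD PZ; apply: smooth_ind => f /PD[g Pg fg]; split=> [x|v].
  by apply/derivable1_diffP; have [] := fg x.
rewrite (_ : 'D_v f = g * cst v); first exact: PZ.
apply/funext => x; rewrite derive_derive1; last first.
  by apply/derivable1_diffP; have [] := fg x.
by rewrite derive1E; have [_ ->] := fg x.
Qed.

Lemma smooth_is_derive f (x : R) : smooth f -> is_derive x 1 f (derive1 f x).
Proof. by move=> sf; rewrite derive1E; apply/derivableP/smooth_derivable. Qed.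

Lemma smooth_primitive f g : smooth g -> (forall x : R, is_derive x 1 f (g x)) -> smooth f.
Proof.
move=> sg fg; apply: (@smooth_ind _ _ (fun h => h = f \/ smooth h)); last by left.
move=> h [->|sh]; split=> [x|v].
- by apply/derivable1_diffP; have [] := fg x.
- right; rewrite (_ : 'D_v f = g * cst v); last first.
    apply/funext => x; rewrite derive_derive1; last first.
      by apply/derivable1_diffP; have [] := fg x.
    by rewrite derive1E; have [_ ->] := fg x.
  by apply: smoothM => //; exact: smooth_cst.
- exact: smooth_differentiable.
- by right; exact: smooth_derive.
Qed.

Lemma derive1_lipschitz f (K : R) : (forall x : R, derivable f x 1) ->
  (forall x, `|derive1 f x| <= K) -> forall x y, `|f x - f y| <= K * `|x - y|.
Proof.
move=> df Kf x y.
wlog xy : x y / x < y.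
  move=> H; have [xy|xy|->] := ltgtP x y; first exact: H.
    by rewrite distrC (distrC x); exact: H.
  by rewrite !subrr normr0 mulr0.
have df1 (z : R) : z \in `]x, y[ -> is_derive z 1 f (derive1 f z).
  by move=> _; rewrite derive1E; exact: derivableP.
have cf : {within `[x, y], continuous f}.
  apply: continuous_subspaceT => z.
  by apply/differentiable_continuous/derivable1_diffP.
have [z _] := MVT xy df1 cf.
by rewrite distrC (distrC x) => ->; rewrite normrM ler_wpM2r.
Qed.

End smooth_line.

(** * Smooth cutoffs *)

Section smooth_families.
Context (R : realType) (I : Type) (e : I -> R -> R).

Inductive family_span : (R -> R) -> Prop :=
| SpanAtom i : family_span (e i)
| SpanAdd f g : family_span f -> family_span g -> family_span (f + g)
| SpanScale f (c : R) : family_span f -> family_span (f * cst c).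

(** The linear span of such a family is stable under differentiation. This covers [flat k] and
    [log_comp b j], whose derivatives stay in the family with a higher negative power. *)
Lemma smooth_family :
  (forall i, exists a j b k, forall x : R,
     is_derive x 1 (e i) (a * e j x + b * e k x)) ->
  forall i, smooth (e i).
Proof.
move=> eD i; apply: (@smooth1_ind _ family_span); last exact: SpanAtom.
  move=> f; elim=> {i f} [i|f g _ [f' sf df] _ [g' sg dg]|f c _ [f' sf df]].
  - have [a [j [b [k Dx]]]] := eD i.
    exists (e j * cst a + e k * cst b).
      by apply: SpanAdd; apply: SpanScale; exact: SpanAtom.
    move=> x; have := Dx x.
    by rewrite [a * _]mulrC [b * _]mulrC; exact.
  - exists (f' + g'); first exact: SpanAdd.
    by move=> x; exact: is_deriveD.
  - exists (f' * cst c); first exact: SpanScale.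
    move=> x; have dfx := df x; apply: is_derive_eq.
    by rewrite scaler0 add0r [LHS]mulrC.
by move=> f c; exact: SpanScale.
Qed.

End smooth_families.

Section flat.
Context (R : realType).
Implicit Types (x y : R) (k : nat).

(** With [y = c / x] this is the inverse of [(y / k.+1) ^+ k.+1 <= expR y], obtained by raising
    [s <= expR s] at [s = y / k.+1] to the power [k.+1]. *)
Lemma expRN_le_pow k (c x : R) : 0 < c -> 0 < x ->
  expR (- (c / x)) <= (k.+1%:R / c) ^+ k.+1 * x ^+ k.+1.
Proof.
move=> c0 x0; set y := c / x.
have y0 : 0 < y by rewrite divr_gt0.
have k0 : (0 : R) < k.+1%:R by rewrite ltr0n.
have : (y / k.+1%:R) ^+ k.+1 <= expR y.
  have {2}-> : y = y / k.+1%:R * k.+1%:R by rewrite divfK// gt_eqF.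
  rewrite expRM_natr; apply: lerXn2r; rewrite ?nnegrE ?expR_ge0//.
    by rewrite divr_ge0// ltW.
  by apply: le_trans (expR_ge1Dx _); rewrite lerDr.
have yk0 : 0 < (y / k.+1%:R) ^+ k.+1 by rewrite exprn_gt0// divr_gt0.
rewrite -lef_pV2 ?posrE ?expR_gt0// -expRN => /le_trans; apply.
rewrite -exprVn -exprMn (_ : (y / _)^-1 = k.+1%:R / c * x)// /y.
by field; rewrite !gt_eqF.
Qed.

(** The power [x ^- k] makes the derivatives of the classical flat function exp(-1/x) stay in one
    family. *)
Definition flat k x : R := if 0 < x then x ^- k * expR (- x^-1) else 0.

Lemma flat_ge0 k x : 0 <= flat k x.
Proof.
by rewrite /flat; case: ifPn => // x0; rewrite mulr_ge0 ?expR_ge0// invr_ge0 exprn_ge0// ltW.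
Qed.

Lemma flat_gt0 k x : 0 < x -> 0 < flat k x.
Proof.
by move=> x0; rewrite /flat x0 mulr_gt0 ?expR_gt0// invr_gt0 exprn_gt0.
Qed.

Lemma is_derive_quadratic (f : R -> R) (x M : R) :
  (forall h, `|f (x + h) - f x| <= M * h ^+ 2) -> is_derive x 1 f 0.
Proof.
move=> fM; have M0 : 0 <= M by have := fM 1; rewrite expr1n mulr1; exact: le_trans.
suff cv : (fun h => h^-1 *: ((f \o shift x) (h *: (1 : R)) - f x)) @ 0^' --> (0 : R).
  by apply: DeriveDef; [apply/cvg_ex; exists 0|apply/cvg_lim].
have M1 : 0 < M + 1 by rewrite ltr_wpDl.
apply/cvgrPdist_le => /= e e0; near=> h.
have h0 : h != 0 by near: h; exact: nbhs_dnbhs_neq.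
have hM : `|h| <= e / (M + 1).
  by near: h; apply: dnbhs0_le; rewrite divr_gt0.
rewrite ler_pdivlMr// mulrC in hM.
rewrite sub0r normrN normrM normfV /= [_ *: 1]mulr1 (addrC h) ler_pdivrMl ?normr_gt0//.
rewrite (le_trans (fM h))//.
rewrite -(real_normK (num_real h)) expr2 mulrCA ler_wpM2l//.
by apply: le_trans hM; rewrite ler_wpM2r// lerDl.
Unshelve. all: by end_near. Qed.

(** Only the origin is delicate: [expRN_le_pow] with exponent [k.+2] leaves a factor [h ^+ 2] after
    division by [h ^+ k], so the derivative there is 0. The factor [1] gives the shape asked by
    [smooth_family]. *)
Lemma is_derive_flat k x :
  is_derive x 1 (flat k) (- k%:R * flat k.+1 x + 1 * flat k.+2 x).
Proof.
have [x0|x0|->] := ltgtP x 0.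
- rewrite /flat ltNge (ltW x0)/= !mulr0 addr0.
  apply: (near_eq_is_derive _ (is_derive_cst (0 : R) x 1)).
  near=> y; rewrite ifF//; apply/negbTE; rewrite -leNgt.
  by near: y; exact: lt_le_nbhsl.
- have xn0 : x != 0 by rewrite gt_eqF.
  have dV : is_derive x 1 (fun y : R => y^-1) (- x ^- 2 *: (1 : R)).
    exact: is_deriveV.
  have dN : is_derive x 1 (fun y : R => - y^-1) (- (- x ^- 2 *: (1 : R))).
    exact: is_deriveN.
  have dE := @is_derive1_comp R expR (fun y => - y^-1) x _ _ (is_derive_expR (- x^-1)) dN.
  have dX : is_derive x 1 (fun y : R => y ^+ k) ((k%:R * x ^+ k.-1) *: (1 : R)).
    by apply: DeriveDef; [exact: exprn_derivable|rewrite exp_derive].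
  have dXV := @is_deriveV R (fun y => y ^+ k) x _ _ (expf_neq0 k xn0) dX.
  have dM := is_deriveM dXV dE.
  apply: is_derive_eq.
    apply: (near_eq_is_derive _ dM).
    near=> y; rewrite /flat ifT//.
    by near: y; exact: lt_nbhsr.
  rewrite /flat x0 /GRing.scale /= !mulr1 mulrN.
  case: k {dX dXV dM} => [|k] /=; rewrite ?expr0 !exprS; set e := expR _.
    by field.
  have p0 : x ^+ k != 0 by rewrite expf_neq0.
  move: (k.+1%:R : R) (x ^+ k) p0 => c p p0; rewrite expr0.
  by field; rewrite p0.
- rewrite [X in is_derive _ _ _ X](_ : _ = 0); last first.
    by rewrite /flat ltxx !mulr0 addr0.
  apply: (@is_derive_quadratic _ _ ((k.+2)%:R ^+ k.+2)) => h.
  rewrite add0r /flat ltxx subr0; case: ifPn => [h0|_]; last first.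
    by rewrite normr0 mulr_ge0 ?sqr_ge0// exprn_ge0.
  rewrite ger0_norm; last by rewrite mulr_ge0 ?expR_ge0// invr_ge0 exprn_ge0// ltW.
  have := @expRN_le_pow k.+1 1 h ltr01 h0; rewrite div1r => /(ler_wpM2l _) H.
  have hk0 : 0 <= h ^- k by rewrite invr_ge0 exprn_ge0// ltW.
  apply: (le_trans (H _ hk0)); rewrite divr1 mulrCA.
  by rewrite -[in h ^+ k.+2]addn2 exprD mulKf// expf_neq0// gt_eqF.
Unshelve. all: by end_near. Qed.

Lemma smooth_flat k : smooth (flat k).
Proof.
apply: smooth_family => {}k; exists (- k%:R), k.+1, 1, k.+2 => x.
exact: is_derive_flat.
Qed.

End flat.

Section cutoff.
Context (R : realType).
Implicit Types (x y : R).

(* Normalised so that [cutoff 0 = 1]. *)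
Definition cutoff y : R := expR 1 * flat 0 (1 - y ^+ 2).

Definition dcutoff y : R := - (2 * y) * (expR 1 * flat 2 (1 - y ^+ 2)).

Lemma is_derive_cutoff y : is_derive y 1 cutoff (dcutoff y).
Proof.
have d1 : is_derive y 1 (fun y : R => 1 - y ^+ 2) (- (2 * y)).
  have dX : is_derive y 1 (fun y : R => y ^+ 2) (2%:R *: y ^+ 1 *: (1 : R)).
    by apply: DeriveDef; [exact: exprn_derivable|rewrite exp_derive].
  have dB : is_derive y 1 (fun y : R => 1 - y ^+ 2) _ :=
    is_deriveB (is_derive_cst (1 : R) y 1) dX.
  by move: dB; rewrite sub0r /GRing.scale/= mulr1.
have d2 := is_derive_flat 0 (1 - y ^+ 2).
have d3 := @is_derive1_comp R (flat 0) (fun y => 1 - y ^+ 2) y _ _ d2 d1.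
have d4 : is_derive y 1 cutoff _ := is_deriveM (is_derive_cst (expR 1 : R) y 1) d3.
apply: is_derive_eq.
rewrite /dcutoff scaler0 addr0 /GRing.scale /cst /=; ring.
Qed.

Lemma smooth_cutoff : smooth cutoff.
Proof.
apply: smoothM; first exact: smooth_cst.
apply: (@smooth_comp _ _ (flat 0) (fun y => 1 - y ^+ 2)); first exact: smooth_flat.
rewrite (_ : (fun y => 1 - y ^+ 2) = cst 1 + cst (- 1) * (id * id)).
  apply: smoothD; first exact: smooth_cst.
  by apply: smoothM; [exact: smooth_cst|apply: smoothM; exact: smooth_id].
by apply/funext => y /=; rewrite /GRing.add/= /GRing.mul/= mulN1r expr2.
Qed.

Lemma derive1_cutoff y : derive1 cutoff y = dcutoff y.
Proof. by rewrite derive1E; have [_ ->] := is_derive_cutoff y. Qed.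

Lemma cutoff_ge0 y : 0 <= cutoff y.
Proof. by rewrite mulr_ge0 ?expR_ge0// flat_ge0. Qed.

Lemma cutoff_out y : 1 <= `|y| -> cutoff y = 0.
Proof.
move=> y1; rewrite /cutoff /flat ifF ?mulr0//; apply/negbTE.
by rewrite -leNgt subr_le0 -real_normK ?num_real// exprn_ege1.
Qed.

Lemma cutoff_gt0 y : `|y| < 1 -> 0 < cutoff y.
Proof.
move=> y1; rewrite mulr_gt0 ?expR_gt0// flat_gt0// subr_gt0.
by rewrite -real_normK ?num_real// exprn_ilt1.
Qed.

Lemma cutoff0 : cutoff 0 = 1.
Proof.
by rewrite /cutoff /flat expr0n/= subr0 ltr01 expr0 invr1 mul1r -expRD subrr expR0.
Qed.

Lemma cutoff_le1 y : cutoff y <= 1.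
Proof.
rewrite /cutoff /flat; case: ifPn => [y1|_]; last by rewrite mulr0.
rewrite expr0 invr1 mul1r -expRD expR_le1 subr_le0.
rewrite invf_ge1// lerBlDr lerDl sqr_ge0//.
Qed.

Lemma cutoff_mono x y : `|x| <= `|y| -> cutoff y <= cutoff x.
Proof.
move=> xy; have [y1|y1] := leP 1 `|y|; first by rewrite (cutoff_out y1) cutoff_ge0.
have x1 := le_lt_trans xy y1.
have pos (z : R) : `|z| < 1 -> 0 < 1 - z ^+ 2.
  by move=> z1; rewrite subr_gt0 -real_normK ?num_real// exprn_ilt1.
rewrite /cutoff /flat !pos// ler_pM2l ?expR_gt0// !expr0 !invr1 !mul1r ler_expR.
rewrite lerN2 lef_pV2 ?posrE ?pos// lerB//.
by rewrite -(real_normK (num_real x)) -(real_normK (num_real y)) lerXn2r ?nnegrE.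
Qed.

Lemma dcutoff_out y : 1 <= `|y| -> dcutoff y = 0.
Proof.
move=> y1; rewrite /dcutoff /flat ifF ?mulr0//; apply/negbTE.
by rewrite -leNgt subr_le0 -real_normK ?num_real// exprn_ege1.
Qed.

Lemma dcutoff_neq0 y : 0 < y < 1 -> dcutoff y != 0.
Proof.
move=> /andP[y0 y1]; rewrite /dcutoff mulNr oppr_eq0 gt_eqF// !mulr_gt0 ?expR_gt0//.
by rewrite flat_gt0// subr_gt0 exprn_ilt1// ltW.
Qed.

(* [x^-2 exp (-1/x) <= C exp (-1/(q x))]: flatness beats any power. *)
Lemma dcutoff_le (q : R) : 1 < q ->
  exists2 C, 0 < C & forall y, `|dcutoff y| <= C * cutoff y `^ q^-1.
Proof.
move=> q1; have q0 : 0 < q by rewrite (lt_trans _ q1).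
(* With this [c], exp(-1/x) = exp(-c/x) exp(-1/(q x)); the first factor absorbs [x ^- 2], and the
   second is the power 1/q of the cutoff up to a constant. *)
pose c := 1 - q^-1.
have c0 : 0 < c by rewrite subr_gt0 invf_lt1.
exists (2 * expR 1 * (2 / c) ^+ 2).
  by rewrite !mulr_gt0 ?expR_gt0 ?invr_gt0.
move=> y; have [y1|y1] := leP 1 `|y|.
  by rewrite dcutoff_out// normr0 mulr_ge0 ?powR_ge0// !mulr_ge0 ?expR_ge0 ?invr_ge0 ?(ltW c0).
have x0 : 0 < 1 - y ^+ 2.
  by rewrite subr_gt0 -real_normK ?num_real// exprn_ilt1.
have b1 : flat 0 (1 - y ^+ 2) `^ q^-1 <= cutoff y `^ q^-1.
  rewrite ge0_ler_powR ?nnegrE ?invr_ge0 ?(ltW q0)// ?cutoff_ge0 ?flat_ge0//.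
  by rewrite /cutoff ler_peMl ?flat_ge0// (le_trans _ (expR_ge1Dx _))// lerDl.
apply: le_trans (ler_wpM2l _ b1); last first.
  by rewrite !mulr_ge0 ?expR_ge0 ?invr_ge0 ?(ltW c0).
rewrite /dcutoff /flat x0 expr0 invr1 mul1r -expRM.
set x := 1 - y ^+ 2 in x0 *.
rewrite !normrM normrN normrM [`|2|]ger0_norm// [`|expR 1|]ger0_norm ?expR_ge0//.
rewrite [`|x ^- 2|]ger0_norm ?invr_ge0 ?sqr_ge0// [`|expR _|]ger0_norm ?expR_ge0//.
have -> : expR (- x^-1) = expR (- (c / x)) * expR (- x^-1 * q^-1).
  by rewrite -expRD; congr expR; rewrite /c; field; rewrite !gt_eqF.
have := @expRN_le_pow R 1 c x c0 x0.
set A := expR (- (c / x)); set B := expR (- x^-1 * q^-1) => AB.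
have B0 : 0 <= B by rewrite expR_ge0.
have A0 : 0 <= A by rewrite expR_ge0.
apply: (@le_trans _ _ (2 * 1 * (expR 1 * (x ^- 2 * (((2 / c) ^+ 2 * x ^+ 2) * B))))).
  rewrite ler_pM ?mulr_ge0 ?expR_ge0 ?invr_ge0 ?sqr_ge0//.
    by rewrite ler_wpM2l// ltW.
  by rewrite ler_wpM2l ?expR_ge0// ler_wpM2l ?invr_ge0 ?sqr_ge0// ler_wpM2r.
by rewrite le_eqVlt; apply/orP; left; apply/eqP; field; rewrite !gt_eqF.
Qed.

Lemma dcutoff_bounded : exists2 C, 0 < C & forall y, `|dcutoff y| <= C.
Proof.
have [C C0 bC] := @dcutoff_le 2 (ltr1n _ 2).
exists C => // y; apply: (le_trans (bC y)); rewrite ler_piMr ?(ltW C0)//.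
apply: (@le_trans _ _ (1 `^ 2^-1)); last by rewrite powR1.
by rewrite ge0_ler_powR ?nnegrE ?cutoff_le1 ?cutoff_ge0 ?invr_ge0.
Qed.

(** The base point lies to the left of the support [-1, 1]: for [x < -1] the integral vanishes near
    [x], and for [x >= -1] the point [x] is interior to [-2, x + 1], as the fundamental theorem of
    calculus requires. *)
Definition pcutoff0 x : R := \int[lebesgue_measure]_(t in `[-2, x]) cutoff t.
Definition pcutoff x : R := pcutoff0 x - pcutoff0 0.

Lemma is_derive_pcutoff x : is_derive x 1 pcutoff (cutoff x).
Proof.
suff d0 : is_derive x 1 pcutoff0 (cutoff x).
  have dB : is_derive x 1 pcutoff _ := is_deriveB d0 (is_derive_cst (pcutoff0 0) x 1).
  by move: dB; rewrite subr0.
have [x1|x1] := ltP x (-1).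
  rewrite cutoff_out; last first.
    have x0 : x < 0 by apply: (lt_trans x1); rewrite oppr_lt0.
    by rewrite ltr0_norm// lerNr ltW.
  apply: (near_eq_is_derive _ (is_derive_cst (0 : R) x 1)).
  near=> y; rewrite /pcutoff0 /=.
  have y1 : y <= -1 by near: y; exact: lt_le_nbhsl.
  rewrite (@eq_Rintegral _ _ _ _ _ (cst 0)).
    by rewrite Rintegral_cst//= mul0r.
  move=> t; rewrite inE /= in_itv /= => /andP[_ ty].
  have t1 := le_trans ty y1.
  have t0 : t <= 0 by apply: (le_trans t1); rewrite oppr_le0.
  apply: cutoff_out; rewrite ler0_norm// lerNr; exact: t1.
have cb : continuous cutoff := smooth_continuous smooth_cutoff.
have xx1 : x < x + 1 by rewrite ltrDl.
have x2 : -2 < x by apply: lt_le_trans x1; rewrite ltrN2 ltr1n.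
have ib : (@lebesgue_measure R).-integrable `[-2, x + 1] (EFin \o cutoff).
  apply: continuous_compact_integrable; first exact: segment_compact.
  exact: continuous_subspaceT.
have [d e] := continuous_FTC1_closed xx1 ib x2 (cb x).
by apply: DeriveDef; [exact: d|rewrite -derive1E; exact: e].
Unshelve. all: by end_near. Qed.

Lemma smooth_pcutoff : smooth pcutoff.
Proof. exact: smooth_primitive smooth_cutoff is_derive_pcutoff. Qed.

Lemma derive1_pcutoff : derive1 pcutoff = cutoff.
Proof.
by apply/funext => x; rewrite derive1E; have [_ ->] := is_derive_pcutoff x.
Qed.

Lemma pcutoff0E : pcutoff 0 = 0.
Proof. by rewrite /pcutoff subrr. Qed.

Lemma pcutoff_mvt x y : x <= y ->
  exists2 z, x <= z <= y & pcutoff y - pcutoff x = cutoff z * (y - x).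
Proof.
move=> xy; have cf : {within `[x, y], continuous pcutoff}.
  exact/continuous_subspaceT/smooth_continuous/smooth_pcutoff.
have [z zi ->] := MVT_segment xy (fun z _ => is_derive_pcutoff z) cf.
by exists z => //; rewrite in_itv /= in zi.
Qed.

Lemma pcutoff_mono x y : x <= y -> pcutoff x <= pcutoff y.
Proof.
move=> xy; rewrite -subr_ge0; have [z _ ->] := pcutoff_mvt xy.
by rewrite mulr_ge0 ?cutoff_ge0// subr_ge0.
Qed.

Lemma pcutoff_lipschitz x y : `|pcutoff x - pcutoff y| <= `|x - y|.
Proof.
rewrite -[leRHS]mul1r; apply: derive1_lipschitz => [z|z].
  by have [] := is_derive_pcutoff z.
by rewrite derive1_pcutoff ger0_norm ?cutoff_ge0// cutoff_le1.
Qed.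

Lemma pcutoff_le x : `|pcutoff x| <= `|x|.
Proof. by have := pcutoff_lipschitz x 0; rewrite pcutoff0E !subr0. Qed.

Lemma pcutoff_ge1 x : 1 <= x -> pcutoff x = pcutoff 1.
Proof.
move=> x1; have [z /andP[z1 _] e] := pcutoff_mvt x1.
apply/eqP; rewrite -subr_eq0 e cutoff_out ?mul0r//.
by rewrite ger0_norm// (le_trans _ z1).
Qed.

Lemma pcutoff_leN1 x : x <= -1 -> pcutoff x = pcutoff (-1).
Proof.
move=> x1; have [z /andP[_ z1] e] := pcutoff_mvt x1.
apply/eqP; rewrite eq_sym -subr_eq0 e cutoff_out ?mul0r//.
have z0 : z <= 0 by apply: (le_trans z1); rewrite oppr_le0.
by rewrite ler0_norm// lerNr.
Qed.

Lemma pcutoff_bounded x : `|pcutoff x| <= 1.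
Proof.
have [x1|x1] := leP `|x| 1; first exact: le_trans (pcutoff_le x) x1.
have [x0|x0] := leP 0 x.
  rewrite pcutoff_ge1 ?(le_trans (pcutoff_le _)) ?normr1//.
  by rewrite ltW// -(ger0_norm x0).
rewrite pcutoff_leN1 ?(le_trans (pcutoff_le _)) ?normrN ?normr1//.
by rewrite lerNr ltW// -(ltr0_norm x0).
Qed.

Lemma pcutoff_ge x : 0 <= x <= 2^-1 -> cutoff 2^-1 * x <= pcutoff x.
Proof.
move=> /andP[x0 x1]; have [z /andP[z0 zx]] := pcutoff_mvt x0.
rewrite pcutoff0E !subr0 => ->; rewrite ler_wpM2r// cutoff_mono//.
by rewrite !ger0_norm ?(le_trans zx).
Qed.

End cutoff.

(** * Smooth functions of ln |s| *)

Section log_comp.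
Context (R : realType) (p : R).
Hypothesis p0 : 0 < p.
Implicit Types (s x y : R) (b : R -> R).

Definition smooth_bounded_supp b :=
  smooth b /\ exists M : R, forall y, M <= `|y| -> b y = 0.

(* [b (ln (|s|^p)) s^-j]; smooth at the origin since [b] has bounded support. *)
Definition log_comp b (j : nat) s : R :=
  if s == 0 then 0 else b (p * ln `|s|) * s ^- j.

Lemma is_derive_ln_norm s : s != 0 -> is_derive s 1 (fun s : R => ln `|s|) s^-1.
Proof.
move=> s0; have [sn|sp|/eqP] := ltgtP s 0; last by rewrite (negPf s0).
- have dN : is_derive s 1 (fun s : R => - s) (-1) := is_deriveNid s 1.
  have Ns : 0 < - s by rewrite oppr_gt0.
  have := @is_derive1_comp R _ (fun s => - s) s _ _ (is_derive1_ln Ns) dN.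
  rewrite invrN mulrNN mulr1; apply: near_eq_is_derive.
  near=> y; rewrite ltr0_norm//.
  by near: y; exact: lt_nbhsl.
- apply: (near_eq_is_derive _ (is_derive1_ln sp)).
  near=> y; rewrite gtr0_norm//.
  by near: y; exact: lt_nbhsr.
Unshelve. all: by end_near. Qed.

Lemma smooth_bounded_supp_derive1 b :
  smooth_bounded_supp b -> smooth_bounded_supp (derive1 b).
Proof.
move=> [sb [M bM]]; split; first exact: smooth_derive1.
exists (M + 1) => y My; have yM : M < `|y| by apply: lt_le_trans My; rewrite ltrDl.
rewrite derive1E (@near_eq_derive _ _ _ b (cst 0)) ?derive_cst//.
near=> z; apply: bM; near: z.
have cn : {for y, continuous (fun z : R => `|z|)} by exact: norm_continuous.
by apply: filterS (cvgr_gt _ cn _ yM) => z /ltW.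
Unshelve. all: by end_near. Qed.

Lemma log_comp_near0 b j : smooth_bounded_supp b ->
  \forall s \near 0, log_comp b j s = 0.
Proof.
move=> [_ [M bM]].
have eM : 0 < expR (- `|M| / p) by exact: expR_gt0.
have nb : \forall s \near (0 : R), `|s| <= expR (- `|M| / p) by exact: nbhs0_le eM.
move: nb; apply: filterS => s sM.
rewrite /log_comp; case: ifPn => // s0.
have lM : p * ln `|s| <= - `|M|.
  by rewrite mulrC -ler_pdivlMr// -(@expRK R (_ / p)) ler_ln ?posrE ?normr_gt0.
rewrite bM ?mul0r// ler0_norm; last by rewrite (le_trans lM)// oppr_le0.
by rewrite (le_trans (ler_norm M))// lerNr.
Qed.

Lemma is_derive_log_comp b j s : smooth_bounded_supp b ->
  is_derive s 1 (log_comp b j)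
    (p * log_comp (derive1 b) j.+1 s + - j%:R * log_comp b j.+1 s).
Proof.
move=> sb; have [->|s0] := eqVneq s 0.
  rewrite {2 3}/log_comp eqxx !mulr0 addr0.
  apply: (near_eq_is_derive _ (is_derive_cst (0 : R) (0 : R) 1)).
  by apply: filterS (log_comp_near0 j sb) => x ->.
have dln : is_derive s 1 (fun s : R => p * ln `|s|) (p * s^-1).
  have := is_deriveM (is_derive_cst p s 1) (is_derive_ln_norm s0).
  by rewrite scaler0 addr0.
have db := @is_derive1_comp R b _ s _ _ (smooth_is_derive (p * ln `|s|) sb.1) dln.
have dX : is_derive s 1 (fun y : R => y ^+ j) (j%:R *: s ^+ j.-1 *: (1 : R)).
  by apply: DeriveDef; [exact: exprn_derivable|rewrite exp_derive].
have dXV := @is_deriveV R (fun y => y ^+ j) s _ _ (expf_neq0 j s0) dX.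
have dM := is_deriveM db dXV.
apply: is_derive_eq.
  apply: (near_eq_is_derive _ dM).
  near=> y; rewrite /log_comp ifF//; apply/negbTE; near: y.
  exact: (@cvgr_neq0 _ _ _ (nbhs s) _ id s).
rewrite /log_comp (negPf s0) /GRing.scale /= !mulr1.
case: j {dX dXV dM} => [|j] /=; rewrite ?expr0 !exprS.
  by field.
have q0 : s ^+ j != 0 by rewrite expf_neq0.
move: (j.+1%:R : R) (s ^+ j) q0 => c q q0; rewrite expr0.
by field; rewrite q0.
Unshelve. all: by end_near. Qed.

(** Differentiation changes [b] into its derivative as well as raising [j], so the family is indexed
    by pairs [(b, j)]. *)
Lemma smooth_log_comp b : smooth_bounded_supp b -> smooth (log_comp b 0).
Proof.
move=> sb; pose e (i : {b | smooth_bounded_supp b} * nat) := log_comp (sval i.1) i.2.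
suff /(_ (exist _ _ sb, 0%N)) : forall i, smooth (e i) by [].
apply: smooth_family => -[[{}b {}sb] j].
exists p, (exist _ _ (smooth_bounded_supp_derive1 sb), j.+1).
exists (- j%:R), (exist _ _ sb, j.+1) => x; exact: is_derive_log_comp.
Qed.

Lemma derive1_log_comp b s : smooth_bounded_supp b ->
  derive1 (log_comp b 0) s = p * log_comp (derive1 b) 1 s.
Proof.
move=> sb; rewrite derive1E.
by have [_ ->] := is_derive_log_comp 0 s sb; rewrite oppr0 mul0r addr0.
Qed.

End log_comp.

(** * Real-valued integrals *)

Section real_integrals.
Context d (T : measurableType d) (R : realType) (mu : {measure set T -> \bar R}).
Context (D : set T) (mD : measurable D).
Implicit Types (f g h : T -> R).

Local Notation integ f := (mu.-integrable D (EFin \o f)).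

Lemma integr_measurable f : integ f -> measurable_fun D f.
Proof. by move/measurable_int/measurable_EFinP. Qed.

Lemma integrD f g : integ f -> integ g -> integ (fun x => f x + g x).
Proof. exact: integrableD. Qed.

Lemma integrB f g : integ f -> integ g -> integ (fun x => f x - g x).
Proof. exact: integrableB. Qed.

Lemma integrZl c f : integ f -> integ (fun x => c * f x).
Proof. exact: integrableZl. Qed.

Lemma integr_sum (I : Type) (s : seq I) (F : I -> T -> R) :
  (forall i, integ (F i)) -> integ (fun x => \sum_(i <- s) F i x).
Proof.
move=> iF; elim: s => [|i s IH].
  under eq_fun do rewrite big_nil; exact: integrable0.
under eq_fun do rewrite big_cons; exact: integrD.
Qed.

Lemma integr_norm f : integ f -> integ (fun x => `|f x|).
Proof. exact: integrable_norm. Qed.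

Lemma ae_le_integr f g : measurable_fun D f -> integ g ->
  {ae mu, forall x, D x -> `|f x| <= g x} -> integ f.
Proof.
move=> mf ig fg; apply/integrableP; split; first exact/measurable_EFinP.
have /integrableP[_] := ig; apply: le_lt_trans.
apply: ae_ge0_le_integral => //.
- by apply: measurableT_comp => //; exact/measurable_EFinP.
- by apply: measurableT_comp => //; exact: measurable_int ig.
- apply: filterS fg => x fg Dx /=; rewrite lee_fin.
  by rewrite (le_trans (fg Dx))// ler_norm.
Qed.

Lemma le_integr f g : measurable_fun D f -> integ g ->
  (forall x, D x -> `|f x| <= g x) -> integ f.
Proof. by move=> mf ig fg; apply: (ae_le_integr mf ig); exact: aeW. Qed.

Lemma bounded_integr f (M : R) : (mu D < +oo)%E -> measurable_fun D f ->
  (forall x, D x -> `|f x| <= M) -> integ f.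
Proof.
move=> fD mf fM; apply: (@le_integr _ (cst M) mf _ fM).
apply: measurable_bounded_integrable => //; exact: bounded_cst.
Qed.

Lemma integrM_bounded f g (M : R) : measurable_fun D f -> integ g ->
  (forall x, D x -> `|f x| <= M) -> integ (fun x => f x * g x).
Proof.
move=> mf ig fM; apply: (@le_integr _ (fun x => M * `|g x|)).
- by apply: measurable_funM => //; exact: integr_measurable.
- exact/integrZl/integr_norm.
- by move=> x Dx; rewrite normrM ler_wpM2r// fM.
Qed.

Lemma ae_le_Rintegral f g : integ f -> integ g ->
  {ae mu, forall x, D x -> f x <= g x} ->
  \int[mu]_(x in D) f x <= \int[mu]_(x in D) g x.
Proof.
move=> fi gi fg; rewrite -subr_ge0 -RintegralB//.
(* The difference is nonnegative only almost everywhere; its absolute value is so everywhere. *)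
rewrite /Rintegral (ae_eq_integral (EFin \o (fun x => `|g x - f x|)))//.
- by apply: fine_ge0; apply: integral_ge0 => x _ /=; rewrite lee_fin.
- exact: measurable_int (integrB gi fi).
- exact: measurable_int (integr_norm (integrB gi fi)).
- by apply: filterS fg => x fg /fg ?/=; rewrite ger0_norm// subr_ge0.
Qed.

Lemma ae_eq_Rintegral f g : measurable_fun D f -> measurable_fun D g ->
  {ae mu, forall x, D x -> f x = g x} ->
  \int[mu]_(x in D) f x = \int[mu]_(x in D) g x.
Proof.
move=> mf mg fg; congr fine; apply: ae_eq_integral => //; try exact/measurable_EFinP.
by apply: filterS fg => x fg /fg /= ->.
Qed.

Lemma Rintegral_sum (I : Type) (s : seq I) (F : I -> T -> R) :
  (forall i, integ (F i)) ->
  \int[mu]_(x in D) (\sum_(i <- s) F i x) = \sum_(i <- s) \int[mu]_(x in D) F i x.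
Proof.
move=> iF; elim: s => [|i s IH].
  rewrite big_nil; under eq_Rintegral do rewrite big_nil.
  by rewrite /Rintegral integral0.
rewrite big_cons -IH -RintegralD//; last exact: integr_sum.
by apply: eq_Rintegral => x _; rewrite big_cons.
Qed.

Lemma Rintegral_norm_le f g : integ f -> integ g ->
  (forall x, D x -> `|f x| <= g x) ->
  `|\int[mu]_(x in D) f x| <= \int[mu]_(x in D) g x.
Proof.
move=> fi gi fg; apply: (le_trans (le_normr_Rintegral _ _)) => //.
by apply: le_Rintegral => //; exact: integr_norm.
Qed.

Lemma in_Lp2P f : in_Lp mu 2%:E D f <->
  measurable_fun D f /\ integ (fun x => f x ^+ 2).
Proof.
have e x : ((f \_ D) x) ^+ 2 = ((fun x => f x ^+ 2) \_ D) x.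
  by rewrite !patchE; case: ifP => //; rewrite expr0n.
have fin : (\int[mu]_x `|((f \_ D) x)%:E| `^ 2 =
    \int[mu]_(x in D) ((f x ^+ 2)%:E))%E.
  rewrite [RHS]integral_mkcond; apply: eq_integral => x _.
  rewrite -[RHS]/((EFin \o (fun x => f x ^+ 2)) \_ D x) restrict_EFin /= -e.
  by rewrite powR_mulrn// real_normK ?num_real.
have mfP : measurable_fun setT (f \_ D) <-> measurable_fun D f.
  by rewrite -measurable_restrictT.
split.
- move=> fL; have : f \_ D \in mfun by exact: (sub_Lfun_mfun fL).
  rewrite inE /= => /mfP mf; split => //.
  have := sub_Lfun_finLfun fL; rewrite inE /finite_norm /= => fn.
  apply/integrableP; split; first by apply/measurable_EFinP; exact: measurable_funX.
  under eq_integral do rewrite /= ger0_norm ?sqr_ge0//.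
  rewrite -fin -poweR_Lnorm ?gt_eqF//.
  by apply: poweR_lty => //; exact: fn.
- move=> [mf /integrableP[_]].
  under eq_integral do rewrite /= ger0_norm ?sqr_ge0//.
  rewrite -fin => foo; rewrite /in_Lp.
  rewrite inE /=; apply/andP; split; first by rewrite inE /=; exact/mfP.
  rewrite inE /= /finite_norm unlock; apply: poweR_lty => //.
Qed.

Lemma in_Lpy_bounded f (M : R) : measurable_fun D f ->
  (forall x, D x -> `|f x| <= M) -> in_Lp mu +oo%E D f.
Proof.
move=> mf fM; rewrite /in_Lp inE /=; apply/andP; split.
  by rewrite inE /=; rewrite -measurable_restrictT.
rewrite inE /= /finite_norm unlock; case: ifPn => // _.
apply: (@le_lt_trans _ _ (Num.max M 0)%:E); last by rewrite ltry.
apply: ess_sup_ler => x /=.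
rewrite patchE; case: ifPn => [|_]; last by rewrite normr0 lee_fin le_max lexx orbT.
by rewrite inE => /fM; rewrite lee_fin le_max => ->.
Qed.

End real_integrals.

(** * Boxes and Borel sets of R^N *)

Section borel_space.
Context (R : realType) (n : nat).
Implicit Types (x : 'rV[R]_n) (a b e : R).

Lemma measurable_forall_coor (A : 'I_n -> set R) :
  (forall i, measurable (A i)) -> measurable [set x : 'rV[R]_n | forall i, A i (x 0 i)].
Proof.
move=> mA; rewrite (_ : [set x : 'rV[R]_n | _] =
    \bigcap_(i in [set: 'I_n]) ((fun x : 'rV[R]_n => x 0 i) @^-1` A i)).
  apply: fin_bigcap_measurable => [|i _]; first exact: finite_finset.
  by rewrite -[X in measurable X]setTI; apply: measurable_coor.
by apply/seteqP; split=> [x /= xA i _|x /= xA i]; exact: xA.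
Qed.

(** The sigma-algebra is generated by the coordinates, so an open set has to be exhausted by
    countably many boxes, taken with rational centres and radii [1 / n.+1]. *)
Lemma open_measurable_rV (U : set 'rV[R]_n) : open U -> measurable U.
Proof.
move=> oU.
pose box (p : 'rV[rat]_n * nat) : set 'rV[R]_n :=
  [set x : 'rV[R]_n | forall i, `]ratr (p.1 0 i) - p.2.+1%:R^-1, ratr (p.1 0 i) + p.2.+1%:R^-1[%classic (x 0 i)].
rewrite (_ : U = \bigcup_p (if `[< box p `<=` U >] then box p else set0)).
  apply: countable_bigcupT_measurable => [|p]; first exact: countableP.
  case: ifPn => // _.
  apply: (@measurable_forall_coor (fun i =>
    `]ratr (p.1 0 i) - p.2.+1%:R^-1, ratr (p.1 0 i) + p.2.+1%:R^-1[%classic)) => i.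
  exact: measurable_itv.
apply/seteqP; split=> [x Ux|x [p _]]; last by case: asboolP => // pU /pU.
have /nbhs_ballP[e /= e0 xeU] : nbhs x U by exact: open_nbhs_nbhs.
have [k ke] : exists k, k.+1%:R^-1 < e / 2.
  have /= := near_infty_natSinv_lt (PosNum (divr_gt0 e0 (ltr0n _ 2))).
  by case=> k _ /(_ k (leqnn k)) /=; exists k.
have k0 : (0 : R) < k.+1%:R^-1 by rewrite invr_gt0.
have /choice[c cP] (i : 'I_n) : exists c : rat,
    ratr c \in `](x 0 i - k.+1%:R^-1), (x 0 i + k.+1%:R^-1)[.
  apply: rat_in_itvoo.
  by rewrite ltrBlDr -addrA ltrDl addr_gt0.
exists (\row_i c i, k) => //.
have xbox : box (\row_i c i, k) x.
  move=> i /=; rewrite mxE in_itv /=; have := cP i; rewrite in_itv /=.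
  by rewrite ltrBlDr ltrBlDr => /andP[-> ->].
case: asboolP => // -[] y yb; apply: xeU; split => // i j.
rewrite (ord1 i) -ball_normE /= ltr_norml.
have /= := yb j; have := cP j; rewrite mxE !in_itv /= => /andP[].
move: ke {cP xbox yb k0}; move: (x 0 j : R) (y 0 j : R) (ratr (c j) : R) (k.+1%:R^-1 : R).
by move=> s t r h *; apply/andP; split; lra.
Qed.

Lemma continuous_measurable_rV (f : 'rV[R]_n -> R) :
  continuous f -> measurable_fun setT f.
Proof.
move=> /continuousP cf; apply: (measurability _ (RGenOpens.measurableE R)).
move=> _ [_ [a [b ->] <-]]; rewrite setTI; apply: open_measurable_rV.
exact/cf/interval_open.
Qed.

End borel_space.

Section box.
Context (R : realType).

Definition box n (a b : R) : set 'rV[R]_n := [set x : 'rV[R]_n | forall i, a <= x 0 i <= b].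

Lemma subset_box n a b a' b' : a' <= a -> b <= b' -> @box n a b `<=` box a' b'.
Proof.
move=> aa bb x xab i; have /andP[ax xb] := xab i.
by rewrite (le_trans aa ax) (le_trans xb bb).
Qed.

Lemma measurable_box n a b : measurable (@box n a b).
Proof.
rewrite (_ : box a b = [set x : 'rV[R]_n | forall i, `[a, b]%classic (x 0 i)]).
  by apply: (@measurable_forall_coor _ _ (fun=> `[a, b]%classic)) => i; exact: measurable_itv.
by apply/seteqP; split=> x xP i; have := xP i; rewrite /= in_itv.
Qed.

Lemma lebesgue_box n a b : a <= b ->
  lebesgue_rV R n (box a b) = ((b - a) ^+ n)%:E.
Proof.
move=> ab; elim: n => [|n IH].
  rewrite /= expr0 diracE mem_set// => i; by case: i.
transitivity ((@lebesgue_measure R \x lebesgue_rV R n)%E (`[a, b] `*` box a b)).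
  rewrite /= /lebesgueS /pushforward; congr (_ _).
  apply/seteqP; split=> [[s x] /= xb|[s x] [/= sb xb] i].
    split=> /=.
      have := xb (lshift n (ord0 : 'I_1)).
      by rewrite /consrV (@row_mxEl _ 1 1 n) mxE in_itv.
    by move=> i; have := xb (rshift 1 i); rewrite /consrV (@row_mxEr _ 1 1 n).
  case: (splitP (i : 'I_(1 + n))) => j ij.
    have -> : i = lshift n j by exact: val_inj.
    by rewrite /consrV (@row_mxEl _ 1 1 n) (ord1 j) mxE; move: sb; rewrite in_itv.
  have -> : i = rshift 1 j by exact: val_inj.
  by rewrite /consrV (@row_mxEr _ 1 1 n).
rewrite product_measure1E//; last exact: measurable_box.
have l1 : lebesgue_measure `[a, b]%classic = (b - a)%:E.
  rewrite lebesgue_measure_itv /= lte_fin; case: ltP => // ba.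
  by have -> : a = b; [apply/eqP; rewrite eq_le ab|rewrite subrr].
by rewrite exprS EFinM; congr (_ * _)%E; [exact: l1|exact: IH].
Qed.

Lemma bounded_lebesgue_rV n (Om : set 'rV[R]_n) :
  measurable Om -> bounded_set Om -> (lebesgue_rV R n Om < +oo)%E.
Proof.
move=> mO [M [_ OM]]; pose K := Num.max M 0 + 1.
have K0 : 0 <= K by rewrite addr_ge0// le_max lexx orbT.
apply: (@le_lt_trans _ _ (lebesgue_rV R n (box (- K) K))).
  apply: le_measure; rewrite ?inE//; first exact: measurable_box.
  move=> x Ox i; have xK : `|x| <= K.
    apply: OM => //; apply: (@le_lt_trans _ _ (Num.max M 0)); last by rewrite ltrDl.
    by rewrite le_max lexx.
  rewrite -ler_norml (le_trans _ xK)//.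
  by rewrite [leRHS](_ : _ = mx_norm x)// mx_normrE; apply: (le_bigmax _ (fun j => `|x j.1 j.2|) (0, i)).
by rewrite lebesgue_box ?ltry// (le_trans _ K0)// oppr_le0.
Qed.

End box.

(** * Integration by parts *)

Lemma integr_indic d (T : measurableType d) (R : realType)
    (mu : {measure set T -> \bar R}) (D A : set T) :
  measurable D -> measurable A -> (mu A < +oo)%E ->
  mu.-integrable D (EFin \o (\1_A : T -> R)).
Proof.
move=> mD mA Aoo; apply/integrableP; split.
  by apply/measurable_EFinP; apply: measurable_indic.
under eq_integral do rewrite /= ger0_norm//.
rewrite integral_indic//; apply: le_lt_trans Aoo.
by apply: le_measure; rewrite ?inE//; exact: measurableI.
Qed.

Section continuous_pair.
Context (U V : topologicalType).

Lemma continuous_pair_cst (s : U) : continuous (fun x : V => (s, x)).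
Proof. by move=> x; apply: cvg_pair => /=; [exact: cvg_cst|exact: cvg_id]. Qed.

Lemma continuous_pair_cstr (s : V) : continuous (fun x : U => (x, s)).
Proof. by move=> x; apply: cvg_pair => /=; [exact: cvg_id|exact: cvg_cst]. Qed.

End continuous_pair.

Section integral_of_derivative.
Context (R : realType).

Lemma integral_derive_line (f g : R -> R) (M : R) :
  (forall x : R, is_derive x 1 f (g x)) -> continuous g ->
  (forall x, M < `|x| -> f x = 0) -> (forall x, M < `|x| -> g x = 0) ->
  (\int[lebesgue_measure]_x (g x)%:E = 0)%E.
Proof.
move=> fg cg f0 g0; pose K : R := `|M| + 1.
have K0 : 0 < K by rewrite ltr_wpDl.
have MK : M < K by rewrite (le_lt_trans (ler_norm M))// ltrDl.
have KK : - K < K by rewrite (lt_trans _ K0)// oppr_lt0.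
have cf : continuous f.
  by move=> x; apply/differentiable_continuous/derivable1_diffP; have [] := fg x.
have := @continuous_FTC2 R g f (- K) K KK.
have -> : (\int[lebesgue_measure]_x (g x)%:E = \int[lebesgue_measure]_(x in `[(- K)%R, K]%classic) (g x)%:E)%E.
  rewrite [RHS]integral_mkcond; apply: eq_integral => x _.
  rewrite patchE; case: ifPn => //.
  rewrite notin_setE /= in_itv /= => /negP; rewrite -ler_norml -ltNge => xK.
  by rewrite /= g0// (lt_trans MK).
move=> ->.
- by rewrite !f0 ?normrN ?(gtr0_norm K0)// sube0.
- exact: continuous_subspaceT.
- split; first by move=> x _; have [] := fg x.
  + by apply: cvg_within_filter; exact: cf.
  + by apply: cvg_within_filter; exact: cf.
- by move=> x _; rewrite derive1E; have [_ ->] := fg x.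
Qed.

Lemma consrVE n s (y : 'rV[R]_n) (i : 'I_n.+1) :
  consrV (s, y) 0 i = if unlift ord0 i is Some j then y 0 j else s.
Proof.
rewrite /consrV; case: unliftP => [j ->|->].
  have -> : lift ord0 j = rshift 1 j by exact: val_inj.
  by rewrite (@row_mxEr _ 1 1 n).
have -> : ord0 = lshift n (ord0 : 'I_1) by exact: val_inj.
by rewrite (@row_mxEl _ 1 1 n) mxE.
Qed.

Lemma consrVD n s h (y v : 'rV[R]_n) (k : R) :
  consrV (s + k * h, y + k *: v) = consrV (s, y) + k *: consrV (h, v).
Proof.
apply/rowP => i; rewrite [RHS]mxE [X in _ = _ + X]mxE !consrVE.
by case: (unlift ord0 i) => [j|]; rewrite ?mxE.
Qed.

Lemma consrV_continuous n : continuous (fun p : R * 'rV[R]_n => consrV p).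
Proof.
move=> [s y] A /nbhs_ballP[e /= e0 eA]; apply/nbhs_ballP; exists e => //.
move=> [t z] [/= st [_ yz]]; apply: eA; split => // i j; rewrite (ord1 i).
rewrite -/(consrV (s, y)) !consrVE.
by case: (unlift ord0 j) => [k|//]; exact: yz.
Qed.

Lemma derive_consrV_tail n (f : 'rV[R]_n.+1 -> R) s y v :
  derivable f (consrV (s, y)) (consrV (0, v)) ->
  is_derive y v (fun y => f (consrV (s, y))) ('D_(consrV (0, v)) f (consrV (s, y))).
Proof.
have qE : (fun k => k^-1 *: (((fun y => f (consrV (s, y))) \o shift y) (k *: v) - f (consrV (s, y)))) =
    (fun k => k^-1 *: ((f \o shift (consrV (s, y))) (k *: consrV (0, v)) - f (consrV (s, y)))).
  by apply/funext => k; rewrite /= (addrC (k *: consrV _)) -consrVD mulr0 addr0 (addrC y).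
by move=> cv; apply: DeriveDef; [rewrite /derivable qE|rewrite /derive qE].
Qed.

Lemma derive_consrV_head n (f : 'rV[R]_n.+1 -> R) (s : R) y :
  derivable f (consrV (s, y)) (consrV (1, 0)) ->
  is_derive s 1 (fun s : R => f (consrV (s, y))) ('D_(consrV (1, 0)) f (consrV (s, y))).
Proof.
have qE : (fun k => k^-1 *: (((fun s : R => f (consrV (s, y))) \o shift s) (k *: (1 : R)) - f (consrV (s, y)))) =
    (fun k => k^-1 *: ((f \o shift (consrV (s, y))) (k *: consrV (1, 0)) - f (consrV (s, y)))).
  by apply/funext => k; rewrite /= (addrC (k *: consrV _)) -consrVD scaler0 addr0 (addrC s).
by move=> cv; apply: DeriveDef; [rewrite /derivable qE|rewrite /derive qE].
Qed.

Lemma box_consrV n a b s (y : 'rV[R]_n) :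
  box a b (consrV (s, y)) <-> a <= s <= b /\ box a b y.
Proof.
split=> [sy|[sb yb] i].
  split; first by have := sy ord0; rewrite consrVE unlift_none.
  by move=> i; have := sy (lift ord0 i); rewrite consrVE liftK.
by rewrite consrVE; case: unliftP => [j _|//].
Qed.

Lemma box_compact n a b : compact (@box R n a b).
Proof.
rewrite (_ : box a b = [set x : 'rV[R]_n | forall i, `[a, b]%classic (x 0 i)]).
  apply: (@rV_compact _ _ (fun=> `[a, b]%classic)) => i; exact: segment_compact.
by apply/seteqP; split=> x xb i; have := xb i; rewrite /= in_itv.
Qed.

(** Induction along the recursive construction of [lebesgue_rV]. For the first coordinate Fubini
    integrates it innermost and the fundamental theorem of calculus applies; for another one it is
    frozen and the induction hypothesis applies to the slice. The assumptions bear on partial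
    derivatives alone because these pass to slices. *)
Lemma integral_partial n (f : 'rV[R]_n -> R) (M : R) (i : 'I_n) :
  0 <= M ->
  (forall x j, derivable f x (delta_mx 0 j)) ->
  (forall j, continuous (dx j f)) ->
  (forall x, ~ box (- M) M x -> f x = 0) ->
  (forall j x, ~ box (- M) M x -> dx j f x = 0) ->
  (\int[lebesgue_rV R n]_x (dx i f x)%:E = 0)%E.
Proof.
move=> M0; elim: n f i => [|n IH] f i df cdf f0 df0; first by case: i.
have mg := continuous_measurable_rV (cdf i).
have [C C0 bC] : exists2 C, 0 <= C & forall x, `|dx i f x| <= C.
  have /compact_bounded[C [_ Cb]] : compact (dx i f @` box (- M) M).
    apply: continuous_compact; last exact: box_compact.
    exact/continuous_subspaceT/cdf.
  exists (Num.max C 0 + 1); first by rewrite addr_ge0// le_max lexx orbT.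
  move=> x; have [xb|xb] := pselect (box (- M) M x).
    apply: Cb; last by exists x.
    by rewrite (@le_lt_trans _ _ (Num.max C 0)) ?le_max ?lexx// ltrDl.
  by rewrite df0// normr0 addr_ge0// le_max lexx orbT.
have Lb : (lebesgue_rV R n.+1 (box (- M) M) < +oo)%E.
  by rewrite lebesgue_box ?ltry// (le_trans _ M0)// oppr_le0.
have ig : (lebesgue_rV R n.+1).-integrable setT (EFin \o dx i f).
  apply: (@le_integr _ _ _ _ _ measurableT _ (fun x => C * \1_(box (- M) M) x) mg).
    apply: integrZl => //; apply: integr_indic => //; first exact: measurable_box.
  move=> x _; rewrite indicE; have [xb|xb] := boolP (x \in box (- M) M).
    by rewrite mulr1.
  by rewrite df0 ?normr0 ?mulr0// => /mem_set; apply/negP.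
have ig' : (@lebesgue_measure R \x lebesgue_rV R n)%E.-integrable setT
    ((EFin \o dx i f) \o @consrV R n).
  have /integrableP[mdf foo] := ig; apply/integrableP; split.
    by apply: measurableT_comp => //; exact: measurable_consrV.
  move: foo; rewrite /= /lebesgueS ge0_integral_pushforward ?preimage_setT//.
    exact: measurable_consrV.
  by apply/measurable_EFinP; exact: measurableT_comp.
rewrite /= /lebesgueS integral_pushforward ?preimage_setT//; last 2 first.
  exact: measurable_consrV.
  exact: measurable_int ig.
have delta_lift (j : 'I_n) : delta_mx 0 (lift ord0 j) = consrV (0, delta_mx 0 j) :> 'rV[R]_n.+1.
  apply/rowP => k; rewrite consrVE mxE eqxx /=.
  case: unliftP => [l ->|->]; last by rewrite eq_liftF.
  by rewrite mxE eqxx /= (inj_eq lift_inj).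
have delta_ord0 : delta_mx 0 ord0 = consrV (1, 0) :> 'rV[R]_n.+1.
  apply/rowP => k; rewrite consrVE mxE eqxx /=.
  by case: unliftP => [l ->|->]; rewrite ?eqxx // mxE.
case: (unliftP ord0 i) => [j ij|i0].
- rewrite -integral12_prod_meas1// (_ : fubini_F _ _ = cst 0%E) ?integral0//.
  apply/funext => s; rewrite /fubini_F /= ij.
  have pd k (x : 'rV[R]_n) : is_derive x (delta_mx 0 k : 'rV[R]_n)
      (fun y => f (consrV (s, y))) (dx (lift ord0 k) f (consrV (s, x))).
    rewrite /dx delta_lift; apply: derive_consrV_tail; rewrite -delta_lift.
    exact: df.
  have dE k (x : 'rV[R]_n) : dx (lift ord0 k) f (consrV (s, x)) =
      dx k (fun y => f (consrV (s, y))) x.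
    by have [_ <-] := pd k x.
  under eq_integral do rewrite dE.
  apply: IH.
  - by move=> x k; have [] := pd k x.
  - move=> k; rewrite (_ : dx k _ = fun x => dx (lift ord0 k) f (consrV (s, x))).
      move=> x; apply: (@continuous_comp _ (R * 'rV[R]_n)%type _ (fun x => ((s : R), x)) (dx (lift ord0 k) f \o @consrV R n)).
        exact: continuous_pair_cst.
      exact: (continuous_comp (@consrV_continuous _ _) (cdf _ _)).
    by apply/funext => x; rewrite dE.
  - by move=> x xb; rewrite f0// box_consrV => -[].
  - by move=> k x xb; rewrite -dE df0// box_consrV => -[].
- rewrite -integral21_prod_meas1// (_ : fubini_G _ _ = cst 0%E) ?integral0//.
  apply/funext => y; rewrite /fubini_G /= i0.
  apply: (@integral_derive_line (fun s => f (consrV (s, y))) _ M).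
  - move=> x; rewrite /dx delta_ord0; apply: derive_consrV_head.
    by rewrite -delta_ord0; exact: df.
  - move=> x; apply: (@continuous_comp _ (R * 'rV[R]_n)%type _ (fun x : R => (x, y)) (dx ord0 f \o @consrV R n)).
      exact: continuous_pair_cstr.
    exact: (continuous_comp (@consrV_continuous _ _) (cdf _ _)).
  - by move=> x xM; rewrite f0// box_consrV -ler_norml leNgt xM => -[].
  - by move=> x xM; rewrite df0// box_consrV -ler_norml leNgt xM => -[].
Qed.

End integral_of_derivative.

(** * Square-integrable functions *)

Section L2_null_sequences.
Context d (T : measurableType d) (R : realType) (mu : {measure set T -> \bar R}).
Context (D : set T) (mD : measurable D).
Implicit Types (f g h : nat -> T -> R).

(** Convergence to 0 in L^2 through the integral of the square. The integral stays in the extended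
    reals, so domination arguments need measurability only. *)
Definition L2null f := forall e : R, 0 < e ->
  \forall n \near \oo, (\int[mu]_(x in D) ((f n x) ^+ 2)%:E <= e%:E)%E.

Lemma Lp_norm2_pow (u : T -> R) :
  (Lp_norm mu 2%:E D u `^ 2 = \int[mu]_(x in D) ((u x) ^+ 2)%:E)%E.
Proof.
rewrite /Lp_norm poweR_Lnorm// [RHS]integral_mkcond; apply: eq_integral => x _.
rewrite -[RHS]/((EFin \o (fun x => u x ^+ 2)) \_ D x) restrict_EFin /=.
rewrite powR_mulrn// real_normK ?num_real// !patchE.
by case: ifP => //; rewrite expr0n.
Qed.

Lemma Lp_norm2_le (u : T -> R) (e : R) : 0 <= e ->
  ((Lp_norm mu 2%:E D u <= e%:E) = (\int[mu]_(x in D) ((u x) ^+ 2)%:E <= (e ^+ 2)%:E))%E.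
Proof.
move=> e0; rewrite -Lp_norm2_pow.
have N0 : (0 <= Lp_norm mu 2%:E D u)%E by exact: Lnorm_ge0.
case: (Lp_norm _ _ _ _) N0 => [r||]//=.
- by rewrite lee_fin => r0; rewrite !lee_fin powR_mulrn// ler_pXn2r.
- by move=> _; rewrite gt_eqF//= leye_eq.
Qed.

Lemma cvg_Lp_norm2P f : Lp_norm mu 2%:E D (f n) @[n --> \oo] --> 0%E <-> L2null f.
Proof.
split=> [f0 e e0|f0].
  have s0 : 0 < Num.sqrt e by rewrite sqrtr_gt0.
  move/fine_cvgP: f0 => [ffin /cvgr0Pnorm_le/(_ _ s0) fle].
  near=> n.
  rewrite -(sqr_sqrtr (ltW e0)) -Lp_norm2_le ?sqrtr_ge0//.
  have fn : Lp_norm mu 2%:E D (f n) \is a fin_num by near: n.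
  rewrite -(fineK fn) lee_fin; apply: (le_trans (ler_norm _)).
  by near: n.
apply/fine_cvgP; split.
  have h1 : 0 < (1 : R) ^+ 2 by rewrite expr1n.
  have := f0 _ h1; apply: filterS => n; rewrite -Lp_norm2_le// => h.
  by rewrite ge0_fin_numE ?Lnorm_ge0// (le_lt_trans h)// ltry.
apply/cvgrPdist_le => e e0.
have e20 : 0 < e ^+ 2 by rewrite exprn_gt0.
have := f0 _ e20; apply: filterS => n; rewrite -Lp_norm2_le ?(ltW e0)// => h.
have N0 : (0 <= Lp_norm mu 2%:E D (f n))%E by exact: Lnorm_ge0.
rewrite sub0r normrN ger0_norm ?fine_ge0// -lee_fin fineK//.
by rewrite ge0_fin_numE// (le_lt_trans h)// ltry.
Unshelve. all: by end_near. Qed.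

Lemma L2null_le f g h (C : R) : 0 <= C ->
  (forall n, measurable_fun D (f n)) ->
  (forall n, measurable_fun D (g n)) -> (forall n, measurable_fun D (h n)) ->
  (forall n x, D x -> `|h n x| <= C * (`|f n x| + `|g n x|)) ->
  L2null f -> L2null g -> L2null h.
Proof.
move=> C0 mf mg mh hfg f0 g0 e e0.
pose c := 2 * C ^+ 2 + 1.
have c0 : 0 < c by rewrite ltr_wpDl// mulr_ge0// sqr_ge0.
have ec : 0 < e / (2 * c) by rewrite divr_gt0// mulr_gt0.
near=> n.
apply: (@le_trans _ _ (\int[mu]_(x in D) (c%:E * ((f n x ^+ 2)%:E + (g n x ^+ 2)%:E)))%E).
  apply: ge0_le_integral => //.
  - by move=> x _; rewrite lee_fin sqr_ge0.
  - by apply/measurable_EFinP; exact: measurable_funX.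
  - apply: measurable_funeM => //; apply: emeasurable_funD;
      by apply/measurable_EFinP; exact: measurable_funX.
  - move=> x Dx; rewrite -EFinD -EFinM lee_fin.
    apply: (@le_trans _ _ ((C * (`|f n x| + `|g n x|)) ^+ 2)).
      rewrite -(real_normK (num_real (h n x))) lerXn2r ?nnegrE// ?hfg//.
      by rewrite mulr_ge0// addr_ge0.
    rewrite -(real_normK (num_real (f n x))) -(real_normK (num_real (g n x))) /c.
    move: `|f n x| `|g n x| (normr_ge0 (f n x)) (normr_ge0 (g n x)) => a b a0 b0.
    have : 0 <= C ^+ 2 * (a - b) ^+ 2 by rewrite mulr_ge0 ?sqr_ge0.
    have : 0 <= a ^+ 2 + b ^+ 2 by rewrite addr_ge0 ?sqr_ge0.
    rewrite exprMn !sqrrD; nra.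
rewrite ge0_integralZl_EFin ?(ltW c0)//; last 2 first.
- by move=> x _; rewrite adde_ge0// lee_fin sqr_ge0.
- by apply: emeasurable_funD; apply/measurable_EFinP; exact: measurable_funX.
rewrite ge0_integralD//; last 4 first.
- by move=> x _; rewrite lee_fin sqr_ge0.
- by apply/measurable_EFinP; exact: measurable_funX.
- by move=> x _; rewrite lee_fin sqr_ge0.
- by apply/measurable_EFinP; exact: measurable_funX.
apply: (@le_trans _ _ (c%:E * ((e / (2 * c))%:E + (e / (2 * c))%:E))%E).
  apply: lee_wpmul2l; first by rewrite lee_fin ltW.
  by apply: leeD; near: n; [exact: f0|exact: g0].
rewrite -EFinD -EFinM lee_fin le_eqVlt; apply/orP; left; apply/eqP.
by field; rewrite gt_eqF.
Unshelve. all: by end_near. Qed.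

End L2_null_sequences.

Section square_integrable.
Context d (T : measurableType d) (R : realType) (mu : {measure set T -> \bar R}).
Context (D : set T) (mD : measurable D).
Implicit Types (f g h : T -> R).

Lemma in_Lp2_dom f g (C : R) : measurable_fun D g -> in_Lp mu 2%:E D f ->
  (forall x, D x -> `|g x| <= C * `|f x|) -> in_Lp mu 2%:E D g.
Proof.
move=> mg /in_Lp2P -/(_ mD)[mf f2] fg; apply/in_Lp2P => //; split => //.
apply: (@le_integr _ _ _ _ _ mD _ (fun x => C ^+ 2 * f x ^+ 2)).
- exact: measurable_funX.
- exact: integrZl.
- move=> x Dx; rewrite ger0_norm ?sqr_ge0// -(real_normK (num_real (g x))).
  rewrite -(real_normK (num_real (f x))) -exprMn lerXn2r ?nnegrE ?fg//.
  by rewrite (le_trans _ (fg x Dx)).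
Qed.

Lemma in_Lp2D f g : in_Lp mu 2%:E D f -> in_Lp mu 2%:E D g ->
  in_Lp mu 2%:E D (fun x => f x + g x).
Proof.
move=> /in_Lp2P -/(_ mD)[mf f2] /in_Lp2P -/(_ mD)[mg g2]; apply/in_Lp2P => //.
have mfg : measurable_fun D (fun x => f x + g x) by exact: measurable_funD.
split=> //; apply: (@le_integr _ _ _ _ _ mD _ (fun x => 2 * f x ^+ 2 + 2 * g x ^+ 2)).
- exact: measurable_funX.
- by apply: integrD => //; exact: integrZl.
- move=> x _; rewrite ger0_norm ?sqr_ge0//.
  have := sqr_ge0 (f x - g x); nra.
Qed.

Lemma in_Lp2Z f (c : R) : in_Lp mu 2%:E D f -> in_Lp mu 2%:E D (fun x => c * f x).
Proof.
move=> /[dup] /in_Lp2P -/(_ mD)[mf _] fL; apply: (@in_Lp2_dom f _ `|c|) => //.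
  exact: measurable_funM.
by move=> x _; rewrite normrM.
Qed.

Lemma in_Lp2B f g : in_Lp mu 2%:E D f -> in_Lp mu 2%:E D g ->
  in_Lp mu 2%:E D (fun x => f x - g x).
Proof.
move=> fL /(in_Lp2Z (-1)) gL; rewrite (_ : (fun x => _) = fun x => f x + -1 * g x).
  exact: in_Lp2D.
by apply/funext => x; rewrite mulN1r.
Qed.

Hypothesis Doo : (mu D < +oo)%E.

Lemma in_Lp2_bounded f (C : R) : measurable_fun D f ->
  (forall x, D x -> `|f x| <= C) -> in_Lp mu 2%:E D f.
Proof.
move=> mf fC; apply/in_Lp2P => //; split => //.
apply: (@bounded_integr _ _ _ _ _ mD _ (C ^+ 2)) => //.
  exact: measurable_funX.
move=> x Dx; rewrite normrX lerXn2r ?nnegrE ?fC//.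
by rewrite (le_trans _ (fC x Dx)).
Qed.

Lemma integr_cst (c : R) : mu.-integrable D (EFin \o (fun=> c)).
Proof. exact: (@bounded_integr _ _ _ _ _ mD _ `|c|). Qed.

Lemma in_Lp2_integr f : in_Lp mu 2%:E D f -> mu.-integrable D (EFin \o f).
Proof.
move=> /in_Lp2P -/(_ mD)[mf f2].
apply: (@le_integr _ _ _ _ _ mD _ (fun x => 1 + f x ^+ 2)) => //.
  by apply: integrD => //; exact: integr_cst.
move=> x _; rewrite -(real_normK (num_real (f x))).
have := sqr_ge0 (`|f x| - 1); have := normr_ge0 (f x); nra.
Qed.

(** In place of Cauchy-Schwarz: |h| <= s + h^2 / s for a small fixed [s]. The first term integrates
    to little because [D] has finite measure, the second because [h n] tends to 0 in L^2. *)
Lemma L2null_weak (h : nat -> T -> R) (w : T -> R) (C : R) :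
  (forall n, in_Lp mu 2%:E D (h n)) -> measurable_fun D w ->
  (forall x, D x -> `|w x| <= C) -> L2null mu D h ->
  forall e : R, 0 < e -> \forall n \near \oo,
    `|\int[mu]_(x in D) (h n x * w x)| <= e.
Proof.
move=> hL mw wC h0 e e0.
pose m := fine (mu D).
have m0 : 0 <= m by exact: fine_ge0.
pose C1 := `|C| + 1.
have C10 : 0 < C1 by rewrite ltr_wpDl.
pose s := e / (2 * C1 * (m + 1)).
have m1 : 0 < m + 1 by rewrite ltr_wpDl.
have s0 : 0 < s by rewrite divr_gt0// !mulr_gt0.
have : 0 < s * e / (2 * C1) by rewrite divr_gt0// mulr_gt0.
move=> /h0; apply: filterS => n hn.
have /in_Lp2P -/(_ mD)[mh h2] := hL n.
have ih := in_Lp2_integr (hL n).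
have isq : mu.-integrable D (EFin \o (fun x => C1 * (s + s^-1 * h n x ^+ 2))).
  by apply: integrZl => //; apply: integrD => //; [exact: integr_cst|exact: integrZl].
apply: (@le_trans _ _ (\int[mu]_(x in D) (C1 * (s + s^-1 * h n x ^+ 2)))).
  apply: Rintegral_norm_le => //.
    rewrite (_ : (fun x => h n x * w x) = fun x => w x * h n x).
      exact: (integrM_bounded mD mw ih wC).
    by apply/funext => x; rewrite mulrC.
  move=> x Dx; rewrite normrM mulrC.
  have wC1 : `|w x| <= C1.
    by rewrite (le_trans (wC x Dx))// (le_trans (ler_norm C))// lerDl.
  apply: ler_pM => //.
  rewrite -(real_normK (num_real (h n x))).
  have : 0 <= s^-1 * (`|h n x| - s) ^+ 2 by rewrite mulr_ge0 ?sqr_ge0// invr_ge0 ltW.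
  rewrite sqrrB mulrDr mulrBr [s^-1 * s ^+ 2](_ : _ = s); last first.
    by field; rewrite gt_eqF.
  rewrite [s^-1 * (_ *+ 2)](_ : _ = 2 * `|h n x|); last by field; rewrite gt_eqF.
  by have := normr_ge0 (h n x); lra.
have i1 : mu.-integrable D (EFin \o (fun x => s^-1 * h n x ^+ 2)) by exact: integrZl.
rewrite RintegralZl//; last by apply: integrD => //; exact: integr_cst.
rewrite RintegralD//; last exact: integr_cst.
rewrite Rintegral_cst// RintegralZl//.
have hn' : \int[mu]_(x in D) (h n x ^+ 2) <= s * e / (2 * C1).
  rewrite -lee_fin fineK//; exact: integrable_fin_num.
apply: (@le_trans _ _ (C1 * (s * m + s^-1 * (s * e / (2 * C1))))).
  rewrite ler_pM2l// lerD2l ler_pM2l// invr_gt0//.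
rewrite (_ : s^-1 * _ = e / (2 * C1)); last by field; rewrite !gt_eqF.
rewrite mulrDr (_ : C1 * (e / _) = e / 2); last by field; rewrite gt_eqF.
have : C1 * (s * m) <= e / 2.
  rewrite /s (_ : C1 * _ = e / 2 * (m / (m + 1))); last by field; rewrite !gt_eqF.
  by rewrite ler_piMr ?divr_ge0 ?(ltW e0)// ler_pdivrMr// mul1r lerDl.
lra.
Qed.

End square_integrable.

(** * Sobolev functions *)

Section sobolev_calculus.
Context (R : realType) (N : nat) (Om : set 'rV[R]_N).
Hypothesis oOm : open Om.
Hypothesis Omoo : (lebesgue_rV R N Om < +oo)%E.
Local Notation leb := (lebesgue_rV R N).
Implicit Types (v w phi psi : 'rV[R]_N -> R) (G K : 'rV[R]_N -> 'rV[R]_N).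

Let mOm : measurable Om. Proof. exact: open_measurable_rV. Qed.

Definition grad phi : 'rV[R]_N -> 'rV[R]_N := fun x => \row_i dx i phi x.

Lemma smooth_dx i phi : smooth phi -> smooth (dx i phi).
Proof. exact: smooth_derive. Qed.

Lemma smooth_measurable phi : smooth phi -> measurable_fun Om phi.
Proof.
by move=> /smooth_continuous/continuous_measurable_rV; exact: measurable_funTS.
Qed.

Lemma test_function_bounded psi : test_function Om psi ->
  exists2 C, 0 <= C & forall x, `|psi x| <= C.
Proof.
by move=> [/smooth_continuous cp kp _]; exact: compact_supp_bounded.
Qed.

Lemma test_function_dx i psi : test_function Om psi -> test_function Om (dx i psi).
Proof.
move=> [sp kp pO]; have sub := @supp_derive _ _ psi (delta_mx 0 i).
split; first exact: smooth_dx.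
  by apply: (subclosed_compact _ kp sub); exact: closed_closure.
exact: subset_trans sub pO.
Qed.

Lemma test_function_out psi x : test_function Om psi -> ~ Om x -> psi x = 0.
Proof.
move=> [_ _ pO] nx; apply: contrapT => /eqP px; apply: nx; apply: pO.
exact: subset_closure.
Qed.

Lemma test_functionM phi psi : smooth phi -> test_function Om psi ->
  test_function Om (phi * psi).
Proof.
move=> sp [ss ks sO].
have p0 x : psi x = 0 -> (phi * psi) x = 0 by move=> /= p; rewrite /GRing.mul /= p mulr0.
split; first exact: smoothM.
  exact: supp_compact ks.
by apply: subset_trans sO; exact: supp_sub.
Qed.

Lemma test_function_comp (f : R -> R) psi : smooth f -> f 0 = 0 ->
  test_function Om psi -> test_function Om (f \o psi).
Proof.
move=> sf f0 [ss ks sO].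
have p0 x : psi x = 0 -> (f \o psi) x = 0 by move=> /= ->.
split; first exact: smooth_comp.
  exact: supp_compact ks.
by apply: subset_trans sO; exact: supp_sub.
Qed.

Lemma integral_dx_test psi i : test_function Om psi ->
  (\int[leb]_(x in Om) (dx i psi x)%:E = 0)%E.
Proof.
move=> tp; rewrite integral_mkcond.
transitivity (\int[leb]_x (dx i psi x)%:E)%E.
  apply: eq_integral => x _; rewrite -[LHS]/((EFin \o dx i psi) \_ Om x) patchE.
  case: ifPn => // /negP nx; rewrite (test_function_out (test_function_dx i tp))//.
  by move=> /mem_set.
have [sp kp _] := tp.
have [M [_ Mb]] := compact_bounded kp.
pose K : R := Num.max M 0 + 1.
have MK : M < K by rewrite (@le_lt_trans _ _ (Num.max M 0)) ?le_max ?lexx// ltrDl.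
have K0 : 0 <= K by rewrite addr_ge0// le_max lexx orbT.
have sK x : supp psi x -> box (- K) K x.
  move=> /(Mb _ MK) xK j; rewrite -ler_norml (le_trans _ xK)//.
  by rewrite [leRHS](_ : _ = mx_norm x)// mx_normrE; apply: (le_bigmax _ (fun j => `|x j.1 j.2|) (0, j)).
have p0 (g : 'rV[R]_N -> R) : supp g `<=` supp psi -> forall x, ~ box (- K) K x -> g x = 0.
  move=> gp x nx; apply: contrapT => /eqP gx; apply: nx; apply/sK/gp.
  exact: subset_closure.
apply: (integral_partial i K0).
- by move=> x j; exact: smooth_derivable.
- by move=> j; apply: smooth_continuous; exact: smooth_dx.
- exact: p0.
- by move=> j; apply: p0; exact: supp_derive.
Qed.

Lemma weak_gradient_smooth phi : smooth phi -> weak_gradient Om phi (grad phi).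
Proof.
move=> sp psi tp i; have [ss _ _] := tp.
have bint w : test_function Om w -> leb.-integrable Om (EFin \o w).
  move=> tw; have [C C0 wC] := test_function_bounded tw.
  apply: (@bounded_integr _ _ _ _ _ mOm _ C) => //.
  by apply: smooth_measurable; case: tw.
have i1 : leb.-integrable Om (EFin \o (fun x => phi x * dx i psi x)).
  exact: (bint _ (test_functionM sp (test_function_dx i tp))).
have i2 : leb.-integrable Om (EFin \o (fun x => dx i phi x * psi x)).
  exact: (bint _ (test_functionM (smooth_dx i sp) tp)).
under [in RHS]eq_Rintegral do rewrite mxE.
apply/eqP; rewrite -subr_eq0 opprK -RintegralD//; apply/eqP.
rewrite /Rintegral (eq_integral (fun x => (dx i (phi * psi) x)%:E)).
  by rewrite integral_dx_test//; exact: test_functionM.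
move=> x _; congr EFin; rewrite /dx deriveM//; try exact: smooth_derivable.
by rewrite /GRing.scale /= [X in _ + X]mulrC.
Qed.

Lemma test_in_Lp2 psi : test_function Om psi -> in_Lp leb 2%:E Om psi.
Proof.
move=> tw; have [C C0 wC] := test_function_bounded tw.
apply: (@in_Lp2_bounded _ _ _ _ _ mOm _ _ C) => //.
by apply: smooth_measurable; case: tw.
Qed.

(** The weak gradient identity holds for each test function by integration by parts and passes to
    L^2 limits, so an approximating sequence is all that membership in H^1_0 demands. *)
Lemma H10_intro v G (phi : nat -> 'rV[R]_N -> R) :
  in_Lp leb 2%:E Om v -> (forall i, in_Lp leb 2%:E Om (fun x => G x 0 i)) ->
  (forall n, test_function Om (phi n)) ->
  L2null leb Om (fun n x => phi n x - v x) ->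
  (forall i, L2null leb Om (fun n x => dx i (phi n) x - G x 0 i)) ->
  H10 Om v G.
Proof.
move=> vL GL tp pv pG; split; last first.
  exists phi; split=> // [|i].
    exact/(@cvg_Lp_norm2P _ _ _ leb Om (fun n => phi n \- v)).
  apply/(@cvg_Lp_norm2P _ _ _ leb Om (fun n => dx i (phi n) \- (fun x => G x 0 i))).
  exact: pG.
split=> // psi ts i; apply/eqP; rewrite -subr_eq0 opprK.
have [C C0 sC] := test_function_bounded ts.
have [C' C'0 sC'] := test_function_bounded (test_function_dx i ts).
have ms : measurable_fun Om psi by apply: smooth_measurable; case: ts.
have ms' : measurable_fun Om (dx i psi).
  by apply: smooth_measurable; case: (test_function_dx i ts).
rewrite -normr_le0; apply/ler_addgt0Pr => e e0; rewrite add0r.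
have e2 : 0 < e / 2 by rewrite divr_gt0.
have n1 := L2null_weak mOm Omoo (fun n => in_Lp2B mOm (test_in_Lp2 (tp n)) vL)
  ms' (fun x _ => sC' x) pv e2.
have n2 := L2null_weak mOm Omoo
  (fun n => in_Lp2B mOm (test_in_Lp2 (test_function_dx i (tp n))) (GL i))
  ms (fun x _ => sC x) (pG i) e2.
have [n [/= hn1 hn2]] := filter_ex (filterI n1 n2).
have wg := @weak_gradient_smooth (phi n) (let: And3 s _ _ := tp n in s) psi ts i.
have int (w s : 'rV[R]_N -> R) (D : R) : measurable_fun Om s -> (forall x, `|s x| <= D) ->
    in_Lp leb 2%:E Om w -> leb.-integrable Om (EFin \o (fun x => w x * s x)).
  move=> mw wD /(in_Lp2_integr mOm Omoo) iw.
  rewrite (_ : (fun x => w x * s x) = fun x => s x * w x).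
    exact: (integrM_bounded mOm mw iw (fun x _ => wD x)).
  by apply/funext => x; rewrite mulrC.
have L1 := test_in_Lp2 (tp n).
have L2 := test_in_Lp2 (test_function_dx i (tp n)).
have e1 : \int[leb]_(x in Om) ((phi n x - v x) * dx i psi x) =
    \int[leb]_(x in Om) (phi n x * dx i psi x) - \int[leb]_(x in Om) (v x * dx i psi x).
  rewrite -RintegralB//; [|exact: int sC' _|exact: int sC' _].
  by apply: eq_Rintegral => x _; rewrite mulrBl.
have e3 : \int[leb]_(x in Om) ((dx i (phi n) x - G x 0 i) * psi x) =
    \int[leb]_(x in Om) (dx i (phi n) x * psi x) - \int[leb]_(x in Om) (G x 0 i * psi x).
  rewrite -RintegralB//; [|exact: int sC _|exact: int sC _].
  by apply: eq_Rintegral => x _; rewrite mulrBl.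
have : \int[leb]_(x in Om) (phi n x * dx i psi x) +
    \int[leb]_(x in Om) (dx i (phi n) x * psi x) = 0.
  rewrite wg; under [in X in - X]eq_Rintegral do rewrite mxE.
  by rewrite addNr.
move: hn1 hn2; rewrite e1 e3 !ler_norml => /andP[? ?] /andP[? ?] ?.
by apply/andP; split; lra.
Qed.

End sobolev_calculus.

(** Both the null sequence [g] and the small fixed error [k] may depend on the precision [e]; this
    is the form needed when the limit is first replaced by a regular approximation, as in
    [H10_comp]. *)
Lemma L2null_approx d (T : measurableType d) (R : realType)
    (mu : {measure set T -> \bar R}) (D : set T) (h : nat -> T -> R) :
  measurable D -> (forall n, measurable_fun D (h n)) ->
  (forall e : R, 0 < e -> exists (g : nat -> T -> R) (k : T -> R),
    [/\ forall n, measurable_fun D (g n), L2null mu D g, measurable_fun D k,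
        (\int[mu]_(x in D) (k x ^+ 2)%:E <= e%:E)%E &
        forall n x, D x -> `|h n x| <= `|g n x| + `|k x|]) ->
  L2null mu D h.
Proof.
move=> mD mh H e e0; have e4 : 0 < e / 4 by rewrite divr_gt0.
have [g [k [mg g0 mk ke hgk]]] := H _ e4.
have := g0 _ e4; apply: filterS => n gn.
apply: (@le_trans _ _ (\int[mu]_(x in D) (2%:E * ((g n x ^+ 2)%:E + (k x ^+ 2)%:E)))%E).
  apply: ge0_le_integral => //.
  - by move=> x _; rewrite lee_fin sqr_ge0.
  - by apply/measurable_EFinP; exact: measurable_funX.
  - apply: measurable_funeM => //; apply: emeasurable_funD;
      by apply/measurable_EFinP; exact: measurable_funX.
  - move=> x Dx; rewrite -EFinD -EFinM lee_fin.
    apply: (@le_trans _ _ ((`|g n x| + `|k x|) ^+ 2)).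
      rewrite -(real_normK (num_real (h n x))) lerXn2r ?nnegrE ?addr_ge0// hgk//.
    rewrite -(real_normK (num_real (g n x))) -(real_normK (num_real (k x))).
    have := sqr_ge0 (`|g n x| - `|k x|); nra.
rewrite ge0_integralZl_EFin//; last 2 first.
- by move=> x _; rewrite adde_ge0// lee_fin sqr_ge0.
- by apply: emeasurable_funD; apply/measurable_EFinP; exact: measurable_funX.
rewrite ge0_integralD//; last 4 first.
- by move=> x _; rewrite lee_fin sqr_ge0.
- by apply/measurable_EFinP; exact: measurable_funX.
- by move=> x _; rewrite lee_fin sqr_ge0.
- by apply/measurable_EFinP; exact: measurable_funX.
apply: (@le_trans _ _ (2%:E * ((e / 4)%:E + (e / 4)%:E))%E).
  by apply: lee_wpmul2l; [rewrite lee_fin|exact: leeD].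
by rewrite -EFinD -EFinM lee_fin; lra.
Qed.

Section sobolev_operations.
Context (R : realType) (N : nat) (Om : set 'rV[R]_N).
Hypothesis oOm : open Om.
Hypothesis Omoo : (lebesgue_rV R N Om < +oo)%E.
Local Notation leb := (lebesgue_rV R N).
Implicit Types (v w phi psi : 'rV[R]_N -> R) (G K : 'rV[R]_N -> 'rV[R]_N).

Let mOm : measurable Om. Proof. exact: open_measurable_rV. Qed.

Lemma measurable_comp_smooth (f : R -> R) v : smooth f -> measurable_fun Om v ->
  measurable_fun Om (fun x => f (v x)).
Proof.
move=> /smooth_continuous/continuous_measurable_fun mf mv.
exact: (measurableT_comp mf mv).
Qed.

Lemma H10_in_Lp v G : H10 Om v G ->
  in_Lp leb 2%:E Om v /\ forall i, in_Lp leb 2%:E Om (fun x => G x 0 i).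
Proof. by case=> -[]. Qed.

Lemma H10_approx v G : H10 Om v G -> exists phi : nat -> 'rV[R]_N -> R,
  [/\ forall n, test_function Om (phi n),
      L2null leb Om (fun n x => phi n x - v x) &
      forall i, L2null leb Om (fun n x => dx i (phi n) x - G x 0 i)].
Proof.
case=> _ [phi [tp pv pG]]; exists phi; split=> // [|i].
  exact/(@cvg_Lp_norm2P _ _ _ leb Om (fun n => phi n \- v)).
apply/(@cvg_Lp_norm2P _ _ _ leb Om (fun n => dx i (phi n) \- (fun x => G x 0 i))).
exact: pG.
Qed.

Lemma in_Lp2_measurable v : in_Lp leb 2%:E Om v -> measurable_fun Om v.
Proof. by move=> /in_Lp2P-/(_ mOm)[]. Qed.

Lemma test_measurable psi : test_function Om psi -> measurable_fun Om psi.
Proof. by case=> sp _ _; exact: smooth_measurable. Qed.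

Lemma dx_comp (f : R -> R) phi i x : smooth f -> smooth phi ->
  dx i (f \o phi) x = derive1 f (phi x) * dx i phi x.
Proof.
move=> sf sp; rewrite /dx derive_comp1; try exact: smooth_differentiable.
by rewrite derive1E.
Qed.

Lemma dx_mul phi psi i x : smooth phi -> smooth psi ->
  dx i (phi * psi) x = dx i phi x * psi x + phi x * dx i psi x.
Proof.
move=> sp ss; rewrite /dx deriveM; try exact: smooth_derivable.
by rewrite /GRing.scale /= addrC mulrC.
Qed.

(** The gradient error contains (f'(phi n) - f'(v)) G with [G] merely in L^2. There [G] is replaced
    by the bounded derivative of one fixed [phi m]: that part is null because f' is Lipschitz, and
    the remainder is at most 2 L |dx i (phi m) - G|. *)
Lemma H10_comp (f : R -> R) (L L' : R) v G :
  smooth f -> f 0 = 0 -> (forall s, `|derive1 f s| <= L) ->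
  (forall s, `|derive1 (derive1 f) s| <= L') ->
  H10 Om v G -> H10 Om (fun x => f (v x)) (fun x => derive1 f (v x) *: G x).
Proof.
move=> sf f0 fL fL' H; have [vL GL] := H10_in_Lp H.
have [phi [tp pv pG]] := H10_approx H.
have L0 : 0 <= L := le_trans (normr_ge0 _) (fL 0).
have L'0 : 0 <= L' := le_trans (normr_ge0 _) (fL' 0).
have sf' := smooth_derive1 sf.
have lip s t : `|f s - f t| <= L * `|s - t|.
  by apply: derive1_lipschitz => // x; exact: smooth_derivable.
have lip' s t : `|derive1 f s - derive1 f t| <= L' * `|s - t|.
  by apply: derive1_lipschitz => // x; exact: smooth_derivable.
have mv := in_Lp2_measurable vL.
have mG i := in_Lp2_measurable (GL i).
have mfv := measurable_comp_smooth sf mv.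
have mfv' := measurable_comp_smooth sf' mv.
have mp n := test_measurable (tp n).
have mdp n i := test_measurable (test_function_dx i (tp n)).
have mfp' n := measurable_comp_smooth sf' (mp n).
have sp n : smooth (phi n) by case: (tp n).
apply: (H10_intro oOm Omoo (phi := fun n => f \o phi n)).
- apply: (in_Lp2_dom mOm (C := L) mfv vL) => x _.
  by rewrite -[f _]subr0 -f0 -{2}[v x]subr0.
- move=> i; apply: (in_Lp2_dom mOm (C := L) _ (GL i)).
    by under eq_fun do rewrite mxE; exact: measurable_funM.
  by move=> x _; rewrite mxE normrM ler_wpM2r.
- by move=> n; exact: test_function_comp.
- apply: (L2null_le mOm L0 _ _ _ _ pv pv) => [n|n|n|n x _].
  + exact: measurable_funB.
  + exact: measurable_funB.
  + by apply: measurable_funB => //; exact: measurable_comp_smooth.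
  + by rewrite (le_trans (lip _ _))// ler_wpM2l// lerDl.
- move=> i; apply: L2null_approx => //.
    move=> n; under eq_fun do rewrite mxE dx_comp//.
    by apply: measurable_funB; exact: measurable_funM.
  move=> e e0; pose c : R := (2 * L) ^+ 2 + 1.
  have c0 : 0 < c by rewrite ltr_wpDl// sqr_ge0.
  have ec : 0 < e / c by rewrite divr_gt0.
  have [m hm] := filter_ex (pG i _ ec).
  have [C C0 Cm] := test_function_bounded (test_function_dx i (tp m)).
  exists (fun n x => derive1 f (phi n x) * (dx i (phi n) x - G x 0 i) +
                     (derive1 f (phi n x) - derive1 f (v x)) * dx i (phi m) x).
  exists (fun x => 2 * L * (dx i (phi m) x - G x 0 i)).
  have mg n : measurable_fun Om (fun x => derive1 f (phi n x) * (dx i (phi n) x - G x 0 i) +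
                     (derive1 f (phi n x) - derive1 f (v x)) * dx i (phi m) x).
    by apply: measurable_funD; apply: measurable_funM => //; exact: measurable_funB.
  split=> //.
  + have LC0 : 0 <= L + L' * C by rewrite addr_ge0// mulr_ge0.
    apply: (L2null_le mOm LC0 _ _ _ _ pv (pG i)) => // [n|n|n x _].
    * exact: measurable_funB.
    * exact: measurable_funB.
    * rewrite (le_trans (ler_normD _ _))// !normrM mulrDr.
      have a1 := fL (phi n x); have a2 := lip' (phi n x) (v x); have a3 := Cm x.
      rewrite addrC lerD//.
        apply: (@le_trans _ _ ((L' * `|phi n x - v x|) * C)); first exact: ler_pM.
        by rewrite mulrAC ler_wpM2r// lerDr.
      by rewrite ler_pM// (le_trans a1)// lerDl mulr_ge0.
  + by apply: measurable_funM => //; exact: measurable_funB.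
  + under eq_integral do rewrite exprMn EFinM.
    rewrite ge0_integralZl_EFin ?sqr_ge0//; last 2 first.
    * by move=> x _; rewrite lee_fin sqr_ge0.
    * by apply/measurable_EFinP; apply: measurable_funX; exact: measurable_funB.
    apply: (@le_trans _ _ (((2 * L) ^+ 2)%:E * (e / c)%:E)%E).
      by apply: lee_wpmul2l => //; rewrite lee_fin sqr_ge0.
    rewrite -EFinM lee_fin mulrCA ler_piMr ?(ltW e0)// ler_pdivrMr// mul1r.
    by rewrite lerDl.
  + move=> n x _; rewrite mxE dx_comp//.
    rewrite (_ : _ - _ = (derive1 f (phi n x) * (dx i (phi n) x - G x 0 i) +
       (derive1 f (phi n x) - derive1 f (v x)) * dx i (phi m) x) -
       (derive1 f (phi n x) - derive1 f (v x)) * (dx i (phi m) x - G x 0 i)); last by ring.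
    rewrite (le_trans (ler_normB _ _))// lerD2l !normrM ler_wpM2r//.
    rewrite (le_trans (ler_normB _ _))// ger0_norm// ger0_norm//.
    by rewrite mulr_natl mulr2n lerD.
Qed.

Lemma H10_mul chi (C : R) v G : smooth chi -> (forall x, `|chi x| <= C) ->
  (forall i x, `|dx i chi x| <= C) -> H10 Om v G ->
  H10 Om (fun x => v x * chi x) (fun x => chi x *: G x + v x *: grad chi x).
Proof.
move=> sc cC dC H; have [vL GL] := H10_in_Lp H.
have [phi [tp pv pG]] := H10_approx H.
have C0 : 0 <= C := le_trans (normr_ge0 _) (cC 0).
have mv := in_Lp2_measurable vL.
have mG i := in_Lp2_measurable (GL i).
have mc := smooth_measurable (Om := Om) sc.
have mdc i := smooth_measurable (Om := Om) (smooth_dx i sc).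
have mp n := test_measurable (tp n).
have mdp n i := test_measurable (test_function_dx i (tp n)).
have sp n : smooth (phi n) by case: (tp n).
have gE i x : (chi x *: G x + v x *: grad chi x) 0 i = chi x * G x 0 i + v x * dx i chi x.
  by rewrite !mxE.
have mg i : measurable_fun Om (fun x => chi x * G x 0 i).
  exact: measurable_funM.
have mh i : measurable_fun Om (fun x => v x * dx i chi x).
  exact: measurable_funM.
apply: (H10_intro oOm Omoo (phi := fun n => chi * phi n)).
- apply: (in_Lp2_dom mOm (C := C) _ vL) => [|x _].
    exact: measurable_funM.
  by rewrite normrM mulrC ler_wpM2r.
- move=> i; under eq_fun do rewrite gE; apply: in_Lp2D => //.
    apply: (in_Lp2_dom mOm (C := C) _ (GL i)) => // x _.
    by rewrite normrM ler_wpM2r.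
  apply: (in_Lp2_dom mOm (C := C) _ vL) => // x _.
  by rewrite normrM mulrC ler_wpM2r.
- by move=> n; exact: test_functionM.
- apply: (L2null_le mOm C0 _ _ _ _ pv pv) => [n|n|n|n x _].
  + exact: measurable_funB.
  + exact: measurable_funB.
  + by apply: measurable_funB => //; exact: measurable_funM.
  + rewrite {1}/GRing.mul /= [v x * _]mulrC -mulrBr normrM.
    by apply: ler_pM => //; rewrite lerDl.
- move=> i; apply: (L2null_le mOm C0 _ _ _ _ pv (pG i)) => [n|n|n|n x _].
  + exact: measurable_funB.
  + exact: measurable_funB.
  + under eq_fun do rewrite gE dx_mul//.
    apply: measurable_funB; last exact: measurable_funD.
    by apply: measurable_funD; exact: measurable_funM.
  + rewrite gE dx_mul// (_ : _ - _ = dx i chi x * (phi n x - v x) +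
      chi x * (dx i (phi n) x - G x 0 i)); last by ring.
    rewrite (le_trans (ler_normD _ _))// !normrM mulrDr lerD//.
      by rewrite ler_wpM2r.
    by rewrite ler_wpM2r.
Qed.

Lemma H10_sub v G w K : H10 Om v G -> H10 Om w K ->
  H10 Om (fun x => v x - w x) (fun x => G x - K x).
Proof.
move=> H H'; have [vL GL] := H10_in_Lp H; have [wL KL] := H10_in_Lp H'.
have [phi [tp pv pG]] := H10_approx H; have [psi [ts sw sK]] := H10_approx H'.
have mv := in_Lp2_measurable vL; have mw := in_Lp2_measurable wL.
have mG i := in_Lp2_measurable (GL i); have mK i := in_Lp2_measurable (KL i).
have mp n := test_measurable (tp n).
have ms n := test_measurable (ts n).
have mdp n i := test_measurable (test_function_dx i (tp n)).
have mds n i := test_measurable (test_function_dx i (ts n)).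
have sp n : smooth (phi n) by case: (tp n).
have ss n : smooth (psi n) by case: (ts n).
have gE i x : (G x - K x) 0 i = G x 0 i - K x 0 i by rewrite !mxE.
have dE i n x : dx i (phi n - psi n) x = dx i (phi n) x - dx i (psi n) x.
  by rewrite /dx deriveB//; exact: smooth_derivable.
apply: (H10_intro oOm Omoo (phi := fun n => phi n - psi n)).
- exact: in_Lp2B.
- by move=> i; under eq_fun do rewrite gE; exact: in_Lp2B.
- move=> n; have [_ kp pO] := tp n; have [_ ks sO] := ts n.
  have sub : supp (phi n - psi n) `<=` supp (phi n) `|` supp (psi n).
    rewrite /supp -closureU; apply: closureS => x /=.
    rewrite -[X in X != _]/(phi n x - psi n x).
    have [->|] := eqVneq (phi n x) 0; last by left.
    by rewrite sub0r oppr_eq0; right.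
  split.
  + rewrite (_ : phi n - psi n = phi n + cst (-1) * psi n).
      by apply: smoothD => //; apply: smoothM => //; exact: smooth_cst.
    by apply/funext => x; rewrite /GRing.add /GRing.mul /= mulN1r.
  + apply: (subclosed_compact _ _ sub); first exact: closed_closure.
    exact: compactU.
  + by apply: (subset_trans sub) => x [/pO|/sO].
- apply: (L2null_le mOm (C := 1) _ _ _ _ _ pv sw) => // [n|n|n|n x _].
  + exact: measurable_funB.
  + exact: measurable_funB.
  + by apply: measurable_funB; exact: measurable_funB.
  + rewrite mul1r -[X in `|X - _|]/(phi n x - psi n x).
    rewrite (_ : _ - _ = phi n x - v x - (psi n x - w x)); last by ring.
    exact: ler_normB.
- move=> i; apply: (L2null_le mOm (C := 1) _ _ _ _ _ (pG i) (sK i)) => // [n|n|n|n x _].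
  + exact: measurable_funB.
  + exact: measurable_funB.
  + under eq_fun do rewrite gE dE.
    by apply: measurable_funB; exact: measurable_funB.
  + rewrite mul1r gE dE.
    rewrite (_ : _ - _ = dx i (phi n) x - G x 0 i - (dx i (psi n) x - K x 0 i)); last by ring.
    exact: ler_normB.
Qed.

Lemma H10_test psi : test_function Om psi -> H10 Om psi (grad psi).
Proof.
move=> ts; apply: (H10_intro oOm Omoo (phi := fun=> psi)) => //.
- exact: test_in_Lp2.
- move=> i; under eq_fun do rewrite mxE.
  by apply: test_in_Lp2 => //; exact: test_function_dx.
- move=> e e0; apply: nearW => n.
  under eq_integral do rewrite subrr expr0n.
  by rewrite integral0 lee_fin ltW.
- move=> i e e0; apply: nearW => n.
  under eq_integral do rewrite mxE subrr expr0n.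
  by rewrite integral0 lee_fin ltW.
Qed.

End sobolev_operations.

(** * The space-time cylinder *)

Section space_time.
Context (R : realType) (N : nat) (Om : set 'rV[R]_N) (T : R).
Hypothesis oOm : open Om.
Hypothesis Omoo : (lebesgue_rV R N Om < +oo)%E.
Hypothesis T0 : 0 < T.
Local Notation leb := (lebesgue_rV R N).
Local Notation lebst := (@lebesgue_st R N).
Local Notation QT := (Q_T Om T).

Let mOm : measurable Om. Proof. exact: open_measurable_rV. Qed.

Lemma measurable_QT : measurable QT.
Proof. by apply: measurableX => //; exact: measurable_itv. Qed.

Lemma lebesgue_QT_lty : (lebst QT < +oo)%E.
Proof.
have -> : lebst QT = (@lebesgue_measure R `]0%R, T[%classic * leb Om)%E.
  by apply: product_measure1E => //; exact: measurable_itv.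
have l1 : @lebesgue_measure R `]0%R, T[%classic = T%:E.
  by rewrite lebesgue_measure_itv /= lte_fin T0 sube0.
by rewrite [X in (X * _)%E]l1 lte_mul_pinfty// lee_fin ltW.
Qed.

Lemma tonelli_QT (f : R * 'rV[R]_N -> R) :
  measurable_fun QT f -> (forall z, QT z -> 0 <= f z) ->
  (\int[lebst]_(z in QT) (f z)%:E =
   \int[@lebesgue_measure R]_(t in `]0%R, T[%classic) \int[leb]_(x in Om) (f (t, x))%:E)%E.
Proof.
move=> mf f0; rewrite [LHS]integral_mkcond fubini_tonelli1.
- rewrite [RHS]integral_mkcond; apply: eq_integral => t _.
  rewrite /fubini_F patchE; case: ifPn => [/set_mem tT|/negP tT].
    rewrite [RHS]integral_mkcond; apply: eq_integral => x _.
    rewrite !patchE; congr (if _ then _ else _).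
    by apply/idP/idP => /set_mem; [case=> /= _ /mem_set|move=> xO; apply/mem_set].
  apply: integral0_eq => x _; rewrite patchE ifF//; apply/negbTE/negP => /set_mem[/= tT' _].
  by apply: tT; exact/mem_set.
- rewrite -measurable_restrictT; last exact: measurable_QT.
  exact/measurable_EFinP.
- move=> z; rewrite patchE; case: ifPn => // /set_mem Qz.
  by rewrite lee_fin f0.
Qed.

(** Weak gradients in [x] are available on almost every time slice only; this carries identities
    from slices to the cylinder. *)
Lemma fubini_QT_eq0 (f : R * 'rV[R]_N -> R) :
  lebst.-integrable QT (EFin \o f) ->
  {ae @lebesgue_measure R, forall t, t \in `]0, T[ ->
    \int[leb]_(x in Om) f (t, x) = 0} ->
  \int[lebst]_(z in QT) f z = 0.
Proof.
move=> fi f0.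
have fi' : lebst.-integrable setT ((EFin \o f) \_ QT).
  by have [+ _] := integrable_mkcond (mu := lebst) (EFin \o f) measurable_QT; apply.
rewrite /Rintegral integral_mkcond -integral12_prod_meas1; last first.
  exact: fi'.
(* [fine] sends infinite values to 0, so a vanishing real-valued integral is informative only on
   slices where [f] is integrable, which is almost all of them. *)
have slice := ae_integrable1 fi'.
rewrite (ae_eq_integral (cst 0%E)) ?integral0//.
  exact: measurable_fubini_F fi'.
apply: filterS2 f0 slice; first exact: (ae_filter_ringOfSetsType (@lebesgue_measure R)).
move=> t ft0 it _ /=.
rewrite /fubini_F.
have [tT|tT] := boolP (t \in `]0, T[); last first.
  apply: integral0_eq => x _; rewrite patchE ifF//; apply/negbTE/negP => /set_mem[/= tT' _].
  by move/negP: tT; apply.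
have E x : ((EFin \o f) \_ QT) (t, x) = ((fun x => (f (t, x))%:E) \_ Om) x.
  rewrite !patchE; congr (if _ then _ else _).
  by apply/idP/idP => /set_mem; [case=> /= _ /mem_set|move=> xO; apply/mem_set].
have {}it : leb.-integrable Om (fun x => (f (t, x))%:E).
  apply/(integrable_mkcond _ mOm); by apply: eq_integrable it => // x _; exact: E.
rewrite (eq_integral ((fun x => (f (t, x))%:E) \_ Om)); last by move=> x _; exact: E.
rewrite -integral_mkcond -[LHS]fineK; last exact: integrable_fin_num it.
by congr EFin; exact: ft0.
Qed.

End space_time.

Lemma ae_impl d (T : measurableType d) (R : realType) (mu : {measure set T -> \bar R})
    (P S : T -> Prop) : (forall x, P x -> S x) ->
  {ae mu, forall x, P x} -> {ae mu, forall x, S x}.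
Proof.
by move=> PS; apply: filterS => //; exact: (ae_filter_ringOfSetsType mu).
Qed.

Lemma ae_impl2 d (T : measurableType d) (R : realType) (mu : {measure set T -> \bar R})
    (P Q S : T -> Prop) : (forall x, P x -> Q x -> S x) ->
  {ae mu, forall x, P x} -> {ae mu, forall x, Q x} -> {ae mu, forall x, S x}.
Proof.
by move=> PQS; apply: filterS2 => //; exact: (ae_filter_ringOfSetsType mu).
Qed.

(** * Operations on L^2(0,T; H^1_0) *)

Section parabolic_spaces.
Context (R : realType) (N : nat) (Om : set 'rV[R]_N) (T : R).
Hypothesis oOm : open Om.
Hypothesis Omoo : (lebesgue_rV R N Om < +oo)%E.
Hypothesis T0 : 0 < T.
Local Notation leb := (lebesgue_rV R N).
Local Notation lebst := (@lebesgue_st R N).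
Local Notation QT := (Q_T Om T).
Implicit Types (w : R * 'rV[R]_N -> R) (G K : R * 'rV[R]_N -> 'rV[R]_N).

Let mOm : measurable Om. Proof. exact: open_measurable_rV. Qed.
Let mQT : measurable QT. Proof. exact: measurable_QT. Qed.
Let QToo : (lebst QT < +oo)%E. Proof. exact: lebesgue_QT_lty. Qed.

Lemma in_Lp2_measurable_QT w : in_Lp lebst 2%:E QT w -> measurable_fun QT w.
Proof. by move=> /in_Lp2P-/(_ mQT)[]. Qed.

Lemma measurable_comp_QT (f : R -> R) w : smooth f -> measurable_fun QT w ->
  measurable_fun QT (fun z => f (w z)).
Proof.
move=> /smooth_continuous/continuous_measurable_fun mf mw.
exact: (measurableT_comp mf mw).
Qed.

Lemma measurable_time (f : R -> R) : smooth f ->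
  measurable_fun QT (fun z : R * 'rV[R]_N => f z.1).
Proof.
move=> /smooth_continuous/continuous_measurable_fun mf.
apply: measurable_funTS; exact: (measurableT_comp mf measurable_fst).
Qed.

Lemma measurable_space (f : 'rV[R]_N -> R) : smooth f ->
  measurable_fun QT (fun z : R * 'rV[R]_N => f z.2).
Proof.
move=> /smooth_continuous/continuous_measurable_rV mf.
apply: measurable_funTS; exact: (measurableT_comp mf measurable_snd).
Qed.

Lemma in_Lp2_domQT w w' (C : R) : measurable_fun QT w' -> in_Lp lebst 2%:E QT w ->
  (forall z, QT z -> `|w' z| <= C * `|w z|) -> in_Lp lebst 2%:E QT w'.
Proof. exact: (@in_Lp2_dom _ _ _ lebst QT mQT w w' C). Qed.

Lemma in_Lp2D_QT w w' : in_Lp lebst 2%:E QT w -> in_Lp lebst 2%:E QT w' ->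
  in_Lp lebst 2%:E QT (fun z => w z + w' z).
Proof. exact: (@in_Lp2D _ _ _ lebst QT mQT w w'). Qed.

Lemma in_Lp2B_QT w w' : in_Lp lebst 2%:E QT w -> in_Lp lebst 2%:E QT w' ->
  in_Lp lebst 2%:E QT (fun z => w z - w' z).
Proof. exact: (@in_Lp2B _ _ _ lebst QT mQT w w'). Qed.

Lemma in_Lp2_boundedQT w (C : R) : measurable_fun QT w ->
  (forall z, QT z -> `|w z| <= C) -> in_Lp lebst 2%:E QT w.
Proof. exact: (@in_Lp2_bounded _ _ _ lebst QT mQT QToo w C). Qed.

Lemma L2H10_comp (f : R -> R) (L L' : R) w G :
  smooth f -> f 0 = 0 -> (forall s, `|derive1 f s| <= L) ->
  (forall s, `|derive1 (derive1 f) s| <= L') ->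
  L2H10 Om T w G -> L2H10 Om T (fun z => f (w z)) (fun z => derive1 f (w z) *: G z).
Proof.
move=> sf f0 fL fL' [wL GL wG].
have mw := in_Lp2_measurable_QT wL.
have mG i := in_Lp2_measurable_QT (GL i).
have lip s t : `|f s - f t| <= L * `|s - t|.
  by apply: derive1_lipschitz => // x; exact: smooth_derivable.
split.
- apply: (in_Lp2_domQT (C := L) _ wL) => [|z _].
    exact: measurable_comp_QT.
  by rewrite -[f _]subr0 -f0 -{2}[w z]subr0.
- move=> i; apply: (in_Lp2_domQT (C := L) _ (GL i)) => [|z _].
    under eq_fun do rewrite mxE; apply: measurable_funM => //.
    by apply: measurable_comp_QT => //; exact: smooth_derive1.
  by rewrite mxE normrM ler_wpM2r.
- apply: (ae_impl _ wG) => t {}wG tT.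
  exact: (H10_comp oOm Omoo sf f0 fL fL' (wG tT)).
Qed.

Lemma L2H10_sub w G w' K : L2H10 Om T w G -> L2H10 Om T w' K ->
  L2H10 Om T (fun z => w z - w' z) (fun z => G z - K z).
Proof.
move=> [wL GL wG] [wL' KL wK]; split.
- exact: in_Lp2B_QT.
- move=> i; under eq_fun do rewrite !mxE; exact: in_Lp2B_QT.
- apply: (ae_impl2 _ wG wK) => t {}wG {}wK tT.
  exact: (H10_sub oOm Omoo (wG tT) (wK tT)).
Qed.

Lemma grad_scale (c : R) (chi : 'rV[R]_N -> R) x : smooth chi ->
  grad (fun x => c * chi x) x = c *: grad chi x.
Proof.
move=> sc; apply/rowP => i; rewrite !mxE /dx.
rewrite (_ : (fun x => _) = cst c * chi)//.
rewrite deriveM; [|exact: derivable_cst|exact: smooth_derivable].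
by rewrite derive_cst scaler0 addr0.
Qed.

Lemma L2H10_mul (eta : R -> R) chi (C : R) w G : smooth eta -> smooth chi ->
  (forall t, `|eta t| <= 1) -> (forall x, `|chi x| <= C) ->
  (forall i x, `|dx i chi x| <= C) -> L2H10 Om T w G ->
  L2H10 Om T (fun z => w z * (eta z.1 * chi z.2))
    (fun z => (eta z.1 * chi z.2) *: G z + (w z * eta z.1) *: grad chi z.2).
Proof.
move=> se sc e1 cC dC [wL GL wG].
have mw := in_Lp2_measurable_QT wL.
have mG i := in_Lp2_measurable_QT (GL i).
have me := measurable_time se; have mc := measurable_space sc.
have mdc i := measurable_space (smooth_dx i sc).
have C0 : 0 <= C := le_trans (normr_ge0 _) (cC 0).
have ecC t x : `|eta t * chi x| <= C.
  by rewrite normrM -[C]mul1r ler_pM.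
have mec : measurable_fun QT (fun z : R * 'rV[R]_N => eta z.1 * chi z.2).
  exact: measurable_funM.
split.
- apply: (in_Lp2_domQT (C := C) _ wL) => [|z _].
    exact: measurable_funM.
  by rewrite normrM mulrC ler_wpM2r.
- move=> i; under eq_fun do rewrite !mxE; apply: in_Lp2D_QT => //.
    apply: (in_Lp2_domQT (C := C) _ (GL i)) => [|z _].
      exact: measurable_funM.
    by rewrite normrM ler_wpM2r.
  apply: (in_Lp2_domQT (C := C) _ wL) => [|z _].
    by apply: measurable_funM => //; exact: measurable_funM.
  rewrite -mulrA normrM mulrC ler_wpM2r// normrM -[C]mul1r ler_pM//.
- apply: (ae_impl _ wG) => t {}wG tT /=.
  have sec : smooth (fun x => eta t * chi x).
    by apply: (@smoothM _ _ (cst (eta t)) chi) => //; exact: smooth_cst.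
  have dec i x : `|dx i (fun x => eta t * chi x) x| <= C.
    have -> : dx i (fun x => eta t * chi x) x = eta t * dx i chi x.
      by have /rowP/(_ i) := grad_scale (eta t) x sc; rewrite !mxE.
    by rewrite normrM -[C]mul1r ler_pM.
  have := H10_mul oOm Omoo sec (fun x => ecC t x) dec (wG tT).
  congr (H10 _ _ _); apply/funext => x.
  by rewrite grad_scale// scalerA.
Qed.

Lemma L2H10_test (eta : R -> R) chi : smooth eta -> (forall t, `|eta t| <= 1) ->
  test_function Om chi ->
  L2H10 Om T (fun z => eta z.1 * chi z.2) (fun z => eta z.1 *: grad chi z.2).
Proof.
move=> se e1 tc; have [sc _ _] := tc.
have me := measurable_time se; have mc := measurable_space sc.
have mdc i := measurable_space (smooth_dx i sc).
have [C C0 cC] := test_function_bounded tc.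
split.
- apply: (in_Lp2_boundedQT (C := C)) => [|z _]; first exact: measurable_funM.
  by rewrite normrM -[C]mul1r ler_pM.
- move=> i; under eq_fun do rewrite !mxE.
  have [D D0 dD] := test_function_bounded (test_function_dx i tc).
  apply: (in_Lp2_boundedQT (C := D)) => [|z _]; first exact: measurable_funM.
  by rewrite normrM -[D]mul1r ler_pM.
- apply: aeW => t tT /=.
  have tec : test_function Om (fun x => eta t * chi x).
    by apply: (@test_functionM _ _ _ (cst (eta t)) chi) => //; exact: smooth_cst.
  have := H10_test oOm Omoo tec; congr (H10 _ _ _); apply/funext => x.
  by rewrite grad_scale.
Qed.

(** * Uniqueness of gradients and the gradient of a power of |u| *)

Section gradients.
Context (u : R * 'rV[R]_N -> R) (Du : R * 'rV[R]_N -> 'rV[R]_N).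
Hypothesis uT : T120 Om T u.
Hypothesis uDu : generalized_gradient Om T u Du.

(* [Du] pins down the gradient of a truncation of [u]; perturbing the latter
   by a gradient of [0] shows that gradients are unique. *)
Lemma L2H10_zero K : L2H10 Om T (fun=> 0) K -> {ae lebst, forall z, QT z -> K z = 0}.
Proof.
move=> K0; have [_ /(_ 1 ltr01)[G uG]] := uT.
have uGK : L2H10 Om T (fun z => truncation 1 (u z)) (fun z => G z - K z).
  have := L2H10_sub uG K0; congr (L2H10 _ _ _ _).
  by apply/funext => z; rewrite subr0.
have [_ gg] := uDu.
apply: (ae_impl2 _ (gg 1 G ltr01 uG) (gg 1 _ ltr01 uGK)) => z e1 e2 Qz.
have := e2 Qz; rewrite -(e1 Qz) -[RHS]subr0 => /addrI/oppr_inj.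
exact.
Qed.

Lemma truncation_id (k s : R) : `|s| <= k -> truncation k s = s.
Proof.
rewrite ler_norml => /andP[ks sk]; rewrite /truncation.
by rewrite (min_idPr sk); apply/max_idPr.
Qed.

Lemma truncation_norm (k s : R) : 0 <= k -> k <= `|s| -> `|truncation k s| = k.
Proof.
move=> k0 ks; rewrite /truncation; have [s0|s0] := leP 0 s.
  rewrite ger0_norm// in ks; rewrite (min_idPl ks).
  by rewrite (max_idPr _) ?ger0_norm// (le_trans _ k0)// oppr_le0.
rewrite ltr0_norm// in ks.
rewrite (min_idPr _); last by rewrite (le_trans (ltW s0)).
rewrite (max_idPl _); last by rewrite lerNr.
by rewrite normrN ger0_norm.
Qed.

Lemma bounded_derivatives (f : R -> R) (K : R) : smooth f ->
  (forall s, K < `|s| -> f s = 0) ->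
  exists L, (forall s, `|derive1 f s| <= L) /\ forall s, `|derive1 (derive1 f) s| <= L.
Proof.
move=> sf fK.
have kf : compact (supp f).
  apply: (@subclosed_compact _ _ `[- K, K]); first exact: closed_closure.
    exact: segment_compact.
  rewrite /supp [X in _ `<=` X](closure_id _).1; last exact: itv_closed.
  apply: closureS => s /= fs; rewrite in_itv /= -ler_norml leNgt.
  by apply: contraNN fs => /fK ->.
have D1 (g : R -> R) : derive1 g = 'D_1 g by apply/funext => s; rewrite derive1E.
have sub : supp (derive1 f) `<=` supp f by rewrite D1; exact: supp_derive.
have sub' : supp (derive1 (derive1 f)) `<=` supp f.
  by apply: subset_trans sub; rewrite (D1 (derive1 f)); exact: supp_derive.
have sf' := smooth_derive1 sf; have sf'' := smooth_derive1 sf'.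
have kg g : supp g `<=` supp f -> compact (supp g).
  by move=> gf; apply: (subclosed_compact _ kf gf); exact: closed_closure.
have [L L0 fL] := compact_supp_bounded (smooth_continuous sf') (kg _ sub).
have [L' L'0 fL'] := compact_supp_bounded (smooth_continuous sf'') (kg _ sub').
exists (L + L'); split=> s; first by rewrite (le_trans (fL s))// lerDl.
by rewrite (le_trans (fL' s))// lerDr.
Qed.

(* Both [u] and [v = |u|^p] determine [b (ln v) = b (p ln |u|)], for a cutoff [b]
   supported in the range of [ln v] over [1/k < |u| < k]; comparing the two
   gradients relates [G] and [G']. *)
Lemma gradient_power (p k : R) G G' : 0 < p -> 1 < k ->
  L2H10 Om T (fun z => truncation k (u z)) G ->
  L2H10 Om T (fun z => `|u z| `^ p) G' ->
  {ae lebst, forall z, QT z -> 1 < `|u z| < k ->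
     G' z = (p * (`|u z| `^ p / u z)) *: G z}.
Proof.
move=> p0 k1 uG vG'; have k0 : 0 < k := lt_trans ltr01 k1.
(* The cutoff [b] will vanish from this height on, that is, for |u| >= k and for |u| <= 1/k. *)
pose M := p * ln k; have M0 : 0 < M by rewrite mulr_gt0// ln_gt0.
pose lin : R -> R := fun y => M^-1 * y.
have sMid : smooth lin.
  by apply: (@smoothM _ _ (cst M^-1) id); [exact: smooth_cst|exact: smooth_id].
pose b : R -> R := @cutoff R \o lin.
have sb : smooth b by apply: smooth_comp => //; exact: smooth_cutoff.
have b0 y : M <= `|y| -> b y = 0.
  move=> My; rewrite /b /= cutoff_out// /lin normrM normfV (gtr0_norm M0).
  by rewrite mulrC ler_pdivlMr// mul1r.
have bb : smooth_bounded_supp b by split => //; exists M.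
have db y : derive1 b y = dcutoff (M^-1 * y) * M^-1.
  rewrite derive1E derive_comp1; try exact: smooth_differentiable; last first.
    exact/smooth_differentiable/smooth_cutoff.
  by rewrite -!derive1E derive1_cutoff /lin derive1Ml// derive1_id mulr1.
pose f (r : R) := log_comp r b 0.
have sf (r : R) : 0 < r -> smooth (f r) by move=> r0; exact: smooth_log_comp.
have f0 (r : R) : f r 0 = 0 by rewrite /f /log_comp eqxx.
have fout (r : R) : 0 < r -> forall s : R, expR (M / r) < `|s| -> f r s = 0.
  move=> r0 s es; rewrite /f /log_comp; case: ifPn => // s0.
  rewrite b0 ?mul0r//.
  have : M / r <= ln `|s|.
    by rewrite -(expRK (M / r)) ler_ln ?posrE ?expR_gt0 ?normr_gt0// ltW.
  rewrite ler_pdivrMr// mulrC => /le_trans; apply; exact: ler_norm.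
have [L [L1 L2]] := bounded_derivatives (sf p p0) (fout p p0).
have [L' [L1' L2']] := bounded_derivatives (sf 1 ltr01) (fout 1 ltr01).
have H1 := L2H10_comp (sf p p0) (f0 p) L1 L2 uG.
have H2 := L2H10_comp (sf 1 ltr01) (f0 1) L1' L2' vG'.
(* For |u| > k both sides vanish, [b] being zero from [M = p ln k] on; the truncation is therefore
   invisible. At u = 0 both are 0 by definition of [log_comp]. *)
have eqf z : f p (truncation k (u z)) = f 1 (`|u z| `^ p).
  rewrite /f /log_comp !expr0 !invr1 !mulr1 powR_eq0 normr_eq0 (gt_eqF p0) andbT.
  rewrite mul1r (ger0_norm (powR_ge0 _ _)) ln_powR.
  have [uk|ku] := leP `|u z| k; first by rewrite truncation_id.
  have tk := truncation_norm (ltW k0) (ltW ku).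
  have u0 : u z != 0 by rewrite -normr_gt0 (lt_trans k0).
  rewrite (negPf u0) ifF; last first.
    by apply/negbTE; rewrite -normr_gt0 tk.
  rewrite tk (b0 (p * ln k)) ?(gtr0_norm M0)// b0//.
  rewrite ger0_norm; last by rewrite mulr_ge0 ?(ltW p0)// ln_ge0// (le_trans (ltW k1))// ltW.
  by rewrite ler_pM2l// ler_ln ?posrE ?normr_gt0// ltW.
have := L2H10_sub H1 H2; under eq_fun do rewrite eqf subrr.
move=> /L2H10_zero; apply: ae_impl => z /[apply] e /andP[u1 uk].
have u0 : u z != 0 by rewrite -normr_gt0 (lt_trans ltr01).
have v0 : 0 < `|u z| `^ p by rewrite powR_gt0// normr_gt0.
have dfE (r s : R) : 0 < r -> s != 0 ->
    derive1 (f r) s = r * (derive1 b (r * ln `|s|) * s^-1).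
  by move=> r0 s0; rewrite derive1_log_comp// /log_comp (negPf s0) expr1.
move/eqP: e; rewrite truncation_id ?ltW// !dfE ?u0 ?(gt_eqF v0)//.
rewrite !mul1r (gtr0_norm v0) ln_powR subr_eq0 => /eqP.
(* [p ln |u|] lies strictly between 0 and [M], where the derivative of the cutoff has no zero. At
   |u| = 1 it does vanish, whence the restriction to 1 < |u| < k. *)
have c0 : derive1 b (p * ln `|u z|) != 0.
  rewrite db mulf_neq0 ?invr_eq0 ?(gt_eqF M0)//; apply: dcutoff_neq0.
  rewrite /M invfM mulrACA mulVf ?gt_eqF// mul1r mulrC.
  rewrite divr_gt0 ?ln_gt0//= ltr_pdivrMr ?ln_gt0// mul1r.
  by rewrite ltr_ln ?posrE ?normr_gt0.
set c := derive1 b _ in c0 *; move=> e.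
have -> : G' z = (`|u z| `^ p * c^-1) *: ((c * (`|u z| `^ p)^-1) *: G' z).
  rewrite scalerA [X in X *: _](_ : _ = 1) ?scale1r//.
  by field; rewrite c0 gt_eqF.
rewrite -e scalerA; congr (_ *: _); by field; rewrite c0 u0.
Qed.

End gradients.

End parabolic_spaces.

(** * Renormalizing nonlinearities *)

Section smooth_linear_precomposition.
Context (R : realType) (E F : normedModType R) (L : {linear E -> F}).
Hypothesis cL : continuous L.

Lemma derive_comp_linear (f : F -> R) x v : smooth f ->
  'D_v (f \o L) x = 'D_(L v) f (L x).
Proof.
move=> sf; have df := smooth_differentiable (L x) sf.
have dL : differentiable L x by exact: linear_differentiable.
rewrite !deriveE//; last exact: differentiable_comp.
by rewrite diff_comp//= diff_lin.
Qed.

Lemma smooth_comp_linear (f : F -> R) : smooth f -> smooth (f \o L).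
Proof.
move=> sf; apply: (@smooth_ind _ _ (fun h => exists2 g, smooth g & h = g \o L)).
  move=> h [g sg ->]; split=> [x|v].
    apply: differentiable_comp; first exact: linear_differentiable.
    exact: smooth_differentiable.
  exists ('D_(L v) g); first exact: smooth_derive.
  by apply/funext => x; rewrite derive_comp_linear.
by exists f.
Qed.

End smooth_linear_precomposition.

Lemma smooth_smooth_closure (R : realType) (E : normedModType R) (U : set E) (f : E -> R) :
  smooth f -> smooth_closure U f.
Proof.
move=> sf; have si vs : smooth (iter_derive vs f).
  by elim: vs => //= v vs IH; exact: smooth_derive.
split.
- by move=> vs x _; exact: smooth_differentiable.
- exact/continuous_subspaceT/smooth_continuous.
- move=> vs; exists (iter_derive vs f) => //.
  exact/continuous_subspaceT/smooth_continuous.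
Qed.

Section weak_derivatives.
Context (R : realType).

Lemma weak_derivative_smooth (f : R -> R) : smooth f -> weak_derivative f (derive1 f).
Proof.
move=> sf psi [sp kp _].
have [M [_ Mb]] := compact_bounded kp.
pose K : R := Num.max M 0 + 1.
have MK : M < K by rewrite (@le_lt_trans _ _ (Num.max M 0)) ?le_max ?lexx// ltrDl.
have K0 : 0 <= K by rewrite addr_ge0// le_max lexx orbT.
have sf' := smooth_derive1 sf; have sp' := smooth_derive1 sp.
have p0 (g : R -> R) : supp g `<=` supp psi -> forall x : R, K < `|x| -> g x = 0.
  move=> gp x nx; apply: contrapT => /eqP gx.
  have : supp psi x by apply: gp; exact: subset_closure.
  by move=> /(Mb _ MK) /=; rewrite leNgt nx.
have D1 (g : R -> R) : derive1 g = 'D_1 g by apply/funext => s; rewrite derive1E.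
have p0' : forall x : R, K < `|x| -> derive1 psi x = 0.
  by apply: p0; rewrite D1; exact: supp_derive.
have ib (g : R -> R) : continuous g -> (forall x : R, K < `|x| -> g x = 0) ->
    (@lebesgue_measure R).-integrable setT (EFin \o g).
  move=> cg g0.
  have gK : (@lebesgue_measure R).-integrable [set` `[- K, K]] (EFin \o g).
    apply: continuous_compact_integrable; first exact: segment_compact.
    exact: continuous_subspaceT.
  have [/(_ gK) + _] := integrable_mkcond (mu := @lebesgue_measure R) (EFin \o g)
    (measurable_itv `[- K, K]).
  congr (_.-integrable _ _); apply/funext => x; rewrite patchE; case: ifPn => //.
  rewrite notin_setE /= in_itv /= => /negP; rewrite -ler_norml -ltNge => xK.
  by rewrite /= g0.
have c1 : continuous (fun s => f s * derive1 psi s).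
  by apply: smooth_continuous; apply: (@smoothM _ _ f (derive1 psi)).
have c2 : continuous (fun s => derive1 f s * psi s).
  by apply: smooth_continuous; apply: (@smoothM _ _ (derive1 f) psi).
have i1 := ib _ c1 (fun x Kx => etrans (congr1 ( *%R (f x)) (p0' x Kx)) (mulr0 _)).
have i2 := ib _ c2 (fun x Kx => etrans (congr1 ( *%R (derive1 f x)) (p0 _ (@subset_refl _ _) x Kx)) (mulr0 _)).
apply/eqP; rewrite -subr_eq0 opprK -RintegralD//; apply/eqP.
suff : (\int[lebesgue_measure]_x (f x * derive1 psi x + derive1 f x * psi x)%:E = 0)%E.
  by rewrite /Rintegral => ->.
apply: (@integral_derive_line _ (f * psi) (fun s => f s * derive1 psi s + derive1 f s * psi s) K).
- move=> x; have dM := is_deriveM (smooth_is_derive x sf) (smooth_is_derive x sp).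
  by apply: is_derive_eq; rewrite /GRing.scale /= [psi x * _]mulrC.
- by move=> x; apply: cvgD; [exact: c1|exact: c2].
- by move=> x Kx; rewrite /GRing.mul /= (p0 psi)// mulr0.
- by move=> x Kx; rewrite p0'// (p0 psi)// !mulr0 addr0.
Qed.

Lemma W2infty_smooth (f : R -> R) (M : R) : smooth f ->
  (forall s, `|f s| <= M) -> (forall s, `|derive1 f s| <= M) ->
  (forall s, `|derive1 (derive1 f) s| <= M) -> W2infty f.
Proof.
move=> sf f0 f1 f2; have sf' := smooth_derive1 sf; have sf'' := smooth_derive1 sf'.
have bd (g : R -> R) : smooth g -> (forall s, `|g s| <= M) ->
    in_Lp (@lebesgue_measure R) +oo%E setT g.
  move=> sg gM; apply: (@in_Lpy_bounded _ _ _ _ _ measurableT _ M) => //.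
  apply: continuous_measurable_fun; exact: smooth_continuous.
split.
- by move=> s; exact: smooth_derivable.
- exact: smooth_continuous.
- exists (derive1 f), (derive1 (derive1 f)); split; try exact: bd.
  + exact: weak_derivative_smooth.
  + exact: weak_derivative_smooth.
Qed.

End weak_derivatives.

Section smooth_truncation.
Context (R : realType) (k : R).
Hypothesis k0 : 0 < k.

(* A smooth odd concave-on-[0, +oo) substitute for the truncation at level [k]. *)
Definition strunc (s : R) : R := k * pcutoff (k^-1 * s).

Let lin : R -> R := fun s => k^-1 * s.

Let smooth_lin : smooth lin.
Proof. by apply: (@smoothM _ _ (cst k^-1) id); [exact: smooth_cst|exact: smooth_id]. Qed.

Let derive1_comp_lin (f : R -> R) s : smooth f ->
  derive1 (f \o lin) s = derive1 f (k^-1 * s) * k^-1.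
Proof.
move=> sf; rewrite derive1E derive_comp1; try exact: smooth_differentiable.
by rewrite -!derive1E /lin derive1Ml// derive1_id mulr1.
Qed.

Lemma smooth_strunc : smooth strunc.
Proof.
apply: (@smoothM _ _ (cst k) (@pcutoff R \o lin)); first exact: smooth_cst.
by apply: smooth_comp => //; exact: smooth_pcutoff.
Qed.

Lemma derive1_strunc s : derive1 strunc s = cutoff (k^-1 * s).
Proof.
rewrite derive1Ml; last first.
  apply: smooth_derivable; apply: (@smooth_comp _ _ _ lin) => //; exact: smooth_pcutoff.
rewrite derive1_comp_lin; last exact: smooth_pcutoff.
by rewrite derive1_pcutoff mulrCA divff ?mulr1// gt_eqF.
Qed.

Lemma derive2_strunc s : derive1 (derive1 strunc) s = k^-1 * dcutoff (k^-1 * s).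
Proof.
rewrite (_ : derive1 strunc = @cutoff R \o lin); last first.
  by apply/funext => t; rewrite derive1_strunc.
rewrite derive1_comp_lin; last exact: smooth_cutoff.
by rewrite derive1_cutoff mulrC.
Qed.

Lemma scaled_ge1 s : k <= `|s| -> 1 <= `|k^-1 * s|.
Proof. by move=> ks; rewrite normrM normfV (gtr0_norm k0) mulrC ler_pdivlMr// mul1r. Qed.

Lemma derive1_strunc_out s : k <= `|s| -> derive1 strunc s = 0.
Proof. by move=> /scaled_ge1 ks; rewrite derive1_strunc cutoff_out. Qed.

Lemma derive2_strunc_out s : k <= `|s| -> derive1 (derive1 strunc) s = 0.
Proof. by move=> /scaled_ge1 ks; rewrite derive2_strunc dcutoff_out// mulr0. Qed.

Lemma derive1_strunc_itv s : 0 <= derive1 strunc s <= 1.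
Proof. by rewrite derive1_strunc cutoff_ge0 cutoff_le1. Qed.

Lemma strunc0 : strunc 0 = 0.
Proof. by rewrite /strunc mulr0 pcutoff0E mulr0. Qed.

Lemma strunc_le s : `|strunc s| <= `|s|.
Proof.
rewrite normrM (gtr0_norm k0) mulrC -ler_pdivlMr//.
by rewrite (le_trans (pcutoff_le _))// normrM normfV (gtr0_norm k0) mulrC.
Qed.

Lemma strunc_bounded s : `|strunc s| <= k.
Proof. by rewrite normrM (gtr0_norm k0) ler_piMr ?(ltW k0)// pcutoff_bounded. Qed.

Lemma strunc_mono s t : s <= t -> strunc s <= strunc t.
Proof. by move=> st; rewrite ler_pM2l// pcutoff_mono// ler_pM2l// invr_gt0. Qed.

Lemma strunc_ge s : 0 <= s <= k / 2 -> cutoff 2^-1 * s <= strunc s.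
Proof.
move=> /andP[s0 sk]; have : cutoff 2^-1 * (k^-1 * s) <= pcutoff (k^-1 * s).
  apply: pcutoff_ge; rewrite mulr_ge0 ?invr_ge0 ?(ltW k0)//=.
  by rewrite ler_pdivrMl// mulrC mulrC.
by rewrite -(ler_pM2l k0) /strunc => /(le_trans _); apply; rewrite mulrCA mulVKf ?gt_eqF.
Qed.

Lemma strunc_W2infty : W2infty strunc.
Proof.
have [C C0 dC] := @dcutoff_bounded R.
apply: (@W2infty_smooth _ _ (k + 1 + k^-1 * C) smooth_strunc) => s.
- by rewrite (le_trans (strunc_bounded s))// -addrA lerDl addr_ge0// mulr_ge0 ?invr_ge0 ?ltW.
- have /andP[a b] := derive1_strunc_itv s.
  rewrite ger0_norm// (le_trans b)// addrAC lerDr addr_ge0 ?(ltW k0)//.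
  by rewrite mulr_ge0 ?invr_ge0 ?ltW.
- rewrite derive2_strunc normrM gtr0_norm ?invr_gt0//.
  rewrite ler_wpDl ?addr_ge0 ?(ltW k0)// ler_wpM2l ?invr_ge0 ?(ltW k0)//.
Qed.

Lemma strunc_compact_supp : compact (supp (derive1 strunc)).
Proof.
apply: (@subclosed_compact _ _ `[- k, k]); first exact: closed_closure.
  exact: segment_compact.
rewrite /supp [X in _ `<=` X](closure_id _).1; last exact: itv_closed.
apply: closureS => s /= fs; rewrite in_itv /= -ler_norml leNgt.
by apply: contraNN fs => /ltW/derive1_strunc_out ->.
Qed.

End smooth_truncation.

Section dot_product.
Context (R : realType) (N : nat).
Implicit Types (x y z : 'rV[R]_N).

Lemma dotDr x y z : dot x (y + z) = dot x y + dot x z.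
Proof. by rewrite /dot -big_split; apply: eq_bigr => i _; rewrite mxE mulrDr. Qed.

Lemma dotZr x y (c : R) : dot x (c *: y) = c * dot x y.
Proof. by rewrite /dot mulr_sumr; apply: eq_bigr => i _; rewrite mxE mulrCA. Qed.

Lemma dotBr x y z : dot x (y - z) = dot x y - dot x z.
Proof. by rewrite dotDr -scaleN1r dotZr mulN1r. Qed.

Lemma dotxx_ge0 x : 0 <= dot x x.
Proof. by apply: sumr_ge0 => i _; rewrite -expr2 sqr_ge0. Qed.

Lemma enorm_ge0 x : 0 <= enorm x.
Proof. exact: sqrtr_ge0. Qed.

Lemma enorm_sqr x : enorm x ^+ 2 = dot x x.
Proof. by rewrite sqr_sqrtr// dotxx_ge0. Qed.

Lemma coor_le_enorm x i : `|x 0 i| <= enorm x.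
Proof.
rewrite -sqrtr_sqr ler_wsqrtr// /dot (bigD1 i)//= -expr2 lerDl.
by apply: sumr_ge0 => j _; rewrite -expr2 sqr_ge0.
Qed.

Lemma dot_le x y (c : R) : (forall i, `|y 0 i| <= c) -> `|dot x y| <= N%:R * (enorm x * c).
Proof.
move=> yc; rewrite /dot (le_trans (ler_norm_sum _ _ _))//.
apply: (@le_trans _ _ (\sum_(i < N) (enorm x * c))).
  by apply: ler_sum => i _; rewrite normrM ler_pM// coor_le_enorm.
by rewrite sumr_const card_ord mulr_natl.
Qed.

End dot_product.

(** * The equation of a truncated solution *)

Section renormalized.
Context (R : realType) (N : nat) (Om : set 'rV[R]_N) (T : R).
Hypothesis oOm : open Om.
Hypothesis Omoo : (lebesgue_rV R N Om < +oo)%E.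
Hypothesis T0 : 0 < T.
Local Notation leb := (lebesgue_rV R N).
Local Notation lebst := (@lebesgue_st R N).
Local Notation QT := (Q_T Om T).

Let mOm : measurable Om. Proof. exact: open_measurable_rV. Qed.
Let mQT : measurable QT. Proof. exact: measurable_QT. Qed.
Let QToo : (lebst QT < +oo)%E. Proof. exact: lebesgue_QT_lty. Qed.

Lemma measurable_dot d (X : measurableType d) (D : set X) (f g : X -> 'rV[R]_N) :
  (forall i, measurable_fun D (fun z => f z 0 i)) ->
  (forall i, measurable_fun D (fun z => g z 0 i)) ->
  measurable_fun D (fun z => dot (f z) (g z)).
Proof.
by move=> mf mg; apply: measurable_sum => i; exact: measurable_funM.
Qed.

Lemma measurable_enorm d (X : measurableType d) (D : set X) (f : X -> 'rV[R]_N) :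
  (forall i, measurable_fun D (fun z => f z 0 i)) ->
  measurable_fun D (fun z => enorm (f z)).
Proof.
move=> mf; have ms : measurable_fun setT (@Num.sqrt R).
  by apply: continuous_measurable_fun; exact: sqrt_continuous.
exact: (measurableT_comp ms (measurable_dot mf mf)).
Qed.

Lemma smooth_separated (eta : R -> R) (chi : 'rV[R]_N -> R) : smooth eta -> smooth chi ->
  smooth (fun z : R * 'rV[R]_N => eta z.1 * chi z.2).
Proof.
move=> se sc; apply: (@smoothM _ _ (eta \o fst) (chi \o snd)).
  by apply: (@smooth_comp_linear _ _ _ fst) => // z; exact: cvg_fst.
by apply: (@smooth_comp_linear _ _ _ snd) => // z; exact: cvg_snd.
Qed.

Lemma time_derivative_separated (eta : R -> R) (chi : 'rV[R]_N -> R) z :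
  smooth eta -> smooth chi ->
  'D_((1, 0) : R * 'rV[R]_N) (fun z : R * 'rV[R]_N => eta z.1 * chi z.2) z =
  derive1 eta z.1 * chi z.2.
Proof.
move=> se sc.
have c1 : continuous (fst : R * 'rV[R]_N -> R) by move=> y; exact: cvg_fst.
have c2 : continuous (snd : R * 'rV[R]_N -> 'rV[R]_N) by move=> y; exact: cvg_snd.
have s1 : smooth (eta \o fst : R * 'rV[R]_N -> R).
  by apply: (@smooth_comp_linear _ _ _ fst).
have s2 : smooth (chi \o snd : R * 'rV[R]_N -> R).
  by apply: (@smooth_comp_linear _ _ _ snd).
rewrite (_ : (fun z : R * 'rV[R]_N => _) = (eta \o fst) * (chi \o snd))//.
rewrite deriveM; try exact: smooth_derivable.
rewrite (@derive_comp_linear _ _ _ fst)// (@derive_comp_linear _ _ _ snd)//=.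
by rewrite derive0 scaler0 add0r derive1E /GRing.scale /= mulrC.
Qed.

Context (gamma q : R) (u0 : 'rV[R]_N -> R) (u : R * 'rV[R]_N -> R).
Hypothesis q0 : 0 < q.
Hypothesis mu0 : measurable_fun Om u0.
Hypothesis usol : renormalized_solution Om T gamma q u0 u.

(** The renormalized equation with [S = strunc k] and a test function separated in time and space.
    The generalized gradient may be replaced by [G], because S' and S'' vanish where |u| >= k. *)
Lemma renormalized_truncated (k : R) (G : R * 'rV[R]_N -> 'rV[R]_N)
    (eta : R -> R) (chi : 'rV[R]_N -> R) :
  0 < k -> L2H10 Om T (fun z => truncation k (u z)) G ->
  smooth eta -> (forall t, `|eta t| <= 1) -> eta T = 0 -> test_function Om chi ->
  - (eta 0 * \int[leb]_(x in Om) (strunc k (u0 x) * chi x)) +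
  \int[lebst]_(z in QT) (- strunc k (u z) * (derive1 eta z.1 * chi z.2) +
     (derive1 (strunc k) (u z) * eta z.1 * dot (G z) (grad chi z.2) +
      derive1 (derive1 (strunc k)) (u z) * (eta z.1 * chi z.2) * dot (G z) (G z))) =
  gamma * \int[lebst]_(z in QT)
     (enorm (G z) `^ q * derive1 (strunc k) (u z) * (eta z.1 * chi z.2)).
Proof.
move=> k0 uG se e1 eT tc; have [sc _ _] := tc.
have [[mu uT] uL1 [Du [[mDu gg] _ weak]]] := usol.
have sS := @smooth_strunc _ k.
have sS' := smooth_derive1 sS; have sS'' := smooth_derive1 sS'.
(* S' equals 1 at 0, so the chain rule in H^1_0 does not apply to it. It applies to [f = 1 - S'],
   and S'(u) phi is then phi - f(u) phi, with phi itself a test function in space. *)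
pose f : R -> R := cst 1 + cst (- 1) * derive1 (strunc k).
have sf : smooth f.
  apply: smoothD; first exact: smooth_cst.
  by apply: smoothM => //; exact: smooth_cst.
have fE s : f s = 1 - derive1 (strunc k) s.
  by rewrite -[LHS]/(1 + -1 * derive1 (strunc k) s) mulN1r.
have f0 : f 0 = 0 by rewrite fE derive1_strunc// mulr0 cutoff0 subrr.
have df s : derive1 f s = - derive1 (derive1 (strunc k)) s.
  rewrite (_ : f = fun s => 1 - derive1 (strunc k) s); last by apply/funext.
  rewrite derive1E deriveB; [|exact: derivable_cst|exact: smooth_derivable].
  by rewrite derive_cst sub0r derive1E.
have fout (s : R) : k < `|s| -> derive1 (strunc k) s = 0.
  by move=> /ltW; exact: derive1_strunc_out.
have [L [L1 L2]] := bounded_derivatives sS' fout.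
have L3 s : `|derive1 f s| <= L by rewrite df normrN.
have L4 s : `|derive1 (derive1 f) s| <= L.
  rewrite (_ : derive1 f = fun s => - derive1 (derive1 (strunc k)) s); last exact/funext.
  rewrite derive1E deriveN; last exact: smooth_derivable.
  by rewrite -derive1E normrN.
have [C C0 cC] := test_function_bounded tc.
have dxb : exists2 D, 0 <= D & forall i x, `|dx i chi x| <= D.
  have /choice[D D0] (i : 'I_N) : exists D, forall x, `|dx i chi x| <= D.
    by have [D _ cD] := test_function_bounded (test_function_dx i tc); exists D.
  exists (\sum_i `|D i|); first by apply: sumr_ge0.
  move=> i x; rewrite (le_trans (D0 i x))// (le_trans (ler_norm _))//.
  by rewrite (bigD1 i)//= lerDl sumr_ge0.
have [D D0 cD] := dxb.
have cCD x : `|chi x| <= C + D by rewrite (le_trans (cC x))// lerDl.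
have dCD i x : `|dx i chi x| <= C + D by rewrite (le_trans (cD i x))// lerDr.
have H1 := L2H10_comp oOm Omoo sf f0 L3 L4 uG.
have H2 := L2H10_mul oOm Omoo se sc e1 cCD dCD H1.
have H3 := L2H10_sub oOm Omoo (L2H10_test oOm Omoo T0 se e1 tc) H2.
pose w z := truncation k (u z).
have S'w z : derive1 (strunc k) (w z) = derive1 (strunc k) (u z).
  rewrite /w; have [uk|ku] := leP `|u z| k; first by rewrite truncation_id.
  by rewrite !derive1_strunc_out ?truncation_norm ?(ltW k0) ?(ltW ku).
have S''w z : derive1 (derive1 (strunc k)) (w z) = derive1 (derive1 (strunc k)) (u z).
  rewrite /w; have [uk|ku] := leP `|u z| k; first by rewrite truncation_id.
  by rewrite !derive2_strunc_out ?truncation_norm ?(ltW k0) ?(ltW ku).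
pose DD (z : R * 'rV[R]_N) := eta z.1 *: grad chi z.2 -
   ((eta z.1 * chi z.2) *: (derive1 f (w z) *: G z) + (f (w z) * eta z.1) *: grad chi z.2).
have H4 : L2H10 Om T (fun z => derive1 (strunc k) (u z) * (eta z.1 * chi z.2)) DD.
  move: H3; congr (L2H10 _ _ _ _); apply/funext => z.
  by rewrite -/(w z) fE S'w; ring.
have := weak (strunc k) (fun z => eta z.1 * chi z.2) DD
  (strunc_W2infty k0) (strunc_compact_supp k0)
  (smooth_smooth_closure _ (smooth_separated se sc)) _ H4.
rewrite /= => /(_ _)/wrap[x _|]; first by rewrite eT mul0r.
have bchi : \int[leb]_(x in Om) (strunc k (u0 x) * (eta 0 * chi x)) =
    eta 0 * \int[leb]_(x in Om) (strunc k (u0 x) * chi x).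
  under eq_Rintegral do rewrite mulrCA.
  apply: RintegralZl => //; apply: (@bounded_integr _ _ _ _ _ mOm _ (k * C)) => //.
    apply: measurable_funM; last exact: smooth_measurable.
    exact: measurable_comp_smooth.
  by move=> x _; rewrite normrM ler_pM// strunc_bounded.
rewrite bchi => /esym weak'.
have G_Du := gg k G k0 uG.
have mG i : measurable_fun QT (fun z => G z 0 i).
  by case: uG => _ /(_ i) + _ => /in_Lp2P-/(_ mQT)[].
have mDui i : measurable_fun QT (fun z => Du z 0 i).
  exact: (measurableT_comp (measurable_coor i) mDu).
have mgc i : measurable_fun QT (fun z : R * 'rV[R]_N => grad chi z.2 0 i).
  by under eq_fun do rewrite mxE; exact: measurable_space (smooth_dx i sc).
have me : measurable_fun QT (fun z : R * 'rV[R]_N => eta z.1) := measurable_time se.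
have me' : measurable_fun QT (fun z : R * 'rV[R]_N => derive1 eta z.1).
  exact: measurable_time (smooth_derive1 se).
have mc : measurable_fun QT (fun z : R * 'rV[R]_N => chi z.2) := measurable_space sc.
have mSu := measurable_comp_QT sS mu.
have mS'u := measurable_comp_QT sS' mu.
have mS''u := measurable_comp_QT sS'' mu.
have mfG : measurable_fun QT (fun z => - strunc k (u z) * (derive1 eta z.1 * chi z.2) +
     (derive1 (strunc k) (u z) * eta z.1 * dot (G z) (grad chi z.2) +
      derive1 (derive1 (strunc k)) (u z) * (eta z.1 * chi z.2) * dot (G z) (G z))).
  apply: measurable_funD.
    by apply: measurable_funM; [exact: measurable_funN|exact: measurable_funM].
  apply: measurable_funD.
    by apply: measurable_funM; [exact: measurable_funM|exact: measurable_dot].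
  apply: measurable_funM; last exact: measurable_dot.
  by apply: measurable_funM => //; exact: measurable_funM.
have mdc i : measurable_fun QT (fun z : R * 'rV[R]_N => dx i chi z.2).
  exact: measurable_space (smooth_dx i sc).
have mDD i : measurable_fun QT (fun z => DD z 0 i).
  rewrite (_ : (fun z => _) = fun z : R * 'rV[R]_N => eta z.1 * dx i chi z.2 -
      ((eta z.1 * chi z.2) * (- derive1 (derive1 (strunc k)) (u z) * G z 0 i) +
       ((1 - derive1 (strunc k) (u z)) * eta z.1) * dx i chi z.2)).
    apply: measurable_funB; first exact: measurable_funM.
    apply: measurable_funD.
      apply: measurable_funM; first exact: measurable_funM.
      by apply: measurable_funM => //; exact: measurable_funN.
    apply: measurable_funM => //; apply: measurable_funM => //.
    exact: measurable_funB.
  by apply/funext => z; rewrite /DD !mxE df fE S'w S''w.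
have mpow (F : R * 'rV[R]_N -> 'rV[R]_N) : (forall i, measurable_fun QT (fun z => F z 0 i)) ->
    measurable_fun QT (fun z => enorm (F z) `^ q * derive1 (strunc k) (u z) * (eta z.1 * chi z.2)).
  move=> mF; apply: measurable_funM; last exact: measurable_funM.
  apply: measurable_funM => //.
  exact: (measurableT_comp (@measurable_powR R q) (measurable_enorm mF)).
have QTk : {ae lebst, forall z, QT z -> `|u z| < k -> Du z = G z}.
  by apply: (ae_impl _ G_Du) => z + Qz uk => ->//; rewrite uk.
have -> : \int[lebst]_(z in QT)
     (enorm (G z) `^ q * derive1 (strunc k) (u z) * (eta z.1 * chi z.2)) =
   \int[lebst]_(z in QT)
     (enorm (Du z) `^ q * derive1 (strunc k) (u z) * (eta z.1 * chi z.2)).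
  apply: ae_eq_Rintegral => //; [exact: mpow|exact: mpow|].
  apply: (ae_impl _ QTk) => z uG' Qz.
  have [uk|ku] := ltP `|u z| k; first by rewrite uG'.
  have -> : derive1 (strunc k) (u z) = 0 by exact: derive1_strunc_out.
  by rewrite !mulr0 !mul0r.
rewrite weak'; congr (_ + _); apply: ae_eq_Rintegral => //.
  apply: measurable_funD; last exact: measurable_dot.
  apply: measurable_funM; first exact: measurable_funN.
  under eq_fun do rewrite time_derivative_separated//.
  exact: measurable_funM.
apply: (ae_impl _ QTk) => z uG' Qz; rewrite time_derivative_separated//.
congr (_ + _); rewrite /DD dotBr dotDr !dotZr df fE S'w S''w.
have [uk|ku] := ltP `|u z| k; first by rewrite uG'//; ring.
by rewrite !derive1_strunc_out ?derive2_strunc_out//; ring.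
Qed.

End renormalized.

(** * The energy inequality *)

Section real_inequalities.
Context (R : realType).
Implicit Types (x y a b : R).

(** Either b <= g a^(q-1) and the first term suffices, or a < (b/g)^(1/(q-1)) and the second does;
    the latter case gives the constant. *)
Lemma young_weighted (q g : R) : 1 < q -> 0 < g ->
  exists2 C, 0 < C & forall a b, 0 <= a -> 0 <= b ->
    a * b <= g * a `^ q + C * b `^ (q / (q - 1)).
Proof.
move=> q1 g0; have q0 : 0 < q by rewrite (lt_trans ltr01).
have q10 : 0 < q - 1 by rewrite subr_gt0.
exists ((g^-1) `^ (q - 1)^-1); first by rewrite powR_gt0// invr_gt0.
move=> a b a0 b0.
have [ba|ab] := leP b (g * a `^ (q - 1)).
  apply: (@le_trans _ _ (g * a `^ q)); last first.
    by rewrite lerDl mulr_ge0// powR_ge0.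
  apply: (le_trans (ler_wpM2l a0 ba)).
  by rewrite mulrCA mulr_powRB1.
have b1 : 0 < b by rewrite (le_lt_trans _ ab)// mulr_ge0 ?powR_ge0// ltW.
apply: (@le_trans _ _ ((g^-1) `^ (q - 1)^-1 * b `^ (q / (q - 1)))); last first.
  by rewrite lerDr mulr_ge0 ?powR_ge0// ltW.
have -> : q / (q - 1) = (q - 1)^-1 + 1 by field; rewrite gt_eqF.
rewrite powRD; last by rewrite (gt_eqF b1) implybT.
rewrite powRr1// mulrA ler_wpM2r// -powRM ?invr_ge0 ?(ltW g0)//.
have {1}-> : a = (a `^ (q - 1)) `^ (q - 1)^-1.
  by rewrite -powRrM divff ?gt_eqF// powRr1.
rewrite ge0_ler_powR ?nnegrE ?powR_ge0 ?invr_ge0 ?(ltW q10)//.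
  by rewrite mulr_ge0 ?invr_ge0 ?(ltW g0) ?(ltW b1).
by rewrite ler_pdivlMl// ltW.
Qed.

Lemma powR_le_sqr (q x : R) : 0 <= q <= 2 -> 0 <= x -> x `^ q <= 1 + x ^+ 2.
Proof.
move=> /andP[q0 q2] x0; have [x1|x1] := leP x 1.
  apply: (@le_trans _ _ (1 `^ q)); last by rewrite powR1 lerDl sqr_ge0.
  by rewrite ge0_ler_powR ?nnegrE.
apply: (@le_trans _ _ (x `^ 2)); first by rewrite ler_powR// ltW.
by rewrite powR_mulrn// lerDr.
Qed.

End real_inequalities.

Section energy.
Context (R : realType) (N : nat) (Om : set 'rV[R]_N) (T : R).
Hypothesis oOm : open Om.
Hypothesis Omoo : (lebesgue_rV R N Om < +oo)%E.
Hypothesis T0 : 0 < T.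
Local Notation leb := (lebesgue_rV R N).
Local Notation lebst := (@lebesgue_st R N).
Local Notation QT := (Q_T Om T).

Let mOm : measurable Om. Proof. exact: open_measurable_rV. Qed.
Let mQT : measurable QT. Proof. exact: measurable_QT. Qed.
Let QToo : (lebst QT < +oo)%E. Proof. exact: lebesgue_QT_lty. Qed.

Local Notation integQT f := (lebst.-integrable QT (EFin \o (f : R * 'rV[R]_N -> R))).

Lemma integrZl_QT (c : R) (f : R * 'rV[R]_N -> R) :
  integQT f -> integQT (fun z => c * f z).
Proof. exact: (@integrZl _ _ _ lebst QT mQT c f). Qed.

Lemma integrD_QT (f g : R * 'rV[R]_N -> R) :
  integQT f -> integQT g -> integQT (fun z => f z + g z).
Proof. exact: (@integrD _ _ _ lebst QT mQT f g). Qed.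

Lemma le_integr_QT (f g : R * 'rV[R]_N -> R) : measurable_fun QT f -> integQT g ->
  (forall z, QT z -> `|f z| <= g z) -> integQT f.
Proof. exact: (@le_integr _ _ _ lebst QT mQT f g). Qed.

Lemma bounded_integr_QT (f : R * 'rV[R]_N -> R) (M : R) : measurable_fun QT f ->
  (forall z, QT z -> `|f z| <= M) -> integQT f.
Proof. exact: (@bounded_integr _ _ _ lebst QT mQT f M QToo). Qed.

Lemma L2H10_coor w (G : R * 'rV[R]_N -> 'rV[R]_N) : L2H10 Om T w G ->
  (forall i, measurable_fun QT (fun z => G z 0 i)) /\
  lebst.-integrable QT (EFin \o (fun z => dot (G z) (G z))).
Proof.
case=> _ GL _; split=> [i|]; first by move: (GL i) => /in_Lp2P-/(_ mQT)[].
apply: (@integr_sum _ _ _ lebst QT mQT) => i.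
by move: (GL i) => /in_Lp2P-/(_ mQT)[].
Qed.

Context (gamma q rho : R) (u0 : 'rV[R]_N -> R) (u : R * 'rV[R]_N -> R).
Hypothesis q1 : 1 < q.
Hypothesis q2 : q <= 2.
Hypothesis rho1 : 1 <= rho.
Hypothesis gamma0 : 0 < gamma.
Hypothesis mu0 : measurable_fun Om u0.
Hypothesis usol : renormalized_solution Om T gamma q u0 u.
Hypothesis urho : in_L2H10 Om T (fun z => `|u z| `^ (rho / 2)).

(* The bound [|u|^(2 - rho) <= |u| <= k] where [1 < |u| < k] makes the
   truncation error dominated by the integrable [|D |u|^(rho/2)|^2]. *)
Lemma truncation_error (e : R) (n0 : nat) : 0 < e ->
  exists k : R, [/\ n0%:R <= k, 0 < k & exists G E : R * 'rV[R]_N -> _,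
    [/\ L2H10 Om T (fun z => truncation k (u z)) G,
        lebst.-integrable QT (EFin \o E),
        forall z, 0 <= E z,
        \int[lebst]_(z in QT) E z <= e &
        {ae lebst, forall z, QT z ->
          `|derive1 (derive1 (strunc k)) (u z)| * dot (G z) (G z) <= E z}]].
Proof.
move=> e0; have [[mu uT] _ [Du [gDu _ _]]] := usol.
have uT12 : T120 Om T u by split.
have [_ gg] := gDu.
have [C C0 dC] := @dcutoff_bounded R.
have [G' vG'] := urho.
have [G2 uG2] := uT 2 (ltr0n _ 2).
pose p := rho / 2; have p0 : 0 < p by rewrite divr_gt0// (lt_le_trans ltr01).
have [mG2 iG2] := L2H10_coor uG2; have [mG' iG'] := L2H10_coor vG'.
(* The shift by 2 keeps every level above 1, as [gradient_power] requires. *)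
pose k (n : nat) : R := n.+2%:R.
have k0 n : 0 < k n by rewrite ltr0n.
have k1 n : 1 < k n by rewrite ltr1n.
(* A majorant of |S''(u)| |G|^2 that does not mention the gradient at level [k n]. Where |u| <= 1
   that gradient is [G2]; where 1 < |u| < k it is expressed by [G']. The minimum with 1 keeps [h n]
   below the integrable [g] everywhere, while [h n] tends to 0 pointwise, so dominated convergence
   selects the level. *)
pose h n z : R := C * ((k n)^-1 * dot (G2 z) (G2 z) +
   Num.min 1 (`|u z| / k n) * (p ^- 2 * dot (G' z) (G' z))).
have h0 n z : 0 <= h n z.
  rewrite mulr_ge0 ?(ltW C0)// addr_ge0// mulr_ge0 ?dotxx_ge0 ?invr_ge0 ?(ltW (k0 n))//.
    by rewrite le_min ler01 divr_ge0// ltW.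
  by rewrite mulr_ge0 ?dotxx_ge0// invr_ge0 sqr_ge0.
pose g z : R := C * (dot (G2 z) (G2 z) + p ^- 2 * dot (G' z) (G' z)).
have hg n z : h n z <= g z.
  rewrite ler_pM2l// lerD//.
    by rewrite ler_piMl ?dotxx_ge0// invf_le1// ltW.
  by rewrite ler_piMl ?ge_min ?lexx// mulr_ge0 ?dotxx_ge0// invr_ge0 sqr_ge0.
have ig : lebst.-integrable QT (EFin \o g).
  by apply: integrZl_QT; apply: integrD_QT => //; exact: integrZl_QT.
have mh n : measurable_fun QT (h n).
  apply: measurable_funM => //; apply: measurable_funD.
    by apply: measurable_funM => //; exact: measurable_dot.
  apply: measurable_funM.
    by apply: measurable_minr => //; apply: measurable_funM => //; exact: measurableT_comp.
  by apply: measurable_funM => //; exact: measurable_dot.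
have h_cvg z : h n z @[n --> \oo] --> (0 : R).
  pose K := C * (dot (G2 z) (G2 z) + `|u z| * (p ^- 2 * dot (G' z) (G' z))).
  have Kh : K * harmonic n @[n --> \oo] --> (0 : R).
    by rewrite -(mulr0 K); apply: cvgM; [exact: cvg_cst|exact: cvg_harmonic].
  apply: (squeeze_cvgr _ (cvg_cst 0) Kh); apply: nearW => n; rewrite h0 /=.
  rewrite /h /K -mulrA ler_pM2l// mulrDl.
  have kh : (k n)^-1 <= n.+1%:R^-1 by rewrite lef_pV2 ?posrE ?ltr0n// ler_nat.
  apply: lerD; first by rewrite mulrC ler_wpM2l// dotxx_ge0.
  rewrite mulrAC ler_wpM2r//.
    by rewrite mulr_ge0 ?dotxx_ge0// invr_ge0 sqr_ge0.
  by rewrite (@le_trans _ _ (`|u z| / k n)) ?ge_min ?lexx ?orbT// ler_wpM2l.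
have ih n : lebst.-integrable QT (EFin \o h n).
  apply: (le_integr_QT (mh n) ig) => z _.
  by rewrite ger0_norm.
have mhE n : measurable_fun QT (EFin \o h n) by exact/measurable_EFinP.
have cvgE z : (fun n => (h n z)%:E) @ \oo --> (0 : R)%:E.
  by apply/fine_cvgP; split; [exact: nearW|exact: h_cvg].
have boundE n z : (`|(h n z)%:E| <= (g z)%:E)%E.
  by rewrite abse_EFin lee_fin ger0_norm.
have ae1 : {ae lebst, forall z, QT z -> (fun n => (h n z)%:E) @ \oo --> (cst 0%:E : _ -> \bar R) z}.
  by apply: aeW => z _; exact: cvgE.
have ae2 : {ae lebst, forall z n, QT z -> (`|(EFin \o h n) z| <= (EFin \o g) z)%E}.
  by apply: aeW => z n _; exact: boundE.
have [_ _ lim0] := @dominated_convergence _ _ R lebst QT mQT (fun n => EFin \o h n)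
  (cst 0%:E) (EFin \o g) mhE (measurable_cst _) ae1 ig ae2.
move: lim0; rewrite integral0 => /fine_cvgP[_ /cvgrPdist_le/(_ _ e0) [m _ hm]].
pose n := (n0 + m)%N.
have hn : \int[lebst]_(z in QT) h n z <= e.
  have := hm n (leq_addl _ _); rewrite /= sub0r normrN.
  exact: le_trans (ler_norm _).
have [G uG] := uT _ (k0 n); have [mG iG] := L2H10_coor uG.
exists (k n); split => //; first by rewrite ler_nat -addn2 -addnA leq_addr.
exists G, (h n); split=> //.
have gp := gradient_power oOm Omoo uT12 gDu p0 (k1 n) uG vG'.
have [_ ggk] := gDu.
apply: (ae_impl2 _ gp); last exact: (ae_impl2 (fun z a b => conj a b) (ggk _ _ (k0 n) uG) (ggk _ _ (ltr0n R 2) uG2)).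
move=> z gpz [gz g2z] Qz.
have [uk|ku] := ltP `|u z| (k n); last first.
  by rewrite derive2_strunc_out// normr0 mul0r.
have S2 : `|derive1 (derive1 (strunc (k n))) (u z)| <= (k n)^-1 * C.
  by rewrite derive2_strunc// normrM gtr0_norm ?invr_gt0// ler_wpM2l// invr_ge0 ltW.
apply: (le_trans (ler_wpM2r (dotxx_ge0 _) S2)).
rewrite /h [_ * C]mulrC -mulrA ler_pM2l//.
have [u1|u1] := leP `|u z| 1.
  have -> : G z = G2 z.
    by rewrite gz// g2z// uk (le_lt_trans u1)// ltr1n.
  rewrite lerDl mulr_ge0//; last by rewrite mulr_ge0 ?dotxx_ge0// invr_ge0 sqr_ge0.
  by rewrite le_min ler01 divr_ge0// ltW.
apply: (@le_trans _ _ (Num.min 1 (`|u z| / k n) * (p ^- 2 * dot (G' z) (G' z)))); last first.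
  by rewrite lerDr mulr_ge0 ?dotxx_ge0// invr_ge0 ltW// ltr0n.
have u1k : 1 < `|u z| < k n by rewrite u1.
have un0 : u z != 0 by rewrite -normr_gt0 (lt_trans ltr01).
have u0' : 0 < `|u z| := lt_trans ltr01 u1.
rewrite gpz// dotZr [dot (_ *: _) _](_ : _ = (p * (`|u z| `^ p / u z)) * dot (G z) (G z)); last first.
  by rewrite /dot mulr_sumr; apply: eq_bigr => i _; rewrite mxE -mulrA.
have min1 : Num.min 1 (`|u z| / k n) = `|u z| / k n.
  by apply/min_idPr; rewrite ler_pdivrMr// mul1r ltW.
rewrite min1 [leRHS](_ : _ = (k n)^-1 * (`|u z| * (`|u z| `^ p) ^+ 2 / (u z) ^+ 2 * dot (G z) (G z))); last first.
  by field; rewrite un0 gt_eqF//= gt_eqF.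
(* Once the common factors are removed the claim is |u| <= |u|^rho, true since |u| > 1 and rho >=
   1. *)
rewrite ler_wpM2l ?invr_ge0 ?(ltW (k0 n))// ler_peMl ?dotxx_ge0//.
rewrite -(real_normK (num_real (u z))) ler_pdivlMr ?exprn_gt0// mul1r.
rewrite expr2 ler_pM2l// expr2 -powRD; last by rewrite (gt_eqF u0') implybT.
rewrite -{1}(powRr1 (ltW u0')) ler_powR ?(ltW u1)//.
by rewrite /p -splitr.
Qed.

Lemma integr_gradient_power w (G : R * 'rV[R]_N -> 'rV[R]_N) :
  L2H10 Om T w G -> lebst.-integrable QT (EFin \o (fun z => enorm (G z) `^ q)).
Proof.
move=> /L2H10_coor[mG iG].
apply: (@le_integr_QT _ (fun z => 1 + dot (G z) (G z))).
- exact: (measurableT_comp (@measurable_powR R q) (measurable_enorm mG)).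
- by apply: integrD_QT => //; apply: (@bounded_integr_QT _ 1) => // z _; rewrite normr1.
- move=> z _; rewrite ger0_norm ?powR_ge0// -enorm_sqr powR_le_sqr ?enorm_ge0//.
  by rewrite q2 (le_trans ler01)// ltW.
Qed.

(** The equation puts the initial mass and the source gamma |G|^q on the same side, so both are
    bounded by the remaining terms. The cross term G . D chi is split by Young's inequality: since
    |D chi| <= B chi^(1/q), one half of the source absorbs |G|^q chi, and a constant carried by [A]
    is left. The term in S'' costs [e]. *)
Lemma energy_inequality (k e B C : R) (G : R * 'rV[R]_N -> 'rV[R]_N)
    (E : R * 'rV[R]_N -> R) (eta : R -> R) (chi : 'rV[R]_N -> R) (A : set 'rV[R]_N) :
  (forall a b, 0 <= a -> 0 <= b -> a * b <= gamma / 2 * a `^ q + C * b `^ (q / (q - 1))) ->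
  0 < k -> L2H10 Om T (fun z => truncation k (u z)) G ->
  lebst.-integrable QT (EFin \o E) -> (forall z, 0 <= E z) ->
  \int[lebst]_(z in QT) E z <= e ->
  {ae lebst, forall z, QT z ->
    `|derive1 (derive1 (strunc k)) (u z)| * dot (G z) (G z) <= E z} ->
  smooth eta -> (forall t, 0 <= eta t <= 1) -> eta T = 0 ->
  test_function Om chi -> (forall x, 0 <= chi x <= 1) -> 0 <= B -> 0 <= C ->
  (forall i x, `|dx i chi x| <= B * chi x `^ q^-1) ->
  measurable A -> (forall x, ~ A x -> chi x = 0) ->
  eta 0 * \int[leb]_(x in Om) (strunc k (u0 x) * chi x) +
  gamma / 2 * \int[lebst]_(z in QT)
     (enorm (G z) `^ q * derive1 (strunc k) (u z) * (eta z.1 * chi z.2)) <=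
  \int[lebst]_(z in QT) (- strunc k (u z) * (derive1 eta z.1 * chi z.2)) +
  C * (N%:R * B) `^ (q / (q - 1)) *
    \int[lebst]_(z in QT) (eta z.1 * \1_A z.2) + e.
Proof.
move=> young k0 uG iE E0 Ee aeE se e01 eT tc c01 B0 C0 dB mA cA.
have [sc _ _] := tc; have [[mu _] _ _] := usol.
have e1 t : `|eta t| <= 1 by have /andP[? ?] := e01 t; rewrite ger0_norm.
have q0 : 0 < q := lt_trans ltr01 q1.
have id := renormalized_truncated oOm Omoo T0 mu0 usol k0 uG se e1 eT tc.
have [mG iG] := L2H10_coor uG.
have iGq := integr_gradient_power uG.
have me : measurable_fun QT (fun z : R * 'rV[R]_N => eta z.1) := measurable_time se.
have me' : measurable_fun QT (fun z : R * 'rV[R]_N => derive1 eta z.1).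
  exact: measurable_time (smooth_derive1 se).
have mc : measurable_fun QT (fun z : R * 'rV[R]_N => chi z.2) := measurable_space sc.
have mdc i : measurable_fun QT (fun z : R * 'rV[R]_N => grad chi z.2 0 i).
  by under eq_fun do rewrite mxE; exact: measurable_space (smooth_dx i sc).
have sS := @smooth_strunc _ k.
have sS' := smooth_derive1 sS; have sS'' := smooth_derive1 sS'.
have mSu := measurable_comp_QT sS mu.
have mS'u := measurable_comp_QT sS' mu.
have mS''u := measurable_comp_QT sS'' mu.
have mec : measurable_fun QT (fun z : R * 'rV[R]_N => eta z.1 * chi z.2) by exact: measurable_funM.
have ec01 z : 0 <= eta z.1 * chi z.2 <= 1.
  have /andP[? ?] := e01 z.1; have /andP[? ?] := c01 z.2.
  by rewrite mulr_ge0//= -[1]mulr1 ler_pM.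
have S'01 z := derive1_strunc_itv k0 (u z).
pose Y z := enorm (G z) `^ q * derive1 (strunc k) (u z) * (eta z.1 * chi z.2).
have mY : measurable_fun QT Y.
  apply: measurable_funM => //; apply: measurable_funM => //.
  exact: (measurableT_comp (@measurable_powR R q) (measurable_enorm mG)).
have Y0 z : 0 <= Y z.
  have /andP[? _] := S'01 z; have /andP[? _] := ec01 z.
  by apply: mulr_ge0 => //; apply: mulr_ge0 => //; exact: powR_ge0.
have iY : integQT Y.
  apply: (le_integr_QT mY iGq) => z _; rewrite ger0_norm// /Y -mulrA ler_piMr ?powR_ge0//.
  have /andP[? ?] := S'01 z; have /andP[? ?] := ec01 z.
  by rewrite -[1]mulr1 ler_pM.
pose X1 z := - strunc k (u z) * (derive1 eta z.1 * chi z.2).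
have mX1 : measurable_fun QT X1.
  by apply: measurable_funM; [exact: measurable_funN|exact: measurable_funM].
have [D D0 eD] : exists2 D, 0 <= D & forall t, `|t| <= T -> `|derive1 eta t| <= D.
  have /compact_bounded[D [_ Db]] : compact (derive1 eta @` `[- T, T]).
    apply: continuous_compact; last exact: segment_compact.
    exact/continuous_subspaceT/smooth_continuous/smooth_derive1.
  exists (Num.max D 0 + 1); first by rewrite addr_ge0// le_max lexx orbT.
  move=> t tT; apply: Db.
    by rewrite (@le_lt_trans _ _ (Num.max D 0)) ?le_max ?lexx// ltrDl.
  by exists t => //=; rewrite in_itv /= -ler_norml.
have iX1 : integQT X1.
  apply: (@bounded_integr_QT _ (k * D)) => // -[t x] [/= tT _].
  rewrite /X1 normrM normrN; apply: ler_pM => //=; first exact: strunc_bounded.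
  have /andP[? ?] := c01 x; rewrite normrM -[D]mulr1 ler_pM//; last by rewrite ger0_norm.
  rewrite eD//; move: tT; rewrite in_itv /= => /andP[t0 tT].
  by rewrite ger0_norm ltW.
pose X2 z := derive1 (strunc k) (u z) * eta z.1 * dot (G z) (grad chi z.2).
pose X3 z := derive1 (derive1 (strunc k)) (u z) * (eta z.1 * chi z.2) * dot (G z) (G z).
pose A1 (z : R * 'rV[R]_N) := eta z.1 * \1_A z.2.
have mA1 : measurable_fun QT A1.
  have m1 : measurable_fun setT (\1_A : 'rV[R]_N -> R) by exact: measurable_indic.
  apply: measurable_funM => //; apply: measurable_funTS.
  exact: (measurableT_comp m1 measurable_snd).
have A10 z : 0 <= A1 z <= 1.
  have /andP[? ?] := e01 z.1; rewrite /A1 indicE.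
  by case: (_ \in _); rewrite ?mulr1 ?mulr0 ?lexx ?ler01//; exact/andP.
have iA1 : integQT A1.
  by apply: (@bounded_integr_QT _ 1) => // z _; have /andP[? ?] := A10 z; rewrite ger0_norm.
have X3E : {ae lebst, forall z, QT z -> `|X3 z| <= E z}.
  apply: (ae_impl _ aeE) => z aez Qz; apply: le_trans (aez Qz).
  have /andP[ec0 ec1] := ec01 z.
  rewrite /X3 !normrM (ger0_norm (dotxx_ge0 _)) -normrM (ger0_norm ec0).
  by rewrite ler_wpM2r ?dotxx_ge0// ler_piMr.
have X2Y z : `|X2 z| <= gamma / 2 * Y z + C * (N%:R * B) `^ (q / (q - 1)) * A1 z.
  have /andP[S0 S1] := S'01 z; have /andP[et0 et1] := e01 z.1.
  have /andP[ch0 ch1] := c01 z.2.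
  have se0 : 0 <= derive1 (strunc k) (u z) * eta z.1 by rewrite mulr_ge0.
  rewrite /X2 normrM ger0_norm//.
  (* Off [A] one has chi = 0, and the bound on the derivatives reads B times 0 to the nonzero power
     1/q, which is 0. *)
  have [Az|nAz] := pselect (A z.2); last first.
    have d0 i : `|grad chi z.2 0 i| <= 0.
      by rewrite mxE (le_trans (dB i z.2))// cA// powR0 ?mulr0// invr_eq0 gt_eqF.
    have := dot_le (G z) d0; rewrite !mulr0 normr_le0 => /eqP ->.
    rewrite normr0 mulr0; have /andP[a0 _] := A10 z.
    apply: addr_ge0; apply: mulr_ge0 => //; first by rewrite divr_ge0// ltW.
    by rewrite mulr_ge0// powR_ge0.
  have d1 i : `|grad chi z.2 0 i| <= B * chi z.2 `^ q^-1 by rewrite mxE.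
  have := dot_le (G z) d1.
  rewrite (_ : N%:R * _ = (enorm (G z) * chi z.2 `^ q^-1) * (N%:R * B)); last by ring.
  move=> /le_trans/(_ (young _ _ _ _)) dd.
  have := ler_wpM2l se0 (dd (mulr_ge0 (enorm_ge0 _) (powR_ge0 _ _)) (mulr_ge0 (ler0n _ _) B0)).
  move=> /le_trans; apply.
  rewrite powRM ?enorm_ge0 ?powR_ge0// -powRrM mulVf ?gt_eqF// powRr1//.
  rewrite /A1 indicE mem_set// mulr1 mulrDr lerD//.
    by rewrite le_eqVlt; apply/orP; left; apply/eqP; rewrite /Y; ring.
  rewrite mulrC ler_wpM2l//; first by rewrite mulr_ge0 ?powR_ge0.
  by rewrite ler_piMl.
have iE' : integQT (fun z => X1 z + (gamma / 2 * Y z + C * (N%:R * B) `^ (q / (q - 1)) * A1 z) + E z).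
  apply: integrD_QT => //; apply: integrD_QT => //.
  by apply: integrD_QT; exact: integrZl_QT.
have mX2 : measurable_fun QT X2.
  by apply: measurable_funM; [exact: measurable_funM|exact: measurable_dot].
have mX3 : measurable_fun QT X3.
  by apply: measurable_funM; [exact: measurable_funM|exact: measurable_dot].
have iX2 : integQT X2.
  apply: (le_integr_QT mX2 _ (fun z _ => X2Y z)).
  by apply: integrD_QT; exact: integrZl_QT.
have iX3 : integQT X3 by exact: (@ae_le_integr _ _ _ lebst QT mQT X3 E mX3 iE X3E).
have iX : integQT (fun z => X1 z + (X2 z + X3 z)).
  by apply: integrD_QT => //; exact: integrD_QT.
have le1 : \int[lebst]_(z in QT) (X1 z + (X2 z + X3 z)) <=
    \int[lebst]_(z in QT) (X1 z + (gamma / 2 * Y z + C * (N%:R * B) `^ (q / (q - 1)) * A1 z) + E z).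
  apply: (@ae_le_Rintegral _ _ _ lebst QT mQT) => //.
  apply: (ae_impl _ X3E) => z x3 Qz; rewrite addrA lerD//; last first.
    exact: le_trans (ler_norm _) (x3 Qz).
  by rewrite lerD2l; exact: le_trans (ler_norm _) (X2Y z).
pose Z z := gamma / 2 * Y z + C * (N%:R * B) `^ (q / (q - 1)) * A1 z.
have iZ : integQT Z by apply: integrD_QT; exact: integrZl_QT.
have iXZ : integQT (fun z => X1 z + Z z) by exact: integrD_QT.
move: le1; rewrite (@RintegralD _ _ _ lebst QT (fun z => X1 z + Z z) E mQT iXZ iE).
rewrite (@RintegralD _ _ _ lebst QT X1 Z mQT iX1 iZ).
rewrite (@RintegralD _ _ _ lebst QT (fun z => gamma / 2 * Y z)
  (fun z => C * (N%:R * B) `^ (q / (q - 1)) * A1 z) mQT); [|exact: integrZl_QT|exact: integrZl_QT].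
rewrite (@RintegralZl _ _ _ lebst QT Y _ mQT iY) (@RintegralZl _ _ _ lebst QT A1 _ mQT iA1).
move: id; rewrite -/X1 -/X2 -/X3 -/Y => id le1.
have gY : gamma * \int[lebst]_(z in QT) Y z =
    gamma / 2 * \int[lebst]_(z in QT) Y z + gamma / 2 * \int[lebst]_(z in QT) Y z.
  by rewrite -mulrDl -splitr.
move: id; rewrite gY; move: le1 Ee; rewrite /X1 /X2 /X3 /Y /A1.
lra.
Qed.

End energy.

(** * Test functions at a given scale *)

Section tensor_products.
Context (R : realType) (N : nat).
Implicit Types (x : 'rV[R]_N) (g : 'I_N -> R -> R).

Definition tensor g x : R := \prod_i g i (x 0 i).

Lemma smooth_coor (i : 'I_N) : smooth (fun x : 'rV[R]_N => x 0 i).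
Proof.
apply: (@smooth_ind _ _ (fun f => f = (fun x => x 0 i) \/ exists c, f = cst c)); last by left.
move=> f [->|[c ->]]; split=> [x|v].
- exact: differentiable_coord.
- right; exists (v 0 i); apply/funext => x.
  rewrite /derive; apply/cvg_lim => //; apply: cvg_near_cst.
  near=> h; have h0 : h != 0 by near: h; exact: nbhs_dnbhs_neq.
  by rewrite /= !mxE addrK /GRing.scale /= mulKf.
- exact: differentiable_cst.
- by right; exists 0; apply/funext => x; rewrite derive_cst.
Unshelve. all: by end_near. Qed.

Lemma smooth_tensor g : (forall i, smooth (g i)) -> smooth (tensor g).
Proof.
move=> sg; apply: (@smooth_prod _ _ _ _ (fun i x => g i (x 0 i))) => i.
apply: (@smooth_comp _ _ (g i) (fun x => x 0 i)) => //; exact: smooth_coor.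
Qed.

Lemma dx_tensor g i x : (forall i, smooth (g i)) ->
  dx i (tensor g) x = derive1 (g i) (x 0 i) * \prod_(j | j != i) g j (x 0 j).
Proof.
move=> sg; rewrite mulrC /dx.
set c := \prod_(j | _) _.
have qE : (fun h => h^-1 *: ((tensor g \o shift x) (h *: delta_mx 0 i) - tensor g x)) =
    (fun h => c * (h^-1 *: ((g i \o shift (x 0 i)) (h *: (1 : R)) - g i (x 0 i)))).
  apply/funext => h /=; rewrite /tensor (bigD1 i)//= [X in _ - X](bigD1 i)//=.
  rewrite -/c (_ : \prod_(j | j != i) _ = c); last first.
    by apply: eq_bigr => j ji; rewrite !mxE (negPf ji) andbF mulr0 add0r.
  by rewrite !mxE !eqxx /GRing.scale /=; ring.
rewrite [LHS]/derive qE; apply/cvg_lim => //; apply: cvgM; first exact: cvg_cst.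
have dg : derivable (g i) (x 0 i) 1 by exact: smooth_derivable.
rewrite derive1E; exact: dg.
Qed.

Lemma tensor_out g (l : R) x : (forall i (s : R), l <= `|s| -> g i s = 0) ->
  ~ box (- l) l x -> tensor g x = 0.
Proof.
move=> g0 nb; have [i xi] : exists i, l <= `|x 0 i|.
  apply: contrapT => ne; apply: nb => i; rewrite -ler_norml leNgt; apply/negP => lx.
  by apply: ne; exists i; exact: ltW.
by rewrite /tensor (bigD1 i)//= g0// mul0r.
Qed.

Lemma test_tensor g (l : R) (Om : set 'rV[R]_N) : (forall i, smooth (g i)) ->
  (forall i (s : R), l <= `|s| -> g i s = 0) -> box (- l) l `<=` Om ->
  test_function Om (tensor g).
Proof.
move=> sg g0 lO.
have cb : closed (@box R N (- l) l).
  by apply: compact_closed; [exact: norm_hausdorff|exact: box_compact].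
have sub : supp (tensor g) `<=` box (- l) l.
  rewrite /supp [X in _ `<=` X](closure_id _).1//; apply: closureS => x /= /eqP gx.
  by apply: contrapT => nb; apply: gx; exact: tensor_out g0 nb.
split; first exact: smooth_tensor.
  by apply: (subclosed_compact _ _ sub); [exact: closed_closure|exact: box_compact].
exact: subset_trans sub lO.
Qed.

Lemma tensor_le g (c : R) (P : pred 'I_N) x : (forall i, P i -> `|g i (x 0 i)| <= c) ->
  `|\prod_(i | P i) g i (x 0 i)| <= c ^+ #|P|.
Proof.
move=> gc; rewrite normr_prod -prodr_const; apply: ler_prod => i Pi.
by rewrite normr_ge0 gc.
Qed.

End tensor_products.

Section bumps.
Context (R : realType) (N : nat).
Implicit Types (x : 'rV[R]_N) (l r s : R).

Definition bumpN l x : R := tensor (fun=> fun s => cutoff (l^-1 * s)) x.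

Lemma smooth_scale (f : R -> R) l : smooth f -> smooth (fun s => f (l * s)).
Proof.
move=> sf; apply: (@smooth_comp _ _ f (fun s => l * s)) => //.
by apply: (@smoothM _ _ (cst l) id); [exact: smooth_cst|exact: smooth_id].
Qed.

Lemma derive1_scale (f : R -> R) l s : smooth f ->
  derive1 (fun s => f (l * s)) s = l * derive1 f (l * s).
Proof.
move=> sf; have sl : smooth (fun s => l * s) by exact: (smooth_scale l (@smooth_id R)).
rewrite derive1E (@derive_comp1 _ _ f (fun s => l * s)); try exact: smooth_differentiable.
by rewrite -!derive1E derive1Ml// derive1_id mulr1 mulrC.
Qed.

Lemma scale_out l s : 0 < l -> l <= `|s| -> 1 <= `|l^-1 * s|.
Proof. by move=> l0 ls; rewrite normrM normfV (gtr0_norm l0) mulrC ler_pdivlMr// mul1r. Qed.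

Lemma bumpN_itv l x : 0 <= bumpN l x <= 1.
Proof.
apply/andP; split; first by apply: prodr_ge0 => i _; exact: cutoff_ge0.
by apply: prodr_ile1 => i _; rewrite cutoff_ge0 cutoff_le1.
Qed.

Lemma test_bumpN l Om : 0 < l -> box (- l) l `<=` Om -> test_function Om (bumpN l).
Proof.
move=> l0; apply: test_tensor => i; first exact/smooth_scale/smooth_cutoff.
by move=> s ls; rewrite cutoff_out// scale_out.
Qed.

Lemma bumpN_out l x : 0 < l -> ~ box (- l) l x -> bumpN l x = 0.
Proof.
move=> l0; apply: tensor_out => i s ls; by rewrite cutoff_out// scale_out.
Qed.

Lemma bumpN_ge l x : 0 < l -> box (- (l / 2)) (l / 2) x -> cutoff 2^-1 ^+ N <= bumpN l x.
Proof.
move=> l0 xb; rewrite -[N in leLHS]card_ord -prodr_const; apply: ler_prod => i _.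
rewrite cutoff_ge0 cutoff_mono// normrM normfV (gtr0_norm l0) ler_pdivrMl//.
by rewrite [`|2^-1|]ger0_norm ?invr_ge0// ler_norml; exact: xb.
Qed.

(** The differentiated factor is handled by [dcutoff_le]. The product [P] of the others lies in
    [0, 1], so [P] is at most its power 1/q. The constant is independent of the scale, only 1/l
    remains. *)
Lemma dx_bumpN_le (q : R) : 1 < q -> exists2 C, 0 < C &
  forall l, 0 < l -> forall i x, `|dx i (bumpN l) x| <= C / l * bumpN l x `^ q^-1.
Proof.
move=> q1; have q0 : 0 < q by rewrite (lt_trans ltr01).
have [C C0 dC] := dcutoff_le q1; exists C => // l l0 i x.
rewrite dx_tensor => [|j]; last exact/smooth_scale/smooth_cutoff.
rewrite derive1_scale; last exact: smooth_cutoff.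
rewrite derive1_cutoff -[X in `|X|]mulrA normrM (normrM (dcutoff _)) normfV (gtr0_norm l0).
have cg0 j : 0 <= cutoff (l^-1 * x 0 j) by exact: cutoff_ge0.
rewrite /bumpN /tensor [in leRHS](bigD1 i)//= powRM ?prodr_ge0//.
rewrite [C / l]mulrC -[leRHS]mulrA ler_wpM2l ?invr_ge0 ?(ltW l0)// mulrA.
apply: ler_pM => //; rewrite ger0_norm ?prodr_ge0//.
set P := \prod_(j | _) _.
have P0 : 0 <= P by apply: prodr_ge0.
have P1 : P <= 1 by apply: prodr_ile1 => j _; rewrite cg0 cutoff_le1.
have [->|Pn0] := eqVneq P 0; first by rewrite powR_ge0.
rewrite ger1_powR//; last by rewrite invf_le1// ltW.
by rewrite lt_neqAle eq_sym Pn0 P0.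
Qed.

(** Its integral is the same for all [l], hence the difference of two of them has a compactly
    supported primitive. *)
Definition mollifier l s : R := l^-1 * cutoff (l^-1 * s).

Lemma tensor_mollifier l x : tensor (fun=> mollifier l) x = (l^-1) ^+ N * bumpN l x.
Proof. by rewrite /tensor big_split /= prodr_const card_ord. Qed.

(** Passing from scale [l] to scale [r] one coordinate at a time: at step [j] the earlier
    coordinates are already at scale [r], the later ones still at [l], and coordinate [j] carries
    the primitive of the difference of the two mollifiers. *)
Definition step_field (r l : R) (j : 'I_N) : 'I_N -> R -> R := fun i =>
  if i == j then fun s => pcutoff (r^-1 * s) - pcutoff (l^-1 * s)
  else if (i < j)%N then mollifier r else mollifier l.

Lemma smooth_mollifier l : smooth (mollifier l).
Proof.
apply: (@smoothM _ _ (cst l^-1) (fun s => cutoff (l^-1 * s))); first exact: smooth_cst.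
exact/smooth_scale/smooth_cutoff.
Qed.

Lemma smooth_pdiff r l : smooth (fun s => pcutoff (r^-1 * s) - pcutoff (l^-1 * s)).
Proof.
apply: (@smoothD _ _ (fun s => pcutoff (r^-1 * s)) (fun s => - pcutoff (l^-1 * s))).
  exact/smooth_scale/smooth_pcutoff.
rewrite (_ : (fun s => _) = (cst (-1) : R -> R) * (fun s => pcutoff (l^-1 * s))).
  apply: smoothM; first exact: smooth_cst.
  exact/smooth_scale/smooth_pcutoff.
by apply/funext => s; rewrite /GRing.mul /= mulN1r.
Qed.

Lemma smooth_step_field r l j i : smooth (step_field r l j i).
Proof.
rewrite /step_field; case: ifP => _; first exact: smooth_pdiff.
by case: ifP => _; exact: smooth_mollifier.
Qed.

Lemma step_field_out r l j i s : 0 < r -> r <= l -> l <= `|s| -> step_field r l j i s = 0.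
Proof.
move=> r0 rl ls; have l0 := lt_le_trans r0 rl; have rs := le_trans rl ls.
rewrite /step_field; case: ifP => _.
  have [s0|s0] := leP 0 s.
    have hs (m : R) : 0 < m -> m <= `|s| -> 1 <= m^-1 * s.
      by move=> m0 /(scale_out m0); rewrite ger0_norm// mulr_ge0// invr_ge0 ltW.
    by rewrite !(pcutoff_ge1 (hs _ _ _))// subrr.
  have hs (m : R) : 0 < m -> m <= `|s| -> m^-1 * s <= -1.
    move=> m0 /(scale_out m0); rewrite ler0_norm; first by rewrite lerNr.
    by rewrite pmulr_rle0 ?invr_gt0// ltW.
  by rewrite !(pcutoff_leN1 (hs _ _ _))// subrr.
by case: ifP => _; rewrite /mollifier cutoff_out ?mulr0// scale_out.
Qed.

Lemma derive1_pdiff r l s :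
  derive1 (fun s => pcutoff (r^-1 * s) - pcutoff (l^-1 * s)) s = mollifier r s - mollifier l s.
Proof.
have sr : smooth (fun s : R => pcutoff (r^-1 * s)) by exact/smooth_scale/smooth_pcutoff.
have sl : smooth (fun s : R => pcutoff (l^-1 * s)) by exact/smooth_scale/smooth_pcutoff.
rewrite derive1E deriveB; try exact: smooth_derivable.
by rewrite -!derive1E !derive1_scale ?derive1_pcutoff//; exact: smooth_pcutoff.
Qed.

(* The vector field with components [tensor (step_field r l j)] interpolates
   between the averages at scales [l] and [r]; its divergence telescopes. *)
Lemma divergence_step_field r l x :
  tensor (fun=> mollifier r) x - tensor (fun=> mollifier l) x =
  \sum_j dx j (tensor (step_field r l j)) x.
Proof.
pose P (k : nat) := \prod_(i < N) (if (i < k)%N then mollifier r (x 0 i) else mollifier l (x 0 i)).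
have PN : tensor (fun=> mollifier r) x = P N.
  by apply: eq_bigr => i _; rewrite ltn_ord.
have P0 : tensor (fun=> mollifier l) x = P 0%N by apply: eq_bigr.
rewrite PN P0 -(telescope_sumr _ (leq0n N)) big_mkord; apply: eq_bigr => j _.
rewrite dx_tensor; last by move=> i; exact: smooth_step_field.
rewrite /P (bigD1 j)//= ltnSn [X in _ - X](bigD1 j)//= ltnn.
set A := \prod_(i | _) _; set B := \prod_(i | _) _.
have -> : A = \prod_(i | i != j) step_field r l j i (x 0 i).
  apply: eq_bigr => i ij; rewrite /step_field (negPf ij) ltnS leq_eqVlt.
  by rewrite -[(i == j :> nat)]/(i == j) (negPf ij) /=; case: ifP.
have -> : B = \prod_(i | i != j) step_field r l j i (x 0 i).
  by apply: eq_bigr => i ij; rewrite /step_field (negPf ij); case: ifP.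
rewrite -mulrBl; congr (_ * _).
by rewrite /step_field eqxx derive1_pdiff.
Qed.

(** The primitive is at most 2, and each of the N - 1 mollifiers at most 1/r since both scales are
    at least [r]. The bound 2 r^(1-N) is written without a truncated subtraction on [N]. *)
Lemma step_field_le r l j x : 0 < r -> r <= l ->
  `|tensor (step_field r l j) x| <= 2 * r * (r^-1) ^+ N.
Proof.
move=> r0 rl; have l0 := lt_le_trans r0 rl.
have mle m s : 0 < m -> r <= m -> `|mollifier m s| <= r^-1.
  move=> m0 rm; have c0 := cutoff_ge0 (m^-1 * s).
  rewrite /mollifier ger0_norm; last by rewrite mulr_ge0// invr_ge0 ltW.
  apply: (@le_trans _ _ m^-1); last by rewrite lef_pV2.
  by rewrite ler_piMr ?cutoff_le1// invr_ge0 ltW.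
rewrite /tensor (bigD1 j)//= normrM.
have rN : r * (r^-1) ^+ N = (r^-1) ^+ #|[pred i | i != j]|.
  have cN : #|[pred i | i != j]|.+1 = N.
    by rewrite (cardC1 j) card_ord prednK// (leq_ltn_trans _ (ltn_ord j)).
  have -> : (r^-1) ^+ N = (r^-1) ^+ (#|[pred i | i != j]|.+1) by rewrite cN.
  by rewrite exprS mulrA divff ?mul1r// gt_eqF.
rewrite -mulrA rN ler_pM//.
  rewrite /step_field eqxx (le_trans (ler_normB _ _))//.
  by rewrite (@le_trans _ _ (1 + 1)) ?lerD ?pcutoff_bounded// -natr1 .
apply: (tensor_le (P := [pred i | i != j])) => i ij.
by rewrite /step_field (negPf ij); case: ifP => _; exact: mle.
Qed.

End bumps.

(** * Integrals over small cylinders *)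

(** Above the threshold [lam] one has 1 <= (x / lam)^(p-1). It serves both the L^1 bound of [u] by
    its L^rho norm and that of the gradient by |G|^q. *)
Lemma le_powR_split (R : realType) (p lam x : R) : 1 <= p -> 0 < lam -> 0 <= x ->
  x <= lam + lam `^ (1 - p) * x `^ p.
Proof.
move=> p1 l0 x0; have [xl|lx] := leP x lam.
  by rewrite (le_trans xl)// lerDl mulr_ge0// powR_ge0.
have xp : 0 < x := lt_trans l0 lx.
apply: (@le_trans _ _ (lam `^ (1 - p) * x `^ p)); last by rewrite lerDr ltW.
rewrite -{1}(powRr1 x0) (_ : 1 = (1 - p) + p :> R); last by rewrite subrK.
rewrite powRD ?(gt_eqF xp) ?implybT// addrK ler_wpM2r ?powR_ge0//.
have -> : 1 - p = - (p - 1) by rewrite opprB.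
rewrite (powRN lam) (powRN x) lef_pV2 ?posrE ?powR_gt0//.
by rewrite ge0_ler_powR ?nnegrE ?subr_ge0 ?(ltW l0) ?(ltW xp) ?(ltW lx).
Qed.

Section cylinders.
Context (R : realType) (N : nat) (Om : set 'rV[R]_N) (T : R).
Hypothesis oOm : open Om.
Hypothesis Omoo : (lebesgue_rV R N Om < +oo)%E.
Hypothesis T0 : 0 < T.
Local Notation leb := (lebesgue_rV R N).
Local Notation lebst := (@lebesgue_st R N).
Local Notation QT := (Q_T Om T).

Let mOm : measurable Om. Proof. exact: open_measurable_rV. Qed.
Let mQT : measurable QT. Proof. exact: measurable_QT. Qed.
Let QToo : (lebst QT < +oo)%E. Proof. exact: lebesgue_QT_lty. Qed.

Lemma measurable_slice_integral (f : R * 'rV[R]_N -> R) :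
  measurable_fun QT f -> (forall z, QT z -> 0 <= f z) ->
  measurable_fun `]0%R, T[%classic (fun t => \int[leb]_(x in Om) (f (t, x))%:E)%E.
Proof.
move=> mf f0; rewrite measurable_restrictT; last exact: measurable_itv.
rewrite (_ : _ \_ _ = fubini_F leb ((EFin \o f) \_ QT)).
  apply: measurable_fun_fubini_tonelli_F => [|z].
    rewrite -measurable_restrictT; last exact: mQT.
    exact/measurable_EFinP.
  rewrite patchE; case: ifPn => // /set_mem Qz.
  by rewrite lee_fin f0.
apply/funext => t; rewrite /fubini_F patchE; case: ifPn => [/set_mem tT|/negP tT].
  rewrite [LHS]integral_mkcond; congr (integral _ _ _); apply/funext => x.
  rewrite !patchE; congr (if _ then _ else _).
  by apply/idP/idP => /set_mem; [move=> xO; apply/mem_set|case=> /= _ /mem_set].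
apply/esym; apply: integral0_eq => x _; rewrite patchE ifF//; apply/negbTE/negP => /set_mem[/= tT' _].
by apply: tT; exact/mem_set.
Qed.

Definition cyl (tau l : R) (z : R * 'rV[R]_N) : R :=
  \1_(`[0, tau]%classic) z.1 * \1_(box (- l) l) z.2.

Lemma cyl_itv tau l z : 0 <= cyl tau l z <= 1.
Proof.
rewrite /cyl !indicE; case: (_ \in _); case: (_ \in _) => /=;
  by rewrite ?mulr1 ?mulr0 ?lexx ?ler01.
Qed.

Lemma measurable_cyl tau l : measurable_fun QT (cyl tau l).
Proof.
have m1 : measurable_fun setT (\1_(`[0, tau]%classic) : R -> R).
  by apply: measurable_indic; exact: measurable_itv.
have m2 : measurable_fun setT (\1_(box (- l) l) : 'rV[R]_N -> R).
  by apply: measurable_indic; exact: measurable_box.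
apply: measurable_funTS; apply: measurable_funM.
  exact: (measurableT_comp m1 measurable_fst).
exact: (measurableT_comp m2 measurable_snd).
Qed.

Lemma cylinder_integral_le (f : R * 'rV[R]_N -> R) (tau l K : R) :
  0 < tau -> 0 <= K -> lebst.-integrable QT (EFin \o f) -> (forall z, 0 <= f z) ->
  {ae @lebesgue_measure R, forall t, t \in `]0, T[ ->
    (\int[leb]_(x in Om) (f (t, x) * \1_(box (- l) l) x)%:E <= K%:E)%E} ->
  \int[lebst]_(z in QT) (f z * cyl tau l z) <= tau * K.
Proof.
move=> tau0 K0 fi f0 fK; have mf := integr_measurable fi.
have mc := measurable_cyl tau l.
have fc0 z : 0 <= f z * cyl tau l z by rewrite mulr_ge0//; have /andP[] := cyl_itv tau l z.
have mfc : measurable_fun QT (fun z => f z * cyl tau l z) by exact: measurable_funM.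
have ifc : lebst.-integrable QT (EFin \o (fun z => f z * cyl tau l z)).
  apply: (@le_integr _ _ _ lebst QT mQT _ f mfc fi) => z _.
  by rewrite ger0_norm// ler_piMr//; have /andP[] := cyl_itv tau l z.
rewrite -lee_fin fineK; last exact: (@integrable_fin_num _ _ _ lebst QT mQT (EFin \o (fun z => f z * cyl tau l z)) ifc).
rewrite tonelli_QT//.
have mI : measurable (`[0, tau]%classic : set R) by exact: measurable_itv.
apply: (@le_trans _ _ (\int[@lebesgue_measure R]_(t in `]0%R, T[%classic) (K * \1_(`[0, tau]%classic) t)%:E)%E).
  apply: ae_ge0_le_integral => //.
  - by move=> t _; apply: integral_ge0 => x _; rewrite lee_fin.
  - by apply: (@measurable_slice_integral (fun z => f z * cyl tau l z)) => // z _; exact: fc0.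
  - by move=> t _; rewrite lee_fin mulr_ge0.
  - by apply/measurable_EFinP; apply: measurable_funM => //; exact: measurable_indic.
  - apply: (ae_impl _ fK) => t fKt tT; rewrite indicE.
    have [tt|tt] := boolP (t \in _); last first.
      rewrite mulr0 integral0_eq// => x _.
      by rewrite /cyl /= indicE (negPf tt) mul0r mulr0.
    rewrite mulr1; apply: le_trans (fKt tT).
    by under eq_integral do rewrite /cyl /= indicE tt mul1r.
under eq_integral do rewrite EFinM.
rewrite ge0_integralZl_EFin//; last first.
  by apply/measurable_EFinP; exact: measurable_indic.
rewrite integral_indic// mulrC EFinM; apply: lee_wpmul2l => //.
apply: (@le_trans _ _ (@lebesgue_measure R `[0, tau]%classic)).
  by apply: le_measure; rewrite ?inE//; exact: measurableI.
by rewrite lebesgue_measure_itv /= lte_fin tau0 sube0.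
Qed.

Lemma lebesgue_box_sym (l : R) : 0 <= l -> leb (box (- l) l) = ((2 * l) ^+ N)%:E.
Proof.
move=> l0; rewrite lebesgue_box; last by rewrite (le_trans _ l0)// oppr_le0.
by rewrite opprK mulr_natl mulr2n.
Qed.

Lemma integral_box_le (l K : R) : 0 <= l -> 0 <= K ->
  (\int[leb]_(x in Om) (K * \1_(box (- l) l) x)%:E <= (K * (2 * l) ^+ N)%:E)%E.
Proof.
move=> l0 K0; have mb := @measurable_box R N (- l) l.
under eq_integral do rewrite EFinM.
rewrite ge0_integralZl_EFin//; last first.
  by apply/measurable_EFinP; exact: measurable_indic.
rewrite integral_indic// EFinM; apply: lee_wpmul2l => //.
rewrite -lebesgue_box_sym//.
by apply: le_measure; rewrite ?inE//; exact: measurableI.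
Qed.

Lemma cyl_measure_le (tau l : R) : 0 < tau -> 0 <= l ->
  \int[lebst]_(z in QT) cyl tau l z <= tau * (2 * l) ^+ N.
Proof.
move=> tau0 l0.
rewrite (@eq_Rintegral _ _ _ lebst QT (fun z => (fun=> 1) z * cyl tau l z)); last first.
  by move=> z _; rewrite mul1r.
apply: cylinder_integral_le => //.
- by rewrite exprn_ge0// mulr_ge0.
- exact: (@integr_cst _ _ _ lebst QT mQT QToo 1).
- apply: aeW => t _; apply: le_trans (integral_box_le l0 ler01) _.
  by rewrite mul1r.
Qed.

Lemma slice_L1_le (rho M l : R) (g : 'rV[R]_N -> R) : 1 <= rho -> 0 <= M -> 0 < l ->
  measurable_fun Om g -> (Lp_norm leb rho%:E Om g <= M%:E)%E ->
  (\int[leb]_(x in Om) (`|g x| * \1_(box (- l) l) x)%:E <=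
   ((2 ^+ N + M `^ rho) * l `^ (N%:R - N%:R / rho))%:E)%E.
Proof.
move=> rho1 M0 l0 mg gM; have rho0 : 0 < rho := lt_le_trans ltr01 rho1.
(* The threshold at which lam l^N and lam^(1-rho) are the same power l^(N - N/rho); the splitting
   then does the work of Hoelder's inequality. *)
pose lam := l `^ (- (N%:R / rho)); have lam0 : 0 < lam by rewrite powR_gt0.
have mb := @measurable_box R N (- l) l.
have gMr : (\int[leb]_(x in Om) (`|g x| `^ rho)%:E <= (M `^ rho)%:E)%E.
  have -> : (\int[leb]_(x in Om) (`|g x| `^ rho)%:E = Lp_norm leb rho%:E Om g `^ rho)%E.
    rewrite /Lp_norm poweR_Lnorm; last by rewrite gt_eqF.
    rewrite [LHS]integral_mkcond; apply: eq_integral => x _.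
    rewrite -[LHS]/((EFin \o (fun x => `|g x| `^ rho)) \_ Om x) restrict_EFin /= !patchE.
    by case: ifP => // _; rewrite normr0 powR0// gt_eqF.
  have N0 : (0 <= Lp_norm leb rho%:E Om g)%E by exact: Lnorm_ge0.
  move: gM N0; case: (Lp_norm _ _ _ _) => [s| |]//; rewrite !lee_fin => sM s0.
  by rewrite ge0_ler_powR ?nnegrE ?(ltW rho0).
have mgr : measurable_fun Om (fun x => `|g x| `^ rho).
  apply: (measurableT_comp (@measurable_powR R rho)); exact: measurableT_comp.
apply: (@le_trans _ _ (\int[leb]_(x in Om) ((lam * \1_(box (- l) l) x)%:E +
    (lam `^ (1 - rho))%:E * (`|g x| `^ rho)%:E))%E).
  apply: ge0_le_integral => //.
  - by apply/measurable_EFinP; apply: measurable_funM; [exact: measurableT_comp|exact: measurable_indic].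
  - apply: emeasurable_funD; first by apply/measurable_EFinP; apply: measurable_funM => //; exact: measurable_indic.
    by apply: measurable_funeM; exact/measurable_EFinP.
  - move=> x _; rewrite -EFinM -EFinD lee_fin indicE; case: (_ \in _).
      by rewrite !mulr1 le_powR_split.
    by rewrite !mulr0 add0r mulr_ge0 ?powR_ge0.
rewrite ge0_integralD//; last 4 first.
- by move=> x _; rewrite lee_fin mulr_ge0// ltW.
- by apply/measurable_EFinP; apply: measurable_funM => //; exact: measurable_indic.
- by move=> x _; rewrite -EFinM lee_fin mulr_ge0 ?powR_ge0.
- by apply: measurable_funeM; exact/measurable_EFinP.
rewrite ge0_integralZl_EFin ?powR_ge0//; last exact/measurable_EFinP.
apply: (@le_trans _ _ ((lam * (2 * l) ^+ N)%:E + (lam `^ (1 - rho))%:E * (M `^ rho)%:E)%E).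
  apply: leeD; first by apply: integral_box_le; rewrite ltW.
  by apply: lee_wpmul2l => //; rewrite lee_fin powR_ge0.
rewrite -EFinM -EFinD lee_fin le_eqVlt; apply/orP; left; apply/eqP.
have e1 : lam * l ^+ N = l `^ (N%:R - N%:R / rho).
  rewrite /lam -powR_mulrn ?(ltW l0)// -powRD; last by rewrite (gt_eqF l0) implybT.
  by rewrite addrC.
have e2 : lam `^ (1 - rho) = l `^ (N%:R - N%:R / rho).
  by rewrite /lam -powRrM; congr (_ `^ _); field; rewrite gt_eqF.
by rewrite e2 -e1 exprMn; ring.
Qed.

End cylinders.

(** * Oscillation of averages *)

Lemma strunc_truncation (R : realType) (k s : R) : 0 < k ->
  strunc k (truncation k s) = strunc k s.
Proof.
move=> k0; have [sk|ks] := leP `|s| k; first by rewrite truncation_id.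
rewrite /strunc; congr (_ * _); have k'0 : 0 < k^-1 by rewrite invr_gt0.
have kk : k^-1 * k = 1 by rewrite mulVf ?gt_eqF.
have [s0|s0] := leP 0 s.
  have sk : k <= s by rewrite ger0_norm// in ks; exact: ltW.
  have -> : truncation k s = k.
    rewrite /truncation (min_idPl sk) (max_idPr _)//.
    by rewrite (@le_trans _ _ 0) ?oppr_le0 ?ltW.
  by rewrite kk [RHS]pcutoff_ge1// -kk ler_pM2l.
have sk : s <= - k by rewrite ltr0_norm// in ks; rewrite lerNr ltW.
have -> : truncation k s = - k.
  rewrite /truncation (min_idPr _); last by rewrite (le_trans (ltW s0)) ?ltW.
  exact: (max_idPl sk).
by rewrite mulrN kk [RHS]pcutoff_leN1// -kk -mulrN ler_pM2l.
Qed.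

Lemma derive1_strunc_truncation (R : realType) (k s : R) : 0 < k ->
  derive1 (strunc k) (truncation k s) = derive1 (strunc k) s.
Proof.
move=> k0; have [sk|ks] := leP `|s| k; first by rewrite truncation_id.
by rewrite !derive1_strunc_out ?truncation_norm ?(ltW k0) ?(ltW ks).
Qed.

Section oscillation.
Context (R : realType) (N : nat) (Om : set 'rV[R]_N) (T : R).
Hypothesis oOm : open Om.
Hypothesis Omoo : (lebesgue_rV R N Om < +oo)%E.
Hypothesis T0 : 0 < T.
Local Notation leb := (lebesgue_rV R N).
Local Notation lebst := (@lebesgue_st R N).
Local Notation QT := (Q_T Om T).

Let mOm : measurable Om. Proof. exact: open_measurable_rV. Qed.
Let mQT : measurable QT. Proof. exact: measurable_QT. Qed.
Let QToo : (lebst QT < +oo)%E. Proof. exact: lebesgue_QT_lty. Qed.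
Local Notation integQT f := (lebst.-integrable QT (EFin \o (f : R * 'rV[R]_N -> R))).

Lemma H10_strunc (k : R) v (G : 'rV[R]_N -> 'rV[R]_N) : 0 < k ->
  H10 Om (fun x => truncation k (v x)) G ->
  H10 Om (fun x => strunc k (v x)) (fun x => derive1 (strunc k) (v x) *: G x).
Proof.
move=> k0 vG; have [C C0 dC] := @dcutoff_bounded R.
have d1 s : `|derive1 (strunc k) s| <= 1.
  by have /andP[? ?] := derive1_strunc_itv k0 s; rewrite ger0_norm.
have d2 s : `|derive1 (derive1 (strunc k)) s| <= k^-1 * C.
  by rewrite derive2_strunc// normrM gtr0_norm ?invr_gt0// ler_wpM2l// invr_ge0 ltW.
have H := H10_comp oOm Omoo (@smooth_strunc _ k) (strunc0 k) d1 d2 vG.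
have e0 : (fun x => strunc k (v x)) = (fun x => strunc k (truncation k (v x))).
  by apply/funext => x; rewrite strunc_truncation.
have e1 : (fun x => derive1 (strunc k) (v x) *: G x) =
    (fun x => derive1 (strunc k) (truncation k (v x)) *: G x).
  by apply/funext => x; rewrite derive1_strunc_truncation.
by rewrite e0 e1.
Qed.

(* Test with the field whose divergence is the difference of the two averages:
   the oscillation of the averages of [v] over scales is controlled by [G]. *)
Lemma oscillation_slice (c r l : R) v (G : 'rV[R]_N -> 'rV[R]_N) : 0 < r -> r <= l ->
  box (- l) l `<=` Om -> H10 Om v G ->
  \int[leb]_(x in Om) (c * (v x * ((r^-1) ^+ N * bumpN r x - (l^-1) ^+ N * bumpN l x) +
    \sum_j G x 0 j * tensor (step_field r l j) x)) = 0.
Proof.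
move=> r0 rl lO vG; have [vL GL] := H10_in_Lp vG; have [[_ _ wG] _] := vG.
pose F j := tensor (step_field (N := N) r l j).
have tF j : test_function Om (F j).
  apply: (test_tensor (l := l)) => // [i|i s]; first exact: smooth_step_field.
  exact: step_field_out.
have iG j : leb.-integrable Om (EFin \o (fun x => G x 0 j * F j x)).
  have [C C0 FC] := test_function_bounded (tF j).
  rewrite (_ : _ \o _ = EFin \o (fun x => F j x * G x 0 j)); last first.
    by apply/funext => x /=; rewrite mulrC.
  apply: (@integrM_bounded _ _ _ leb Om mOm _ _ C) => //.
    exact: test_measurable.
  exact: in_Lp2_integr.
have iv j : leb.-integrable Om (EFin \o (fun x => v x * dx j (F j) x)).
  have [C C0 FC] := test_function_bounded (test_function_dx j (tF j)).
  rewrite (_ : _ \o _ = EFin \o (fun x => dx j (F j) x * v x)); last first.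
    by apply/funext => x /=; rewrite mulrC.
  apply: (@integrM_bounded _ _ _ leb Om mOm _ _ C) => //.
    exact: (test_measurable (test_function_dx j (tF j))).
  exact: in_Lp2_integr.
rewrite (@eq_Rintegral _ _ _ leb Om
   (fun x => c * \sum_j (v x * dx j (F j) x + G x 0 j * F j x))); last first.
  by move=> x _; congr (c * _); rewrite -!tensor_mollifier divergence_step_field mulr_sumr -big_split.
rewrite RintegralZl//; last by apply: (@integr_sum _ _ _ leb Om mOm) => j; exact: integrD.
rewrite (@Rintegral_sum _ _ _ leb Om mOm); last by move=> j; exact: integrD.
rewrite big1 ?mulr0// => j _; rewrite RintegralD//.
by rewrite wG// addNr.
Qed.

(** The time weight is the derivative of [eta], as in the flux term of the energy inequality, so
    this compares the fluxes at scales [r] and [l]. It is [oscillation_slice] on almost every slice,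
    with the weight as the constant [c]. *)
Lemma oscillation_identity (k r l D : R) (eta : R -> R) u (G : R * 'rV[R]_N -> 'rV[R]_N) :
  0 < k -> 0 < r -> r <= l -> box (- l) l `<=` Om -> measurable_fun QT u ->
  smooth eta -> (forall t, `|derive1 eta t| <= D) ->
  L2H10 Om T (fun z => truncation k (u z)) G ->
  \int[lebst]_(z in QT) (derive1 eta z.1 *
    (strunc k (u z) * ((r^-1) ^+ N * bumpN r z.2 - (l^-1) ^+ N * bumpN l z.2) +
     \sum_j derive1 (strunc k) (u z) * G z 0 j * tensor (step_field r l j) z.2)) = 0.
Proof.
move=> k0 r0 rl lO mu se eD uG; have [_ GL vG] := uG.
have l0 : 0 < l := lt_le_trans r0 rl.
have mG j : measurable_fun QT (fun z => G z 0 j).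
  by move: (GL j) => /in_Lp2P-/(_ mQT)[].
have mSu := measurable_comp_QT (@smooth_strunc _ k) mu.
have mS'u := measurable_comp_QT (smooth_derive1 (@smooth_strunc _ k)) mu.
have me' := measurable_time (Om := Om) (T := T) (smooth_derive1 se).
have sb m : smooth (@bumpN R N m).
  by apply: smooth_tensor => i; exact/smooth_scale/smooth_cutoff.
have mb m : measurable_fun QT (fun z => @bumpN R N m z.2) := measurable_space (sb m).
have sF j : smooth (tensor (step_field (N := N) r l j)).
  by apply: smooth_tensor => i; exact: smooth_step_field.
have iGq j : integQT (fun z => derive1 (strunc k) (u z) * G z 0 j * tensor (step_field r l j) z.2).
  rewrite (_ : (fun z => _) = fun z => (derive1 (strunc k) (u z) * tensor (step_field r l j) z.2) * G z 0 j); last first.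
    by apply/funext => z; ring.
  apply: (@integrM_bounded _ _ _ lebst QT mQT _ _ (2 * r * (r^-1) ^+ N)) => //.
  - by apply: measurable_funM => //; exact: measurable_space.
  - exact: (@in_Lp2_integr _ _ _ lebst QT mQT QToo).
  - move=> z _; rewrite normrM; have /andP[a b] := derive1_strunc_itv k0 (u z).
    by rewrite (ger0_norm a) (le_trans _ (step_field_le j z.2 r0 rl))// ler_piMl.
have iS : integQT (fun z => strunc k (u z) * ((r^-1) ^+ N * bumpN r z.2 - (l^-1) ^+ N * bumpN l z.2)).
  apply: (@bounded_integr_QT _ _ _ _ oOm Omoo T0 _ (k * ((r^-1) ^+ N + (l^-1) ^+ N))) => [|z _].
    apply: measurable_funM => //; apply: measurable_funB; exact: measurable_funM.
  rewrite normrM ler_pM ?strunc_bounded// (le_trans (ler_normB _ _))//.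
  have nb m : 0 < m -> `|(m^-1) ^+ N * bumpN m z.2| <= (m^-1) ^+ N.
    move=> m0; have /andP[a b] := bumpN_itv m z.2.
    by rewrite ger0_norm ?mulr_ge0 ?exprn_ge0 ?invr_ge0 ?(ltW m0)// ler_piMr ?exprn_ge0 ?invr_ge0 ?(ltW m0).
  by rewrite lerD ?nb.
apply: (fubini_QT_eq0 oOm).
  apply: (@integrM_bounded _ _ _ lebst QT mQT _ _ D) => //.
  apply: (@integrD _ _ _ lebst QT mQT) => //.
  exact: (@integr_sum _ _ _ lebst QT mQT).
apply: (ae_impl _ vG) => t vGt tT.
have Ht := H10_strunc k0 (vGt tT).
rewrite -[RHS](oscillation_slice (derive1 eta t) r0 rl lO Ht) /=.
apply: eq_Rintegral => x _; congr (_ * (_ + _)); apply: eq_bigr => j _.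
by rewrite mxE.
Qed.

End oscillation.

(** * Estimates at two scales *)

Section time_cutoff.
Context (R : realType) (theta : R).
Hypothesis theta0 : 0 < theta.

Definition tcutoff (s : R) : R := cutoff (theta^-1 * s).

Lemma smooth_tcutoff : smooth tcutoff.
Proof. exact/smooth_scale/smooth_cutoff. Qed.

Lemma tcutoff_itv s : 0 <= tcutoff s <= 1.
Proof. by rewrite cutoff_ge0 cutoff_le1. Qed.

Lemma tcutoff_out s : theta <= s -> tcutoff s = 0.
Proof.
move=> ts; rewrite /tcutoff cutoff_out// scale_out//.
by rewrite (le_trans ts)// ler_norm.
Qed.

Lemma tcutoff0 : tcutoff 0 = 1.
Proof. by rewrite /tcutoff mulr0 cutoff0. Qed.

Lemma tcutoff_le s : 0 <= s -> tcutoff s <= \1_(`[0, theta]%classic) s.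
Proof.
move=> s0; rewrite indicE; have [_|] := boolP (s \in _); first by have /andP[] := tcutoff_itv s.
rewrite notin_setE /= in_itv /= s0 /= => /negP; rewrite -ltNge => /ltW ts.
by rewrite tcutoff_out.
Qed.

Lemma derive1_tcutoff_le (D : R) s : (forall y, `|dcutoff y| <= D) -> 0 <= s ->
  `|derive1 tcutoff s| <= D / theta * \1_(`[0, theta]%classic) s.
Proof.
move=> dD s0; rewrite derive1_scale; last exact: smooth_cutoff.
rewrite derive1_cutoff normrM gtr0_norm ?invr_gt0// [D / theta]mulrC -mulrA.
rewrite ler_pM2l ?invr_gt0// indicE.
have [_|] := boolP (s \in _); first by rewrite mulr1.
rewrite notin_setE /= in_itv /= s0 /= => /negP; rewrite -ltNge => /ltW ts.
by rewrite mulr0 dcutoff_out ?normr0// scale_out// ger0_norm.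
Qed.

Lemma derive1_tcutoff_bounded (D : R) s : (forall y, `|dcutoff y| <= D) ->
  `|derive1 tcutoff s| <= D / theta.
Proof.
move=> dD; rewrite derive1_scale; last exact: smooth_cutoff.
by rewrite derive1_cutoff normrM gtr0_norm ?invr_gt0// mulrC ler_pM2r ?invr_gt0.
Qed.

End time_cutoff.

Section estimates.
Context (R : realType) (N : nat) (Om : set 'rV[R]_N) (T : R).
Hypothesis oOm : open Om.
Hypothesis Omoo : (lebesgue_rV R N Om < +oo)%E.
Hypothesis T0 : 0 < T.
Local Notation leb := (lebesgue_rV R N).
Local Notation lebst := (@lebesgue_st R N).
Local Notation QT := (Q_T Om T).
Local Notation integQT f := (lebst.-integrable QT (EFin \o (f : R * 'rV[R]_N -> R))).

Let mOm : measurable Om. Proof. exact: open_measurable_rV. Qed.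
Let mQT : measurable QT. Proof. exact: measurable_QT. Qed.
Let QToo : (lebst QT < +oo)%E. Proof. exact: lebesgue_QT_lty. Qed.

Context (rho M : R) (u : R * 'rV[R]_N -> R).
Hypothesis rho1 : 1 <= rho.
Hypothesis M0 : 0 <= M.
Hypothesis mu : measurable_fun QT u.
Hypothesis uM : {ae @lebesgue_measure R, forall t, t \in `]0, T[ ->
    (Lp_norm leb rho%:E Om (fun x => u (t, x)) <= M%:E)%E}.

Let K : R := 2 ^+ N + M `^ rho.
Let B : R := N%:R / rho.

Lemma measurable_slice t : t \in `]0, T[ -> measurable_fun Om (fun x => u (t, x)).
Proof.
move=> tT; apply: (@measurable_comp _ _ _ _ _ _ QT u Om (fun x => (t, x))).
- exact: mQT.
- by move=> _ [x Ox <-].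
- exact: mu.
- by apply: measurable_funTS; exact: measurable_pair1.
Qed.

Context (k : R).
Hypothesis k0 : 0 < k.

Let mSu : measurable_fun QT (fun z => strunc k (u z)).
Proof. exact: (measurable_comp_QT (@smooth_strunc _ k) mu). Qed.

Lemma mass_le (tau l : R) : 0 < tau -> 0 < l ->
  \int[lebst]_(z in QT) (`|strunc k (u z)| * cyl tau l z) <= tau * (K * l `^ (N%:R - B)).
Proof.
move=> tau0 l0; apply: cylinder_integral_le => //.
- by rewrite mulr_ge0 ?powR_ge0// addr_ge0 ?exprn_ge0 ?powR_ge0.
- apply: (bounded_integr_QT oOm Omoo T0 (M := k)); first exact: measurableT_comp.
  by move=> z _; rewrite normr_id strunc_bounded.
- apply: (ae_impl _ uM) => t uMt tT.
  have mut := measurable_slice tT.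
  have mb := @measurable_box R N (- l) l.
  apply: le_trans (slice_L1_le oOm rho1 M0 l0 mut (uMt tT)).
  apply: ge0_le_integral => //.
  + apply/measurable_EFinP; apply: measurable_funM; last exact: measurable_indic.
    by apply: measurableT_comp => //; exact: (measurable_comp_smooth (@smooth_strunc _ k)).
  + apply/measurable_EFinP; apply: measurable_funM; last exact: measurable_indic.
    exact: measurableT_comp.
  + by move=> x _; rewrite lee_fin ler_wpM2r// strunc_le.
Qed.

Context (D : R).
Hypothesis D0 : 0 <= D.
Hypothesis dD : forall y : R, `|dcutoff y| <= D.

Lemma bumpN_indic (m : R) (x : 'rV[R]_N) : 0 < m -> bumpN m x <= \1_(box (- m) m) x.
Proof.
move=> m0; rewrite indicE; have [_|] := boolP (x \in _).
  by have /andP[] := bumpN_itv m x.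
by rewrite notin_setE => nb; rewrite bumpN_out.
Qed.

Lemma QT_time_ge0 z : QT z -> 0 <= z.1.
Proof. by move=> [/= + _]; rewrite in_itv /= => /andP[/ltW]. Qed.

(** The factor 1/theta from the time derivative cancels the length of the time interval, so the
    bound does not see [theta]. *)
Lemma flux_le (theta m : R) : 0 < theta -> 0 < m ->
  \int[lebst]_(z in QT) (- strunc k (u z) * (derive1 (tcutoff theta) z.1 * bumpN m z.2)) <=
  D * (K * m `^ (N%:R - B)).
Proof.
move=> th0 m0.
have sb : smooth (@bumpN R N m) by apply: smooth_tensor => i; exact/smooth_scale/smooth_cutoff.
have mc := @measurable_cyl R N Om T theta m.
have iSc : integQT (fun z => `|strunc k (u z)| * cyl theta m z).
  apply: (bounded_integr_QT oOm Omoo T0 (M := k)).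
    by apply: measurable_funM => //; exact: measurableT_comp.
  move=> z _; have /andP[c0 c1] := cyl_itv theta m z.
  rewrite normrM normr_id (ger0_norm c0) (le_trans _ (strunc_bounded k0 (u z)))//.
  by rewrite ler_piMr.
have -> : D * (K * m `^ (N%:R - B)) = D / theta * (theta * (K * m `^ (N%:R - B))).
  by field; rewrite gt_eqF.
apply: (@le_trans _ _ (D / theta * \int[lebst]_(z in QT) (`|strunc k (u z)| * cyl theta m z))); last first.
  by rewrite ler_wpM2l ?mass_le// divr_ge0// ltW.
rewrite -(@RintegralZl _ _ _ lebst QT _ _ mQT)//.
have pw z : QT z -> `|- strunc k (u z) * (derive1 (tcutoff theta) z.1 * bumpN m z.2)| <=
    D / theta * (`|strunc k (u z)| * cyl theta m z).
  move=> Qz; have /andP[b0 _] := bumpN_itv m z.2.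
  rewrite normrM normrN mulrCA ler_wpM2l// normrM (ger0_norm b0) /cyl mulrA.
  by rewrite ler_pM// ?bumpN_indic// derive1_tcutoff_le// QT_time_ge0.
have iZ : integQT (fun z => D / theta * (`|strunc k (u z)| * cyl theta m z)).
  exact: integrZl_QT.
apply: (@ae_le_Rintegral _ _ _ lebst QT mQT) => //.
  apply: (le_integr_QT oOm _ iZ pw).
  apply: measurable_funM; first exact: measurable_funN.
  apply: measurable_funM; last exact: measurable_space.
  exact: measurable_time (smooth_derive1 (smooth_tcutoff theta)).
by apply: aeW => z Qz; exact: le_trans (ler_norm _) (pw z Qz).
Qed.

Context (G : R * 'rV[R]_N -> 'rV[R]_N).
Hypothesis uG : L2H10 Om T (fun z => truncation k (u z)) G.

Context (gamma q : R) (u0 : 'rV[R]_N -> R).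
Hypothesis q1 : 1 < q.
Hypothesis q2 : q <= 2.

Definition dissipation (tau l : R) : R := \int[lebst]_(z in QT)
  (enorm (G z) `^ q * derive1 (strunc k) (u z) * cyl tau l z).

Let mG i : measurable_fun QT (fun z => G z 0 i).
Proof. by case: uG => _ GL _; move: (GL i) => /in_Lp2P-/(_ mQT)[]. Qed.

Let mGq : measurable_fun QT (fun z => enorm (G z) `^ q * derive1 (strunc k) (u z)).
Proof.
apply: measurable_funM.
  exact: (measurableT_comp (@measurable_powR R q) (measurable_enorm mG)).
exact: (measurable_comp_QT (smooth_derive1 (@smooth_strunc _ k)) mu).
Qed.

Let Gq0 z : 0 <= enorm (G z) `^ q * derive1 (strunc k) (u z).
Proof. by have /andP[? _] := derive1_strunc_itv k0 (u z); rewrite mulr_ge0 ?powR_ge0. Qed.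

Lemma dissipation_integr (g : R * 'rV[R]_N -> R) : measurable_fun QT g ->
  (forall z, QT z -> 0 <= g z <= 1) ->
  integQT (fun z => enorm (G z) `^ q * derive1 (strunc k) (u z) * g z).
Proof.
move=> mg g01; apply: (le_integr_QT oOm _ (integr_gradient_power oOm Omoo T0 q1 q2 uG)).
  exact: measurable_funM.
move=> z Qz; have /andP[g0 g1] := g01 z Qz.
have /andP[s0 s1] := derive1_strunc_itv k0 (u z).
rewrite ger0_norm; last by rewrite mulr_ge0 ?Gq0.
by rewrite -mulrA ler_piMr ?powR_ge0// mulr_ile1.
Qed.

(** The field vanishes off the box of size [l] and has size r^(1-N); on the cylinder [le_powR_split]
    trades the gradient for its dissipation. Integrability is recorded as well because
    [flux_oscillation] splits the integral. *)
Lemma field_le (tau r l lam : R) : 0 < tau -> 0 < r -> r <= l -> 0 < lam ->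
  integQT (fun z => derive1 (tcutoff tau) z.1 *
      \sum_j derive1 (strunc k) (u z) * G z 0 j * tensor (step_field r l j) z.2) /\
  `|\int[lebst]_(z in QT) (derive1 (tcutoff tau) z.1 *
      \sum_j derive1 (strunc k) (u z) * G z 0 j * tensor (step_field r l j) z.2)| <=
  D / tau * (N%:R * (2 * r * (r^-1) ^+ N)) *
    (lam * (tau * (2 * l) ^+ N) + lam `^ (1 - q) * dissipation tau l).
Proof.
move=> tau0 r0 rl lam0; have l0 := lt_le_trans r0 rl.
have mc := @measurable_cyl R N Om T tau l.
have ic : integQT (cyl tau l).
  apply: (bounded_integr_QT oOm Omoo T0 (M := 1)) => // z _.
  by have /andP[? ?] := cyl_itv tau l z; rewrite ger0_norm.
have iI := dissipation_integr mc (fun z _ => cyl_itv tau l z).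
pose c := D / tau * (N%:R * (2 * r * (r^-1) ^+ N)).
have c0 : 0 <= c.
  by rewrite !mulr_ge0 ?invr_ge0 ?exprn_ge0 ?invr_ge0 ?(ltW tau0) ?(ltW r0).
pose W z := c * (lam * cyl tau l z + lam `^ (1 - q) *
  (enorm (G z) `^ q * derive1 (strunc k) (u z) * cyl tau l z)).
have iW : integQT W.
  by apply: integrZl_QT => //; apply: integrD_QT => //; exact: integrZl_QT.
have WE : \int[lebst]_(z in QT) W z = c * (lam * (\int[lebst]_(z in QT) cyl tau l z) +
    lam `^ (1 - q) * dissipation tau l).
  rewrite (@RintegralZl _ _ _ lebst QT _ _ mQT); last first.
    by apply: integrD_QT => //; exact: integrZl_QT.
  rewrite (@RintegralD _ _ _ lebst QT _ _ mQT); [|exact: integrZl_QT|exact: integrZl_QT].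
  by rewrite (@RintegralZl _ _ _ lebst QT _ _ mQT)// (@RintegralZl _ _ _ lebst QT _ _ mQT).
have sF j : smooth (tensor (step_field (N := N) r l j)).
  by apply: smooth_tensor => i; exact: smooth_step_field.
pose V z := derive1 (tcutoff tau) z.1 *
   \sum_j derive1 (strunc k) (u z) * G z 0 j * tensor (step_field r l j) z.2.
have mV : measurable_fun QT V.
  apply: measurable_funM; first exact: measurable_time (smooth_derive1 (smooth_tcutoff tau)).
  apply: measurable_sum => j; apply: measurable_funM; last exact: measurable_space.
  apply: measurable_funM => //.
  exact: (measurable_comp_QT (smooth_derive1 (@smooth_strunc _ k)) mu).
have VW z : QT z -> `|V z| <= W z.
  move=> Qz; have /andP[s0 s1] := derive1_strunc_itv k0 (u z).
  have e0 := enorm_ge0 (G z).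
  have ze := derive1_tcutoff_le tau0 dD (QT_time_ge0 Qz).
  pose F := \row_j tensor (step_field (N := N) r l j) z.2.
  have VE : V z = derive1 (tcutoff tau) z.1 * (derive1 (strunc k) (u z) * dot (G z) F).
    rewrite /V /dot; congr (_ * _); rewrite mulr_sumr; apply: eq_bigr => j _.
    by rewrite mxE mulrA.
  have [bz|nbz] := pselect (box (- l) l z.2); last first.
    rewrite VE (_ : dot _ _ = 0).
      rewrite !mulr0 normr0 /W /cyl [\1_(box _ _) _]indicE memNset// !mulr0.
      by rewrite addr0 mulr0.
    rewrite /dot big1// => j _; rewrite mxE (tensor_out _ nbz) ?mulr0// => i s.
    exact: step_field_out.
  have d1 j : `|F 0 j| <= 2 * r * (r^-1) ^+ N by rewrite mxE step_field_le.
  rewrite VE normrM.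
  have bE : \1_(box (- l) l) z.2 = 1 :> R by rewrite indicE mem_set.
  apply: (@le_trans _ _ (D / tau * \1_(`[0, tau]%classic) z.1 *
      (N%:R * ((lam + lam `^ (1 - q) * (enorm (G z) `^ q * derive1 (strunc k) (u z))) *
       (2 * r * (r^-1) ^+ N))))); last first.
    rewrite /W /c /cyl bE le_eqVlt; apply/orP; left; apply/eqP; ring.
  apply: ler_pM => //.
  rewrite normrM (ger0_norm s0).
  apply: (le_trans (ler_wpM2l s0 (dot_le (G z) d1))).
  rewrite [leLHS](_ : _ = N%:R * ((derive1 (strunc k) (u z) * enorm (G z)) *
    (2 * r * (r^-1) ^+ N))); last by ring.
  rewrite ler_wpM2l// ler_wpM2r//.
    by rewrite mulr_ge0 ?mulr_ge0 ?exprn_ge0 ?invr_ge0 ?(ltW r0).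
  apply: (@le_trans _ _ (derive1 (strunc k) (u z) * (lam + lam `^ (1 - q) * enorm (G z) `^ q))).
    by rewrite ler_wpM2l// le_powR_split// ltW.
  rewrite mulrDr lerD//; first by rewrite ler_piMl// ltW.
  by rewrite le_eqVlt; apply/orP; left; apply/eqP; ring.
have iV : integQT V by exact: (le_integr_QT oOm mV iW VW).
split=> //; apply: (le_trans (@Rintegral_norm_le _ _ _ lebst QT mQT V W iV iW VW)).
rewrite WE ler_wpM2l// lerD2r ler_wpM2l ?(ltW lam0)//.
by apply: cyl_measure_le => //; rewrite ltW.
Qed.

Hypothesis gamma0 : 0 < gamma.
Hypothesis mu0 : measurable_fun Om u0.
Hypothesis usol : renormalized_solution Om T gamma q u0 u.

Context (E : R * 'rV[R]_N -> R) (e Cy C1 : R).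
Hypothesis iE : integQT E.
Hypothesis E0 : forall z, 0 <= E z.
Hypothesis Ee : \int[lebst]_(z in QT) E z <= e.
Hypothesis aeE : {ae lebst, forall z, QT z ->
    `|derive1 (derive1 (strunc k)) (u z)| * dot (G z) (G z) <= E z}.
Hypothesis Cy0 : 0 < Cy.
Hypothesis young : forall a b, 0 <= a -> 0 <= b ->
  a * b <= gamma / 2 * a `^ q + Cy * b `^ (q / (q - 1)).
Hypothesis C10 : 0 < C1.
Hypothesis dC1 : forall l, 0 < l -> forall i (x : 'rV[R]_N),
  `|dx i (bumpN l) x| <= C1 / l * bumpN l x `^ q^-1.

(** Applied twice: with [tau] and [r] to see the initial datum, with [2 * tau] and [2 * l] to bound
    the dissipation. The condition [theta <= T] makes the time cutoff vanish at [T]. *)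
Lemma energy_bump (theta m : R) : 0 < theta -> theta <= T -> 0 < m ->
  box (- m) m `<=` Om ->
  \int[leb]_(x in Om) (strunc k (u0 x) * bumpN m x) +
  gamma / 2 * \int[lebst]_(z in QT)
     (enorm (G z) `^ q * derive1 (strunc k) (u z) * (tcutoff theta z.1 * bumpN m z.2)) <=
  \int[lebst]_(z in QT) (- strunc k (u z) * (derive1 (tcutoff theta) z.1 * bumpN m z.2)) +
  Cy * (N%:R * (C1 / m)) `^ (q / (q - 1)) * (theta * (2 * m) ^+ N) + e.
Proof.
move=> th0 thT m0 mO.
have := energy_inequality oOm Omoo T0 q1 q2 gamma0 mu0 usol young k0 uG iE E0 Ee aeE
  (smooth_tcutoff theta) (tcutoff_itv theta) (tcutoff_out th0 thT) (test_bumpN m0 mO)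
  (bumpN_itv m) (divr_ge0 (ltW C10) (ltW m0)) (ltW Cy0) (dC1 m0) (@measurable_box R N (- m) m)
  (fun x => @bumpN_out R N m x m0).
rewrite tcutoff0 mul1r => /le_trans; apply.
rewrite lerD2r lerD2l ler_wpM2l// ?mulr_ge0 ?powR_ge0 ?(ltW Cy0)//.
apply: le_trans (cyl_measure_le oOm Omoo T0 th0 (ltW m0)).
have mb : measurable_fun setT (\1_(box (- m) m) : 'rV[R]_N -> R).
  by apply: measurable_indic; exact: measurable_box.
have pw z : QT z -> `|tcutoff theta z.1 * \1_(box (- m) m) z.2| <= cyl theta m z.
  move=> Qz; have /andP[t0 _] := tcutoff_itv theta z.1.
  rewrite normrM (ger0_norm t0) ger0_norm; last by rewrite indicE.
  by rewrite ler_wpM2r ?indicE ?tcutoff_le// -?indicE ?tcutoff_le// QT_time_ge0.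
have ic : integQT (cyl theta m).
  apply: (bounded_integr_QT oOm Omoo T0 (M := 1)); first exact: measurable_cyl.
  by move=> z _; have /andP[? ?] := cyl_itv theta m z; rewrite ger0_norm.
apply: (@ae_le_Rintegral _ _ _ lebst QT mQT) => //.
  apply: (le_integr_QT oOm _ ic pw).
  apply: measurable_funM; first exact: measurable_time (smooth_tcutoff theta).
  by apply: measurable_funTS; exact: (measurableT_comp mb measurable_snd).
by apply: aeW => z Qz; exact: le_trans (ler_norm _) (pw z Qz).
Qed.

Hypothesis u0_ge0 : {ae leb, forall x, Om x -> 0 <= u0 x}.

Lemma initial_integr (m : R) : 0 < m ->
  leb.-integrable Om (EFin \o (fun x => strunc k (u0 x) * bumpN m x)).
Proof.
move=> m0; apply: (@bounded_integr _ _ _ leb Om mOm _ k) => //.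
  apply: measurable_funM; first exact: (measurable_comp_smooth (@smooth_strunc _ k)).
  by apply: smooth_measurable; apply: smooth_tensor => i; exact/smooth_scale/smooth_cutoff.
move=> x _; have /andP[b0 b1] := bumpN_itv m x.
rewrite normrM (ger0_norm b0) (le_trans _ (strunc_bounded k0 (u0 x)))//.
by rewrite ler_piMr.
Qed.

(** With duration and size both doubled, the test function is at least cutoff(1/2)^(N+1) on the
    original cylinder: one factor for time and N for space. The initial term is nonnegative and
    dropped. *)
Lemma dissipation_le (tau l : R) : 0 < tau -> 2 * tau <= T -> 0 < l ->
  box (- (2 * l)) (2 * l) `<=` Om ->
  cutoff (2^-1 : R) ^+ N.+1 * (gamma / 2) * dissipation tau l <=
  D * (K * (2 * l) `^ (N%:R - B)) +
  Cy * (N%:R * (C1 / (2 * l))) `^ (q / (q - 1)) * (2 * tau * (2 * (2 * l)) ^+ N) + e.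
Proof.
move=> tau0 tauT l0 lO.
have t20 : 0 < 2 * tau by rewrite mulr_gt0.
have l20 : 0 < 2 * l by rewrite mulr_gt0.
apply: le_trans (le_trans (energy_bump t20 tauT l20 lO) _); last first.
  by rewrite !lerD2r flux_le.
rewrite -[leLHS]add0r lerD//.
  rewrite (_ : 0 = \int[leb]_(x in Om) (fun=> 0 : R) x); last by rewrite /Rintegral integral0.
  apply: (@ae_le_Rintegral _ _ _ leb Om mOm); [|exact: initial_integr|].
    exact: (@integr_cst _ _ _ leb Om mOm Omoo 0).
  apply: (ae_impl _ u0_ge0) => x u0x Ox; have /andP[b0 _] := bumpN_itv (2 * l) x.
  by rewrite mulr_ge0// -(strunc0 k) strunc_mono// u0x.
rewrite [leLHS](_ : _ = gamma / 2 * (cutoff (2^-1 : R) ^+ N.+1 * dissipation tau l)); last first.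
  by ring.
rewrite ler_wpM2l ?divr_ge0 ?(ltW gamma0)//.
have c0 : 0 <= cutoff (2^-1 : R) by exact: cutoff_ge0.
have mc := @measurable_cyl R N Om T tau l.
have iI := dissipation_integr mc (fun z _ => cyl_itv tau l z).
rewrite -(@RintegralZl _ _ _ lebst QT _ _ mQT iI).
have tb01 z : QT z -> 0 <= tcutoff (2 * tau) z.1 * bumpN (2 * l) z.2 <= 1.
  move=> _; have /andP[a0 a1] := tcutoff_itv (2 * tau) z.1.
  by have /andP[b0 b1] := bumpN_itv (2 * l) z.2; rewrite mulr_ge0//= mulr_ile1.
have mtb : measurable_fun QT (fun z => tcutoff (2 * tau) z.1 * bumpN (2 * l) z.2).
  apply: measurable_funM; first exact: measurable_time (smooth_tcutoff _).
  by apply: measurable_space; apply: smooth_tensor => i; exact/smooth_scale/smooth_cutoff.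
apply: (@ae_le_Rintegral _ _ _ lebst QT mQT).
- exact: integrZl_QT.
- exact: dissipation_integr.
apply: aeW => z Qz; rewrite mulrCA ler_wpM2l//.
have /andP[a0 _] := tcutoff_itv (2 * tau) z.1.
have /andP[b0 _] := bumpN_itv (2 * l) z.2.
rewrite /cyl !indicE; have [t1|_] := boolP (z.1 \in _); last by rewrite mul0r mulr0 mulr_ge0.
have [b1|_] := boolP (z.2 \in _); last by rewrite !mulr0 mulr_ge0.
rewrite !mulr1 exprS ler_pM ?exprn_ge0//.
  move: t1 => /set_mem; rewrite /= in_itv /= => /andP[t1 t2].
  apply: cutoff_mono; rewrite ger0_norm ?mulr_ge0 ?invr_ge0 ?(ltW t20)//.
  by rewrite [`|2^-1|]ger0_norm ?invr_ge0// ler_pdivrMl// mulrAC divff ?mul1r.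
apply: bumpN_ge => //; move/set_mem : b1.
by rewrite mulrAC divff ?mul1r.
Qed.

Lemma flux_integr (theta m : R) : 0 < theta ->
  integQT (fun z => - strunc k (u z) * (derive1 (tcutoff theta) z.1 * bumpN m z.2)).
Proof.
move=> th0; apply: (bounded_integr_QT oOm Omoo T0 (M := k * (D / theta))).
  apply: measurable_funM; first exact: measurable_funN.
  apply: measurable_funM; first exact: measurable_time (smooth_derive1 (smooth_tcutoff theta)).
  by apply: measurable_space; apply: smooth_tensor => i; exact/smooth_scale/smooth_cutoff.
move=> z _; have /andP[b0 b1] := bumpN_itv m z.2.
rewrite normrM normrN ler_pM ?strunc_bounded// normrM (ger0_norm b0).
by rewrite (le_trans _ (derive1_tcutoff_bounded th0 z.1 dD))// ler_piMr.
Qed.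

(** Applied directly at scale [r], [flux_le] would only give r^(-N/rho). The flux is moved to scale
    [l] instead, and [field_le] pays for the move. *)
Lemma flux_oscillation (tau r l lam : R) : 0 < tau -> 0 < r -> r <= l -> 0 < lam ->
  box (- l) l `<=` Om ->
  (r^-1) ^+ N * \int[lebst]_(z in QT)
    (- strunc k (u z) * (derive1 (tcutoff tau) z.1 * bumpN r z.2)) <=
  (l^-1) ^+ N * (D * (K * l `^ (N%:R - B))) +
  D / tau * (N%:R * (2 * r * (r^-1) ^+ N)) *
    (lam * (tau * (2 * l) ^+ N) + lam `^ (1 - q) * dissipation tau l).
Proof.
move=> tau0 r0 rl lam0 lO; have l0 := lt_le_trans r0 rl.
have [iV VW] := field_le tau0 r0 rl lam0.
have iXr := flux_integr r tau0; have iXl := flux_integr l tau0.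
have osc := oscillation_identity oOm Omoo T0 k0 r0 rl lO mu (smooth_tcutoff tau)
  (fun t => derive1_tcutoff_bounded tau0 t dD) uG.
pose fX m z := - strunc k (u z) * (derive1 (tcutoff tau) z.1 * bumpN m z.2).
pose V z := derive1 (tcutoff tau) z.1 *
   \sum_j derive1 (strunc k) (u z) * G z 0 j * tensor (step_field r l j) z.2.
have E1 : \int[lebst]_(z in QT) ((- (r^-1) ^+ N * fX r z + (l^-1) ^+ N * fX l z) + V z) = 0.
  rewrite -[RHS]osc; apply: eq_Rintegral => z _; rewrite /fX /V.
  by rewrite mulrDr; congr (_ + _); ring.
move: E1; rewrite (@RintegralD _ _ _ lebst QT _ _ mQT)//; last first.
  by apply: integrD_QT => //; exact: integrZl_QT.
rewrite (@RintegralD _ _ _ lebst QT _ _ mQT); [|exact: integrZl_QT|exact: integrZl_QT].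
rewrite (@RintegralZl _ _ _ lebst QT _ _ mQT)// (@RintegralZl _ _ _ lebst QT _ _ mQT)//.
have Xl : (l^-1) ^+ N * \int[lebst]_(z in QT) fX l z <= (l^-1) ^+ N * (D * (K * l `^ (N%:R - B))).
  by rewrite ler_wpM2l ?flux_le// exprn_ge0// invr_ge0 ltW.
have Yl : \int[lebst]_(z in QT) V z <= D / tau * (N%:R * (2 * r * (r^-1) ^+ N)) *
    (lam * (tau * (2 * l) ^+ N) + lam `^ (1 - q) * dissipation tau l).
  exact: le_trans (ler_norm _) VW.
rewrite mulNr -addrA addrC => /eqP; rewrite subr_eq0 => /eqP <-.
exact: lerD Xl Yl.
Qed.

(** The constant has N factors cutoff(1/2) from [bumpN_ge] and one from [strunc_ge]. The latter
    needs the value (N r)^-b to be at most k/2, whence the assumption on [k]; [N * r < 1] keeps the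
    points in the unit ball. *)
Lemma initial_ge (b r : R) : (0 < N)%N -> 0 < b -> 0 < r -> N%:R * r < 1 ->
  box (- r) r `<=` Om -> 2 * (N%:R * r) `^ (- b) <= k ->
  {ae leb, forall x, Om x ->
     u0 x >= enorm x `^ (- b) * \1_[set y : 'rV[R]_N | enorm y < 1] x} ->
  cutoff (2^-1 : R) ^+ N.+1 * (N%:R * r) `^ (- b) * (r / 4) ^+ N <=
  \int[leb]_(x in Om) (strunc k (u0 x) * bumpN r x).
Proof.
(* This box avoids the origin, where a negative power takes the default value 0; it lies in the
   half-size box where the bump is bounded below, and has volume (r/4)^N. *)
move=> N0 b0 r0 Nr rO kb hu0; pose A : set 'rV[R]_N := box (r / 4) (r / 2).
have N1 : 1 <= N%:R :> R by rewrite ler1n.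
have Nr0 : 0 < N%:R * r by rewrite mulr_gt0// ltr0n.
have mA : measurable A by exact: measurable_box.
have AO : A `<=` Om.
  by apply: subset_trans rO; apply: subset_box; move: r0; lra.
pose c := cutoff (2^-1 : R) ^+ N.+1 * (N%:R * r) `^ (- b).
have c0 : 0 <= c by rewrite mulr_ge0 ?powR_ge0// exprn_ge0// cutoff_ge0.
have mI : measurable_fun Om (\1_A : 'rV[R]_N -> R) by exact: measurable_indic.
have iI : leb.-integrable Om (EFin \o (\1_A : 'rV[R]_N -> R)).
  apply: (@bounded_integr _ _ _ leb Om mOm _ 1) => // x _.
  by rewrite indicE; case: (_ \in _); rewrite ?normr1 ?normr0.
have -> : (r / 4) ^+ N = \int[leb]_(x in Om) (\1_A x : R).
  rewrite /Rintegral integral_indic//.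
  have -> : A `&` Om = A by apply/setIidPl.
  have r42 : r / 4 <= r / 2 by move: r0; lra.
  rewrite (_ : r / 4 = r / 2 - r / 4); last by field.
  exact: (congr1 fine (esym (@lebesgue_box R N _ _ r42))).
rewrite -(@RintegralZl _ _ _ leb Om _ _ mOm iI).
apply: (@ae_le_Rintegral _ _ _ leb Om mOm).
- exact: (@integrZl _ _ _ leb Om mOm).
- exact: initial_integr.
apply: (ae_impl2 _ u0_ge0 hu0) => x u0x0 u0x Ox.
have S0 : 0 <= strunc k (u0 x) by rewrite -(strunc0 k) strunc_mono// u0x0.
have /andP[b'0 _] := bumpN_itv r x.
rewrite indicE; have [/set_mem Ax|_] := boolP (x \in A); last by rewrite mulr0 mulr_ge0.
rewrite mulr1 [leLHS](_ : _ = (cutoff (2^-1 : R) * (N%:R * r) `^ (- b)) * cutoff (2^-1 : R) ^+ N).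
  2: by rewrite /c exprS; ring.
have c20 : 0 <= cutoff (2^-1 : R) := cutoff_ge0 _.
apply: ler_pM; [by apply: mulr_ge0 => //; exact: powR_ge0|exact: exprn_ge0| |]; last first.
  by apply: bumpN_ge => //; apply: subset_box Ax => //; move: r0; lra.
pose i0 := Ordinal N0.
have ex0 : 0 < enorm x.
  rewrite (lt_le_trans _ (coor_le_enorm x i0))// normr_gt0 gt_eqF//.
  by have /andP[+ _] := Ax i0; apply: lt_le_trans; rewrite divr_gt0.
have exr : enorm x <= N%:R * r.
  rewrite -(@ler_pXn2r _ 2)// ?nnegrE ?enorm_ge0 ?(ltW Nr0)//.
  rewrite enorm_sqr /dot exprMn.
  apply: (@le_trans _ _ (\sum_(i < N) r ^+ 2)).
    apply: ler_sum => i _; rewrite -expr2 lerXn2r ?nnegrE//.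
    - by have /andP[+ _] := Ax i; apply: le_trans; rewrite divr_ge0// ltW.
    - exact: ltW.
    - have /andP[_ /le_trans] := Ax i; apply.
      by rewrite ler_pdivrMr// ler_peMr ?(ltW r0)// ler1n.
  rewrite sumr_const card_ord -[_ *+ N]mulr_natl ler_wpM2r ?sqr_ge0// expr2 ler_peMl//.
have {}u0x : (N%:R * r) `^ (- b) <= u0 x.
  apply: (le_trans _ (u0x Ox)); rewrite indicE mem_set /= ?mulr1; last exact: le_lt_trans Nr.
  rewrite !powRN lef_pV2 ?posrE ?powR_gt0//.
  by rewrite ge0_ler_powR ?nnegrE ?(ltW b0) ?(ltW ex0) ?(ltW Nr0).
apply: le_trans (strunc_mono k0 u0x); apply: strunc_ge => //.
by rewrite powR_ge0 ler_pdivlMr// mulrC.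
Qed.

(** The factor r^-N turns integrals at scale [r] into means. At this scale the dissipation is only
    used through its sign; its size matters at scale [l], inside [flux_oscillation]. *)
Lemma mean_inequality (b tau r l lam : R) : (0 < N)%N -> 0 < b ->
  0 < tau -> 2 * tau <= T -> 0 < r -> r <= l -> N%:R * r < 1 -> 0 < lam ->
  box (- l) l `<=` Om -> 2 * (N%:R * r) `^ (- b) <= k ->
  {ae leb, forall x, Om x ->
     u0 x >= enorm x `^ (- b) * \1_[set y : 'rV[R]_N | enorm y < 1] x} ->
  (r^-1) ^+ N * (cutoff (2^-1 : R) ^+ N.+1 * (N%:R * r) `^ (- b) * (r / 4) ^+ N) <=
  (l^-1) ^+ N * (D * (K * l `^ (N%:R - B))) +
  D / tau * (N%:R * (2 * r * (r^-1) ^+ N)) *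
    (lam * (tau * (2 * l) ^+ N) + lam `^ (1 - q) * dissipation tau l) +
  (r^-1) ^+ N * (Cy * (N%:R * (C1 / r)) `^ (q / (q - 1)) * (tau * (2 * r) ^+ N) + e).
Proof.
move=> N0 b0 tau0 tauT r0 rl Nr lam0 lO kb hu0.
have l0 := lt_le_trans r0 rl.
have rO : box (- r) r `<=` Om.
  by apply: subset_trans lO; apply: subset_box => //; rewrite lerN2.
have tT : tau <= T by rewrite (le_trans _ tauT)// ler_peMl ?(ltW tau0)// ler1n.
have rN : 0 <= (r^-1) ^+ N by rewrite exprn_ge0// invr_ge0 ltW.
have ini := ler_wpM2l rN (initial_ge N0 b0 r0 Nr rO kb hu0).
have en := ler_wpM2l rN (energy_bump tau0 tT r0 rO).
have osc := flux_oscillation tau0 r0 rl lam0 lO.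
have Y0 : 0 <= gamma / 2 * \int[lebst]_(z in QT) (enorm (G z) `^ q *
    derive1 (strunc k) (u z) * (tcutoff tau z.1 * bumpN r z.2)).
  rewrite mulr_ge0 ?divr_ge0 ?(ltW gamma0)//; apply: Rintegral_ge0 => z _.
  have /andP[a0 _] := tcutoff_itv tau z.1; have /andP[b'0 _] := bumpN_itv r z.2.
  by rewrite mulr_ge0// mulr_ge0.
have := mulr_ge0 rN Y0.
move: ini en osc; rewrite !mulrDr; lra.
Qed.

End estimates.

(** * Choice of the scales *)

(** The last five conditions say that the five terms of [scale_bounds], multiplied by r^b, are
    positive powers of [r] when l = r^(1-eps), tau = r^t and lam = r^(-b-1+eps1). At eps = eps1 = 0
    and b = B the five exponents are 0, 0, q + B(q-1) - t, q(B+1-A) and t - (1+A-B), with A =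
    1/(q-1). A suitable [t] makes the last three positive, and a small perturbation opens the first
    two. *)
Lemma scaling_exponents (R : realType) (N : nat) (q B : R) :
  1 < q -> 0 < B -> (q - 1)^-1 < B + 1 ->
  exists eps t b eps1 : R, [/\ 0 < eps < 1, 0 < t, 0 < b < B &
   [/\ 0 < b - B * (1 - eps),
       0 < b + (1 - N%:R + (- b - 1 + eps1) + N%:R * (1 - eps)),
       0 < b + (1 - N%:R - t + (1 - q) * (- b - 1 + eps1) + (N%:R - B) * (1 - eps)),
       0 < b + (1 - N%:R + (1 - q) * (- b - 1 + eps1) + (N%:R - q / (q - 1)) * (1 - eps)) &
       0 < b + (- (q / (q - 1)) + t)]].
Proof.
move=> q1 B0; set A := (q - 1)^-1 => AB.
have q10 : 0 < q - 1 by rewrite subr_gt0.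
have A0 : 0 < A by rewrite invr_gt0.
have qA : (q - 1) * A = 1 by rewrite mulfV// gt_eqF.
have q'A : q / (q - 1) = 1 + A by rewrite -/A -qA; ring.
rewrite q'A.
have Bq : 0 < B * (q - 1) by rewrite mulr_gt0.
have q0 : 0 < q := lt_trans ltr01 q1.
have qBA : 0 < q * (B + 1 - A) by apply: mulr_gt0; [exact: lt_trans q1|rewrite subr_gt0].
(* Lower end of the window for [t]. The upper end q + B(q-1) exceeds 1 + A - B by exactly q(B+1-A),
   because qA = 1 + A. *)
pose m0 := Num.max 0 (1 + A - B).
have m00 : 0 <= m0 by rewrite le_max lexx.
have m01 : 1 + A - B <= m0 by rewrite le_max lexx orbT.
have m02 : m0 < q + B * (q - 1).
  rewrite gt_max; apply/andP; split; first by rewrite addr_gt0.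
  by move: qBA; rewrite mulrDr mulrBr; lra.
pose t := (m0 + (q + B * (q - 1))) / 2.
(* The slack available in the last three conditions before perturbation. *)
pose g := Num.min (t - m0) (Num.min (q + B * (q - 1) - t) (q * (B + 1 - A))).
have g0 : 0 < g by rewrite !lt_min qBA andbT; apply/andP; split; rewrite /t; lra.
have g1 : g <= t - m0 by rewrite ge_min lexx.
have g2 : g <= q + B * (q - 1) - t by rewrite !ge_min lexx orbT.
have g3 : g <= q * (B + 1 - A) by rewrite !ge_min lexx !orbT.
(* Total of the coefficients of [eps] that the perturbation can introduce; [eps * Kb < g] then
   preserves the slack. *)
pose Kb := B + q * B + (q - 1) * (N%:R + 1) + N%:R + 1.
have N0 : 0 <= N%:R :> R by [].
have Kb0 : 1 <= Kb.
  have z1 : 0 <= q * B by rewrite mulr_ge0 ?ltW.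
  have z2 : 0 <= (q - 1) * (N%:R + 1) by apply: mulr_ge0; [exact: ltW|exact: addr_ge0].
  by rewrite /Kb; lra.
have Kb1 : 0 < Kb by rewrite (lt_le_trans ltr01).
pose eps := Num.min (1 / 2) (g / (2 * Kb)).
have eps0 : 0 < eps by rewrite lt_min divr_gt0//= divr_gt0// mulr_gt0.
have eps12 : eps <= 1 / 2 by rewrite ge_min lexx.
have epsK : eps * Kb < g.
  have : eps <= g / (2 * Kb) by rewrite ge_min lexx orbT.
  rewrite ler_pdivlMr ?mulr_gt0// => h; rewrite (lt_le_trans _ h)//.
  by rewrite mulrCA ltr_pMl ?mulr_gt0// ltr1n.
have e1 : 0 <= eps * B by rewrite mulr_ge0 ?ltW.
have e2 : 0 <= q * (eps * B) by rewrite mulr_ge0 ?(ltW q0).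
have e3 : 0 <= (q - 1) * eps by apply: mulr_ge0; exact: ltW.
have e4 : 0 <= N%:R * eps by rewrite mulr_ge0 ?(ltW eps0) ?(ltW A0).
have e5 : 0 <= (q - 1) * (N%:R * eps) by apply: mulr_ge0 => //; exact: ltW.
have e6 : 0 <= A * eps by rewrite mulr_ge0 ?(ltW eps0) ?(ltW A0).
have e7 : 0 < eps * B by rewrite mulr_gt0.
have t0 : 0 < t by rewrite /t; lra.
(* With this [b] the first exponent is eps B / 2, and with [eps1 = (N + 1) eps] the second is
   [eps]. *)
exists eps, t, (B - eps * B / 2), ((N%:R + 1) * eps).
have b1 : eps * B <= 1 / 2 * B by rewrite ler_pM2r.
have epsK' : eps * B + q * (eps * B) + ((q - 1) * (N%:R * eps) + (q - 1) * eps) + N%:R * eps + eps < g.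
  by rewrite (le_lt_trans _ epsK)// le_eqVlt; apply/orP; left; apply/eqP; rewrite /Kb; ring.
have qA' : q * A = 1 + A by rewrite -[in RHS]qA; ring.
split; [lra|lra|lra|split].
- lra.
- lra.
- rewrite (_ : _ + _ = (q + B * (q - 1) - t) - (q * (eps * B) / 2 +
    ((q - 1) * (N%:R * eps) + (q - 1) * eps) + N%:R * eps - eps * B)); last by field.
  lra.
- rewrite (_ : _ + _ = q * B + q - (1 + A) - (q * (eps * B) / 2 +
    ((q - 1) * (N%:R * eps) + (q - 1) * eps) + N%:R * eps - eps - A * eps)); last by field.
  have g3' : g <= q * B + q - (1 + A) by move: g3; rewrite -qA' mulrBr mulrDr mulr1.
  lra.
- lra.
Qed.

Lemma powRB_nat (R : realType) (r x : R) (n : nat) : 0 < r ->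
  r `^ (n%:R - x) = r ^+ n * r `^ (- x).
Proof.
by move=> r0; rewrite powRD ?powR_mulrn ?(ltW r0)// (gt_eqF r0) implybT.
Qed.

(** [P] is fixed before the scales, so only powers of [r], [l], [tau] and [lam] remain to be
    compared. [I] stands for the dissipation, its assumption for [dissipation_le], and [p] for 1 -
    q; the truncation error is already set to r^N l^-B. *)
Lemma scale_bounds (R : realType) (N : nat) (q' B D K Cy C1 c3 p : R) :
  0 <= D -> 0 <= K -> 0 <= Cy -> 0 < C1 -> 0 < c3 ->
  exists2 P : R, 0 < P & forall r l tau lam I : R,
    0 < r -> r <= l -> 0 < tau -> 0 < lam ->
    c3 * I <= D * (K * (2 * l) `^ (N%:R - B)) +
      Cy * (N%:R * (C1 / (2 * l))) `^ q' * (2 * tau * (2 * (2 * l)) ^+ N) +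
      r ^+ N * l `^ (- B) ->
    (l^-1) ^+ N * (D * (K * l `^ (N%:R - B))) +
    D / tau * (N%:R * (2 * r * (r^-1) ^+ N)) *
      (lam * (tau * (2 * l) ^+ N) + lam `^ p * I) +
    (r^-1) ^+ N * (Cy * (N%:R * (C1 / r)) `^ q' * (tau * (2 * r) ^+ N) +
      r ^+ N * l `^ (- B)) <=
    P * (l `^ (- B) + r `^ (1 - N%:R) * lam * l ^+ N +
         r `^ (1 - N%:R) * tau^-1 * lam `^ p * l `^ (N%:R - B) +
         r `^ (1 - N%:R) * lam `^ p * l `^ (N%:R - q') +
         r `^ (- q') * tau).
Proof.
move=> D0 K0 Cy0 C10 c30.
(* Each [Pi] is the constant of the i-th term. The [+ 1] in [P1] and in [P3] absorbs the truncation
   error, which is l^-B after division by r^N and at most l^(N-B) inside the dissipation. *)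
pose P1 := D * K + 1.
pose P2 : R := 2 * D * N%:R * 2 ^+ N.
pose P3 := 2 * D * N%:R * c3^-1 * (D * K * 2 `^ (N%:R - B) + 1).
pose P4 := 2 * D * N%:R * c3^-1 * (Cy * (N%:R * C1 / 2) `^ q' * (2 * 4 ^+ N)).
pose P5 := Cy * (N%:R * C1) `^ q' * 2 ^+ N.
have c3V : 0 <= c3^-1 by rewrite invr_ge0 ltW.
have N0 : 0 <= N%:R :> R by [].
have DN0 : 0 <= 2 * D * N%:R by rewrite !mulr_ge0.
have P10 : 0 <= P1 by rewrite addr_ge0// mulr_ge0.
have P20 : 0 <= P2 by rewrite mulr_ge0// exprn_ge0.
have P30 : 0 <= P3 by rewrite mulr_ge0 ?mulr_ge0// addr_ge0// !mulr_ge0// powR_ge0.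
have P40 : 0 <= P4 by rewrite !mulr_ge0// ?powR_ge0 ?exprn_ge0.
have P50 : 0 <= P5 by rewrite !mulr_ge0// ?powR_ge0 ?exprn_ge0.
exists (1 + (P1 + P2 + P3 + P4 + P5)).
  by rewrite (lt_le_trans ltr01)// lerDl; do 4![apply: addr_ge0 => //].
move=> r l tau lam I r0 rl tau0 lam0 hI.
have l0 : 0 < l := lt_le_trans r0 rl.
have rne : r != 0 by rewrite gt_eqF.
have lne : l != 0 by rewrite gt_eqF.
have taune : tau != 0 by rewrite gt_eqF.
pose W1 := l `^ (- B); pose W2 := r `^ (1 - N%:R) * lam * l ^+ N.
pose W3 := r `^ (1 - N%:R) * tau^-1 * lam `^ p * l `^ (N%:R - B).
pose W4 := r `^ (1 - N%:R) * lam `^ p * l `^ (N%:R - q').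
pose W5 := r `^ (- q') * tau.
rewrite -/W1 -/W2 -/W3 -/W4 -/W5.
have W10 : 0 <= W1 by rewrite powR_ge0.
have W20 : 0 <= W2 by rewrite !mulr_ge0 ?powR_ge0 ?exprn_ge0 ?(ltW lam0) ?(ltW l0).
have W30 : 0 <= W3 by rewrite !mulr_ge0 ?powR_ge0// invr_ge0 ltW.
have W40 : 0 <= W4 by rewrite !mulr_ge0 ?powR_ge0.
have W50 : 0 <= W5 by rewrite !mulr_ge0 ?powR_ge0// ltW.
have r1N : r `^ (1 - N%:R) = r * (r^-1) ^+ N.
  by rewrite powRD ?rne ?implybT// powRr1 ?(ltW r0)// powRN powR_mulrn ?(ltW r0)// exprVn.
have q'E (c s : R) : 0 <= c -> 0 < s -> (c * s^-1) `^ q' = c `^ q' * s `^ (- q').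
  by move=> c0 s0; rewrite powRM ?invr_ge0 ?(ltW s0)// -powR_inv1 ?(ltW s0)// -powRrM mulN1r.
have e1 : (l^-1) ^+ N * (D * (K * l `^ (N%:R - B))) = D * K * W1.
  rewrite powRB_nat// -/W1 exprVn; field; exact: expf_neq0.
have e5 : (r^-1) ^+ N * (Cy * (N%:R * (C1 / r)) `^ q' * (tau * (2 * r) ^+ N) +
      r ^+ N * l `^ (- B)) = P5 * W5 + W1.
  have -> : N%:R * (C1 / r) = N%:R * C1 * r^-1 by rewrite mulrA.
  rewrite q'E ?mulr_ge0 ?(ltW C10)// -/W1 exprMn exprVn /P5 /W5; field; exact: expf_neq0.
have IE : I <= c3^-1 * ((D * K * 2 `^ (N%:R - B) + 1) * l `^ (N%:R - B) +
    Cy * (N%:R * C1 / 2) `^ q' * (2 * 4 ^+ N) * (tau * l `^ (N%:R - q'))).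
  rewrite ler_pdivlMl//; apply: (le_trans hI).
  have -> : N%:R * (C1 / (2 * l)) = (N%:R * C1 / 2) * l^-1 by field.
  rewrite q'E ?divr_ge0 ?mulr_ge0 ?(ltW C10)// powRM ?(ltW l0)// mulrA !exprMn.
  have el : r ^+ N * l `^ (- B) <= l `^ (N%:R - B).
    rewrite powRB_nat// ler_wpM2r ?powR_ge0// lerXn2r ?nnegrE ?(ltW r0) ?(ltW l0)//.
  have -> : 4 ^+ N = 2 ^+ N * 2 ^+ N :> R by rewrite -exprMn; congr (_ ^+ _); ring.
  rewrite (powRB_nat q')//.
  apply: (le_trans (lerD (lexx _) el)); rewrite le_eqVlt; apply/orP; left; apply/eqP; ring.
have e2 : D / tau * (N%:R * (2 * r * (r^-1) ^+ N)) *
      (lam * (tau * (2 * l) ^+ N) + lam `^ p * I) <= P2 * W2 + P3 * W3 + P4 * W4.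
  rewrite (_ : D / tau * _ = 2 * D * N%:R * (r `^ (1 - N%:R) / tau)); last by rewrite r1N; ring.
  apply: (@le_trans _ _ (2 * D * N%:R * (r `^ (1 - N%:R) / tau) *
     (lam * (tau * (2 * l) ^+ N) + lam `^ p * (c3^-1 * ((D * K * 2 `^ (N%:R - B) + 1) * l `^ (N%:R - B) +
    Cy * (N%:R * C1 / 2) `^ q' * (2 * 4 ^+ N) * (tau * l `^ (N%:R - q'))))))).
    rewrite ler_wpM2l//; first by rewrite mulr_ge0// divr_ge0 ?powR_ge0// ltW.
    by rewrite lerD2l ler_wpM2l// powR_ge0.
  rewrite exprMn le_eqVlt; apply/orP; left; apply/eqP.
  rewrite /P2 /P3 /P4 /W2 /W3 /W4; field.
  by rewrite taune gt_eqF.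
rewrite e1 e5.
have m1 : (D * K + 1) * W1 <= P1 * W1 by [].
have PW : P1 * W1 + P2 * W2 + P3 * W3 + P4 * W4 + P5 * W5 <=
    (1 + (P1 + P2 + P3 + P4 + P5)) * (W1 + W2 + W3 + W4 + W5).
  move: P10 P20 P30 P40 P50 W10 W20 W30 W40 W50; clear.
  move: P1 P2 P3 P4 P5 W1 W2 W3 W4 W5 => P1 P2 P3 P4 P5 W1 W2 W3 W4 W5.
  move=> P10 P20 P30 P40 P50 W10 W20 W30 W40 W50.
  by rewrite !mulrDr; repeat apply: lerD; rewrite ler_wpM2r//; lra.
apply: le_trans PW; move: e2; rewrite /P1; lra.
Qed.

Lemma box_subset_nbhs (R : realType) (n : nat) (U : set 'rV[R]_n) :
  open U -> U 0 -> exists2 d, 0 < d & box (- d) d `<=` U.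
Proof.
move=> oU U0; have /nbhs_ballP[e /= e0 eU] := open_nbhs_nbhs (conj oU U0).
exists (e / 2); first by rewrite divr_gt0.
move=> x xb; apply: eU; split=> // i j; rewrite ord1 mxE /ball /= sub0r normrN.
rewrite (@le_lt_trans _ _ (e / 2))//; first by rewrite ler_norml.
by rewrite ltr_pdivrMr// ltr_pMr// ltr1n.
Qed.

Lemma seq_positive_lower_bound (R : realType) (ys : seq R) :
  {in ys, forall y, 0 < y} -> exists2 x, 0 < x & {in ys, forall y, x <= y}.
Proof.
elim: ys => [|z ys IH] ys0; first by exists 1.
have [y yy|x x0 xy] := IH; first by rewrite ys0// inE yy orbT.
exists (Num.min z x); first by rewrite lt_min x0 ys0// mem_head.
move=> y; rewrite inE => /predU1P[->|yy]; first by rewrite ge_min lexx.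
by rewrite ge_min xy ?orbT.
Qed.

Lemma small_powers (R : realType) (s : R) (ys : seq R) : 0 < s <= 1 ->
  {in ys, forall y, 0 < y} ->
  exists2 r : R, 0 < r & {in ys, forall y, r `^ y <= s}.
Proof.
move=> /andP[s0 s1] /seq_positive_lower_bound[x x0 xy].
(* [x] is a lower bound of the exponents, so r^y = s^(y/x) with y/x >= 1 and s <= 1. *)
exists (s `^ x^-1); first by rewrite powR_gt0.
move=> y /xy xy'; rewrite -powRrM -[leRHS]powRr1 ?(ltW s0)//.
by rewrite ger_powR ?s0// mulrC ler_pdivlMr// mul1r.
Qed.

Theorem theorem7p1 (R : realType) (N : nat) (q rho : R)
    (hN : (2 < N)%N)
    (hq : 2 - N%:R / N.+1%:R < q) (hq2 : q < 2)
    (hrho1 : 1 <= rho) (hrho : rho < N%:R * (q - 1) / (2 - q)) :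
  exists delta : R, 0 < delta /\
    forall (Om : set 'rV[R]_N) (T gamma : R) (u0 : 'rV[R]_N -> R),
      open Om -> bounded_set Om -> Om 0 -> 0 < T -> 0 < gamma ->
      measurable_fun Om u0 ->
      {ae lebesgue_rV R N, forall x, Om x ->
        u0 x >= enorm x `^ (- (N%:R / rho) + delta)
                * \1_[set y : 'rV[R]_N | enorm y < 1] x} ->
      ~ exists u : R * 'rV[R]_N -> R,
          [/\ renormalized_solution Om T gamma q u0 u,
              in_LinftyLp Om T rho u &
              in_L2H10 Om T (fun z => `|u z| `^ (rho / 2))].
Proof.
have N0 : (0 < N)%N by exact: ltn_trans hN.
have NR0 : 0 < N%:R :> R by rewrite ltr0n.
have rho0 : 0 < rho := lt_le_trans ltr01 hrho1.
have q1 : 1 < q.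
  apply: lt_trans hq; rewrite ltrBrDr addrC -ltrBrDr ltr_pdivrMr ?ltr0n//.
  by rewrite [2 - 1](_ : _ = 1); [rewrite mul1r ltr_nat|ring].
have q10 : 0 < q - 1 by rewrite subr_gt0.
pose B := N%:R / rho; have B0 : 0 < B by rewrite divr_gt0.
(* The hypothesis rho < sigma, in the form (2-q)/(q-1) < N/rho. *)
have AB : (q - 1)^-1 < B + 1.
  rewrite -ltrBlDr (_ : _ - 1 = (2 - q) / (q - 1)); last by field; rewrite gt_eqF.
  rewrite ltr_pdivrMr// /B mulrAC ltr_pdivlMr// mulrC.
  by move: hrho; rewrite ltr_pdivlMr// subr_gt0.
have [eps [t [b [eps1 [/andP[eps0 eps_1] t0 /andP[b0 bB] [x1 x2 x3 x4 x5]]]]]] :=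
  scaling_exponents N q1 B0 AB.
(* All exponents are fixed here from q, rho and N, before the domain, the time, gamma and the datum
   are introduced; the datum then dominates |x|^-b near 0. *)
exists (B - b); split; first by rewrite subr_gt0.
move=> Om T gamma u0 oOm bOm Om0 T0 gamma0 mu0 hu0 [u [usol uLinf urho]].
have Omoo := bounded_lebesgue_rV (open_measurable_rV oOm) bOm.
have {}hu0 : {ae lebesgue_rV R N, forall x, Om x ->
    u0 x >= enorm x `^ (- b) * \1_[set y : 'rV[R]_N | enorm y < 1] x}.
  by move: hu0; rewrite (_ : - (N%:R / rho) + (B - b) = - b)// /B; ring.
have u0_ge0 : {ae lebesgue_rV R N, forall x, Om x -> 0 <= u0 x}.
  by apply: (ae_impl _ hu0) => x ux Ox; apply: le_trans (ux Ox); rewrite mulr_ge0 ?powR_ge0.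
have [[mu _] _ _] := usol.
have [_ [M' uM']] := uLinf; pose M := Num.max M' 0.
have M0 : 0 <= M by rewrite le_max lexx orbT.
have uM : {ae @lebesgue_measure R, forall t, t \in `]0, T[ ->
    (Lp_norm (lebesgue_rV R N) rho%:E Om (fun x => u (t, x)) <= M%:E)%E}.
  apply: (ae_impl _ uM') => s us sT; apply: (le_trans (us sT)).
  by rewrite lee_fin le_max lexx.
have [D D0 dD] := @dcutoff_bounded R.
have [C1 C10 dC1] := dx_bumpN_le N q1.
have [Cy Cy0 young] := young_weighted q1 (divr_gt0 gamma0 (ltr0n R 2)).
have [d d0 dOm] := box_subset_nbhs oOm Om0.
pose K : R := 2 ^+ N + M `^ rho.
have K0 : 0 <= K by rewrite addr_ge0 ?powR_ge0 ?exprn_ge0.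
have c0 : 0 < cutoff (2^-1 : R).
  by rewrite cutoff_gt0// ger0_norm ?invr_ge0// invf_lt1// ltr1n.
pose c3 := cutoff (2^-1 : R) ^+ N.+1 * (gamma / 2).
have c30 : 0 < c3 by rewrite mulr_gt0 ?exprn_gt0// divr_gt0.
have [P P0 bounds] := @scale_bounds R N (q / (q - 1)) B D K Cy C1 c3 (1 - q)
  (ltW D0) K0 (ltW Cy0) C10 c30.
pose c4 : R := cutoff (2^-1 : R) ^+ N.+1 * N%:R `^ (- b) * (4^-1) ^+ N.
have c40 : 0 < c4.
  apply: mulr_gt0; last by rewrite exprn_gt0// invr_gt0.
  by apply: mulr_gt0; [exact: exprn_gt0|exact: powR_gt0].
(* One smallness threshold for all uses, in order: r <= 1, N r < 1, 2 tau <= T, the box of size 2 l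
   inside Om, and the final contradiction. *)
have [s s0 ssP] : exists2 s : R, 0 < s &
    {in [:: 1; (N%:R + 1)^-1; T / 2; d / 2; c4 / (5 * P + 1)], forall y, s <= y}.
  apply: seq_positive_lower_bound => y.
  have NN : 0 < N%:R + 1 :> R by rewrite addr_gt0.
  have PP : 0 < 5 * P + 1 by rewrite addr_gt0// mulr_gt0.
  by rewrite !inE => /or4P[/eqP ->|/eqP ->|/eqP ->|/predU1P[->|/eqP ->]];
    rewrite ?invr_gt0// divr_gt0.
have /andP[/andP[s1 sN] /andP[/andP[sT sd] sc]] :
    (s <= 1) && (s <= (N%:R + 1)^-1) && ((s <= T / 2) && (s <= d / 2) && (s <= c4 / (5 * P + 1))).
  by rewrite !ssP// !inE eqxx ?orbT.
(* Exponents of the powers of [r] to be made small: [r], [tau] and [l], then the five error terms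
   multiplied by r^b. *)
pose xs : seq R := [:: 1; t; 1 - eps; b - B * (1 - eps);
  b + (1 - N%:R + (- b - 1 + eps1) + N%:R * (1 - eps));
  b + (1 - N%:R - t + (1 - q) * (- b - 1 + eps1) + (N%:R - B) * (1 - eps));
  b + (1 - N%:R + (1 - q) * (- b - 1 + eps1) + (N%:R - q / (q - 1)) * (1 - eps));
  b + (- (q / (q - 1)) + t)].
have [r r0 rs] : exists2 r : R, 0 < r & {in xs, forall y, r `^ y <= s}.
  apply: small_powers => [|y]; first by rewrite s0.
  rewrite !inE => /or4P[/eqP ->|/eqP ->|/eqP ->|/or4P[/eqP ->|/eqP ->|/eqP ->|/predU1P[->|/eqP ->]]]//.
  by rewrite subr_gt0.
have r1 : r <= s by have := rs 1; rewrite powRr1 ?(ltW r0)//; apply; rewrite mem_head.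
pose l := r `^ (1 - eps); pose tau := r `^ t; pose lam := r `^ (- b - 1 + eps1).
have l0 : 0 < l by rewrite powR_gt0.
have tau0 : 0 < tau by rewrite powR_gt0.
have lam0 : 0 < lam by rewrite powR_gt0.
have ls : l <= s by apply: rs; rewrite !inE eqxx ?orbT.
have taus : tau <= s by apply: rs; rewrite !inE eqxx ?orbT.
have rl : r <= l.
  rewrite -[leLHS](powRr1 (ltW r0)) ger_powR ?r0 ?(le_trans r1)//.
  by rewrite lerBlDr lerDl ltW.
have tauT : 2 * tau <= T.
  by rewrite -ler_pdivlMl// mulrC (le_trans taus).
have Nr : N%:R * r < 1.
  have : r * (N%:R + 1) <= 1 by rewrite -ler_pdivlMr ?addr_gt0// mul1r (le_trans r1).
  by rewrite mulrDr mulr1 mulrC; apply: lt_le_trans; rewrite ltrDl.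
have lO : box (- (2 * l)) (2 * l) `<=` Om.
  have ld : 2 * l <= d by rewrite -ler_pdivlMl// mulrC (le_trans ls).
  by apply: subset_trans dOm; apply: subset_box => //; rewrite lerN2.
have lO' : box (- l) l `<=` Om.
  have l2 : l <= 2 * l by rewrite ler_peMl ?(ltW l0)// ler1n.
  by apply: subset_trans lO; apply: subset_box => //; rewrite lerN2.
(* With this tolerance the truncation error in the mean at scale [r] is l^-B, of the same order as
   the mean at scale [l]. *)
pose e := r ^+ N * l `^ (- B); have e0 : 0 < e by rewrite mulr_gt0 ?exprn_gt0// powR_gt0.
(* The level [k] is chosen last, after [r]: high enough for the datum at scale [r] not to be
   flattened, and for the truncation error to be at most [e]. *)
pose n0 := (Num.truncn (2 * (N%:R * r) `^ (- b))).+1.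
have [k [nk k0 [G [E [uG iE E0 Ee aeE]]]]] :=
  truncation_error oOm Omoo hrho1 usol urho n0 e0.
have kb : 2 * (N%:R * r) `^ (- b) <= k.
  by apply: le_trans nk; rewrite ltW// truncnS_gt.
have q2 := ltW hq2.
have dis := dissipation_le oOm Omoo T0 hrho1 M0 mu uM k0 (ltW D0) dD uG q1 q2 gamma0 mu0
  usol iE E0 Ee aeE Cy0 young C10 dC1 u0_ge0 tau0 tauT l0 lO.
have main := mean_inequality oOm Omoo T0 hrho1 M0 mu uM k0 (ltW D0) dD uG q1 q2 gamma0 mu0
  usol iE E0 Ee aeE Cy0 young C10 dC1 u0_ge0 N0 b0 tau0 tauT r0 rl Nr lam0 lO' kb hu0.
have := le_trans main (bounds r l tau lam _ r0 rl tau0 lam0 dis).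
have rne : r != 0 by rewrite gt_eqF.
have rD x y : r `^ (x + y) = r `^ x * r `^ y by rewrite powRD// rne implybT.
have lE y : r `^ (y * (1 - eps)) = l `^ y by rewrite mulrC powRrM.
have lEN : r `^ (N%:R * (1 - eps)) = l ^+ N by rewrite lE powR_mulrn// ltW.
have lhsE : (r^-1) ^+ N * (cutoff (2^-1 : R) ^+ N.+1 * (N%:R * r) `^ (- b) * (r / 4) ^+ N) =
    c4 * r `^ (- b).
  rewrite powRM ?(ltW r0)// /c4 [(r / 4) ^+ N]exprMn [r^-1 ^+ N]exprVn.
  set f := 4^-1 ^+ N; by field; exact: expf_neq0.
(* Multiplied by r^b, the lower bound becomes the constant [c4] and each of the five error terms at
   most [s], while 5 P s < s (5 P + 1) <= c4. *)
rewrite lhsE powRN ler_pdivrMr ?powR_gt0//; apply/negP; rewrite -ltNge.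
have W1 : l `^ (- B) * r `^ b <= s.
  rewrite -lE -rD (_ : _ + b = b - B * (1 - eps)); last by ring.
  by apply: rs; rewrite !inE eqxx ?orbT.
have W2 : r `^ (1 - N%:R) * lam * l ^+ N * r `^ b <= s.
  by rewrite -lEN mulrC -!rD; apply: rs; rewrite !inE eqxx ?orbT.
have W3 : r `^ (1 - N%:R) * tau^-1 * lam `^ (1 - q) * l `^ (N%:R - B) * r `^ b <= s.
  rewrite -lE /lam -powRrM -powRN mulrC [_ * (1 - q)]mulrC -!rD.
  by apply: rs; rewrite !inE eqxx ?orbT.
have W4 : r `^ (1 - N%:R) * lam `^ (1 - q) * l `^ (N%:R - q / (q - 1)) * r `^ b <= s.
  rewrite -lE /lam -powRrM mulrC [_ * (1 - q)]mulrC -!rD.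
  by apply: rs; rewrite !inE eqxx ?orbT.
have W5 : r `^ (- (q / (q - 1))) * tau * r `^ b <= s.
  by rewrite mulrC -!rD; apply: rs; rewrite !inE eqxx ?orbT.
apply: (@le_lt_trans _ _ (P * (5 * s))).
  rewrite -[leLHS]mulrA ler_wpM2l ?(ltW P0)//.
  rewrite (_ : 5 * s = s + s + s + s + s); last by ring.
  rewrite !mulrDl.
  by rewrite !lerD.
apply: (@lt_le_trans _ _ (s * (5 * P + 1))).
  rewrite (_ : s * (5 * P + 1) = P * (5 * s) + s); last by ring.
  by rewrite ltrDl.
by rewrite -ler_pdivlMr// addr_gt0// mulr_gt0.
Qed.
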